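(* Let $p\ge 1$, let $\pi \in \mathscr{S}_p$ be a permutation and let $\mathfrak{S}_\pi(\mathbf{t}, \mathbf{s}) \in \mathbb{Z}[t_1,\ldots,t_p,s_1,\ldots,s_p]$ be the corresponding double Schubert polynomial. Then the support $\mathrm{supp}(\mathfrak{S}_\pi) \subset \mathbb{N}^{2p}$ of $\mathfrak{S}_\pi$ is a discrete polymatroid on $[2p]=\{1,\ldots,2p\}$. In particular, $\mathfrak{S}_\pi$ has the Saturated Newton Polytope property.
   Context: $\mathbb{N}=\{0,1,2,\ldots\}$ and $[n]=\{1,\ldots,n\}$. Double Schubert polynomials. Let $\mathscr{S}_p$ be the symmetric group on $[p]$, and for $1\le i\le p-1$ let $\sigma_i=(i,i+1)\in\mathscr{S}_p$ be the adjacent transposition. The length $\ell(\pi)$ of a permutation $\pi$ is the least number of factors (counted with repetition) from $\{\sigma_1,\ldots,\sigma_{p-1}\}$ needed to write $\pi$ as a product. The permutation $\pi_0=(p,p-1,\ldots,2,1)$ (one-line notation) is the longest permutation, of length $p(p-1)/2$. The double Schubert polynomial $\mathfrak{S}_\pi=\mathfrak{S}_\pi(\mathbf{t},\mathbf{s})\in\mathbb{Z}[t_1,\ldots,t_p,s_1,\ldots,s_p]$ of $\pi \in \mathscr{S}_p$ is defined recursively: $\mathfrak{S}_{\pi_0}=\prod_{i+j\le p}(t_i-s_j)$ (product over $i,j\ge 1$), and for any permutation $\pi$ and transposition $\sigma_i$ with $\ell(\sigma_i\pi)<\ell(\pi)$, $$\mathfrak{S}_{\sigma_i\pi}=\frac{\mathfrak{S}_\pi-\sigma_i\mathfrak{S}_\pi}{t_i-t_{i+1}},$$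 where $\mathscr{S}_p$ acts only on the variables $t_1,\ldots,t_p$, by permuting them (the variables $s_j$ are fixed). Support and SNP. For a polynomial $f=\sum_{\mathbf{n}}c_{\mathbf{n}}\mathbf{x}^{\mathbf{n}}\in\mathbb{Z}[x_1,\ldots,x_n]$, the support is $\mathrm{supp}(f)=\{\mathbf{n}\in\mathbb{N}^n\mid c_{\mathbf{n}}\neq 0\}$ and the Newton polytope $\mathrm{Newton}(f)$ is the convex hull of $\mathrm{supp}(f)$ (in $\mathbb{R}^n$). The polynomial $f$ has the Saturated Newton Polytope property if $\mathrm{supp}(f)=\mathrm{Newton}(f)\cap\mathbb{N}^n$. For $\mathfrak{S}_\pi$ the variables are ordered as $t_1,\ldots,t_p,s_1,\ldots,s_p$. Discrete polymatroids. A rank function on $[n]$ is a function $r:2^{[n]}\to\mathbb{N}$ such that (i) $r(\emptyset)=0$; (ii) $r(\mathfrak{J}_1)\le r(\mathfrak{J}_2)$ if $\mathfrak{J}_1\subseteq\mathfrak{J}_2\subseteq[n]$; (iii) $r(\mathfrak{J}_1\cap\mathfrak{J}_2)+r(\mathfrak{J}_1\cup\mathfrak{J}_2)\le r(\mathfrak{J}_1)+r(\mathfrak{J}_2)$ for all $\mathfrak{J}_1,\mathfrak{J}_2\subseteq[n]$. A discrete polymatroid on $[n]$ is a subset of $\mathbb{N}^n$ of the form $$\Big\{(x_1,\ldots,x_n)\in\mathbb{N}^n \;\Big|\; \sum_{j\in\mathfrak{J}}x_j\le r(\mathfrak{J})\ \text{for all } \mathfrak{J}\subsetneq[n],\ \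 \sum_{i\in[n]}x_i=r([n])\Big\}$$ for some rank function $r$ on $[n]$. *)

(* Defs.v *)
From HB Require Import structures.
From mathcomp Require Import all_boot all_order all_algebra all_fingroup.
From mathcomp Require Import reals.
From mathcomp Require Import mpoly.
From mathcomp Require Import zify.

Set Implicit Arguments.
Unset Strict Implicit.
Unset Printing Implicit Defensive.

Import Order.TTheory GRing.Theory Num.Theory.

Local Open Scope ring_scope.

(* [adj1 i] and [adj2 i] are the consecutive indices i and i + 1 of 'I_p;
   indices are 0-based, so i : 'I_p.-1 stands for i + 1 in {1, ..., p - 1}. *)
Lemma adj1_proof p (i : 'I_p.-1) : (i < p)%N.
Proof. by case: p i => [|n] [i] //= /ltnW. Qed.

Lemma adj2_proof p (i : 'I_p.-1) : (i.+1 < p)%N.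
Proof. by case: p i => [|n] [i]. Qed.

Definition adj1 p (i : 'I_p.-1) : 'I_p := Ordinal (adj1_proof i).
Definition adj2 p (i : 'I_p.-1) : 'I_p := Ordinal (adj2_proof i).

Definition sigma p (i : 'I_p.-1) : 'S_p := tperm (adj1 i) (adj2 i).

Definition word_prod p (w : seq 'I_p.-1) : 'S_p := (\prod_(i <- w) sigma i)%g.

(* Inversions are only used to prove that the definitions below make sense. *)
Definition inversions p (pi : 'S_p) : {set 'I_p * 'I_p} :=
  [set x : 'I_p * 'I_p | (x.1 < x.2)%N && (pi x.2 < pi x.1)%N].

Lemma sigmaE p (i : 'I_p.-1) (x : 'I_p) :
  sigma i x = (if x == i :> nat then i.+1 else
               if x == i.+1 :> nat then i : nat else x) :> nat.
Proof.
rewrite /sigma; case: tpermP => [->|->|] /=; rewrite ?eqxx //.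
  by case: eqP => // /eqP; rewrite eqn_leq ltnn.
by move=> n1 n2; case: eqP => [e|_]; [case: n1 | case: eqP => // e; case: n2];
  apply: val_inj.
Qed.

Lemma sigmaK p (i : 'I_p.-1) : (sigma i * sigma i = 1)%g.
Proof. exact: tperm2. Qed.

Lemma sigmaKl p (i : 'I_p.-1) (pi : 'S_p) : (sigma i * (sigma i * pi) = pi)%g.
Proof. by rewrite mulgA sigmaK mul1g. Qed.

Lemma card_inversions_up p (pi : 'S_p) (i : 'I_p.-1) :
  (pi (adj1 i) < pi (adj2 i))%N ->
  #|inversions (sigma i * pi)| = #|inversions pi|.+1.
Proof.
move=> lt_pi; pose h (x : 'I_p * 'I_p) := (sigma i x.1, sigma i x.2).
have hK : cancel h h by move=> [x y]; rewrite /h /= !tpermK.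
have -> : inversions (sigma i * pi)
          = (adj1 i, adj2 i) |: (h @: inversions pi).
  apply/setP => -[x y]; rewrite in_setU1 inE /= !permM.
  rewrite -[in RHS](hK (x, y)) (mem_imset _ _ (can_inj hK)) inE /=.
  have Exy : ((x, y) == (adj1 i, adj2 i))
             = (x == i :> nat) && (y == i.+1 :> nat) by [].
  have [/andP[/eqP ex /eqP ey]|nxy] :=
    boolP ((x == i :> nat) && (y == i.+1 :> nat)).
    have -> : x = adj1 i by apply: val_inj.
    have -> : y = adj2 i by apply: val_inj.
    by rewrite hK eqxx /= tpermR tpermL ltnSn lt_pi.
  rewrite hK Exy (negbTE nxy) /=.
  have [lt_s|le_s] := boolP (pi (sigma i y) < pi (sigma i x))%N;
    rewrite ?andbT ?andbF //.
  have nyx : ~~ ((y == i :> nat) && (x == i.+1 :> nat)).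
    apply/negP => /andP[/eqP ey /eqP ex]; move: lt_s.
    have -> : x = adj2 i by apply: val_inj.
    have -> : y = adj1 i by apply: val_inj.
    by rewrite tpermR tpermL ltnNge ltnW.
  rewrite !sigmaE; move: nxy nyx.
  case: (x =P i :> nat); case: (x =P i.+1 :> nat);
    case: (y =P i :> nat); case: (y =P i.+1 :> nat) => /=; lia.
rewrite cardsU1 card_imset; last exact: can_inj hK.
suff -> : (adj1 i, adj2 i) \notin h @: inversions pi by [].
rewrite -(hK (_, _)) (mem_imset _ _ (can_inj hK)) inE /=.
by rewrite !tpermL !tpermR /= ltnNge leqnSn.
Qed.

Lemma card_inversions_down p (pi : 'S_p) (i : 'I_p.-1) :
  (pi (adj2 i) < pi (adj1 i))%N ->
  #|inversions pi| = #|inversions (sigma i * pi)|.+1.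
Proof.
move=> lt_pi; rewrite -{1}(sigmaKl i pi); apply: card_inversions_up.
by rewrite !permM tpermL tpermR.
Qed.

Lemma adj_total p (pi : 'S_p) (i : 'I_p.-1) :
  (pi (adj1 i) < pi (adj2 i))%N || (pi (adj2 i) < pi (adj1 i))%N.
Proof.
rewrite -neq_ltn; apply/negP => /eqP e.
have /(congr1 val)/= : adj1 i = adj2 i by apply: (@perm_inj _ pi); apply: val_inj.
lia.
Qed.

Lemma no_descent p (pi : 'S_p) :
  (forall i : 'I_p.-1, (pi (adj1 i) < pi (adj2 i))%N) -> pi = 1%g.
Proof.
move=> up.
have step (x y : 'I_p) : y = x.+1 :> nat -> (pi x < pi y)%N.
  move=> exy; have hx : (x < p.-1)%N by have := ltn_ord y; lia.
  have := up (Ordinal hx).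
  have -> : adj1 (Ordinal hx) = x by apply: val_inj.
  by have -> : adj2 (Ordinal hx) = y by apply: val_inj.
have lower k (x : 'I_p) : x = k :> nat -> (k <= pi x)%N.
  elim: k x => // k IH x ex.
  have hk : (k < p)%N by have := ltn_ord x; lia.
  by have := IH (Ordinal hk) erefl; have := step (Ordinal hk) x ex; lia.
have upper k (x : 'I_p) : (x + k = p.-1)%N -> (pi x + k <= p.-1)%N.
  elim: k x => [|k IH] x ex; first by have := ltn_ord (pi x); lia.
  have hk : (x.+1 < p)%N by have := ltn_ord x; lia.
  have := IH (Ordinal hk); have := step x (Ordinal hk) erefl.
  by move=> /=; lia.
apply/permP => x; rewrite perm1; apply: val_inj => /=.
have := lower x x erefl; have := upper (p.-1 - x)%N x.
by have := ltn_ord x; lia.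
Qed.

Lemma word_inversions p (pi : 'S_p) :
  exists w : seq 'I_p.-1, word_prod w = pi /\ size w = #|inversions pi|.
Proof.
have [n] := ubnP #|inversions pi|; elim: n pi => // n IH pi ltn.
have [/forallP up|/forallPn[i dn]] :=
  boolP [forall i : 'I_p.-1, (pi (adj1 i) < pi (adj2 i))%N].
  exists [::]; rewrite (no_descent up) /word_prod big_nil; split=> //.
  apply/esym/eqP; rewrite cards_eq0; apply/eqP/setP => -[x y].
  by rewrite !inE /= !perm1; case: ltngtP.
have {}dn : (pi (adj2 i) < pi (adj1 i))%N.
  by have := adj_total pi i; rewrite (negbTE dn).
have e := card_inversions_down dn.
have [|w [wE sz]] := IH (sigma i * pi)%g; first by rewrite e in ltn.
exists (i :: w); split; last by rewrite /= sz e.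
by rewrite /word_prod big_cons -/(word_prod w) wE sigmaKl.
Qed.

Lemma exists_word p (pi : 'S_p) :
  exists k, [exists w : k.-tuple 'I_p.-1, word_prod w == pi].
Proof.
have [w [wE _]] := word_inversions pi.
by exists (size w); apply/existsP; exists (in_tuple w); apply/eqP.
Qed.

Definition perm_length p (pi : 'S_p) : nat := ex_minn (exists_word pi).

Lemma perm_lengthE p (pi : 'S_p) : perm_length pi = #|inversions pi|.
Proof.
rewrite /perm_length; case: ex_minnP => k /existsP[w /eqP wE] kmin.
apply/eqP; rewrite eqn_leq; apply/andP; split.
  have [u [uE <-]] := word_inversions pi.
  by apply: kmin; apply/existsP; exists (in_tuple u); apply/eqP.
rewrite -wE -[leqRHS](size_tuple w) {wE kmin}; elim: (tval w) => [|i u IH].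
  rewrite /word_prod big_nil leqn0 cards_eq0; apply/eqP/setP => -[x y].
  by rewrite !inE /= !perm1; case: ltngtP.
rewrite /word_prod big_cons -/(word_prod u) /=.
have /orP[lt|lt] := adj_total (word_prod u) i.
  by rewrite card_inversions_up.
by apply: leqW; apply: leq_trans IH; rewrite (card_inversions_down lt).
Qed.

Definition longest_perm p : 'S_p := perm (@rev_ord_inj p).

(* The 2p variables are t_1, ..., t_p followed by s_1, ..., s_p. *)
Definition tvar p (i : 'I_p) : {mpoly int[p + p]} := 'X_(lshift p i).
Definition svar p (j : 'I_p) : {mpoly int[p + p]} := 'X_(rshift p j).

Definition t_act p (w : 'S_p) (f : {mpoly int[p + p]}) :
    {mpoly int[p + p]} :=
  f \mPo [tuple match split k with
                | inl i => tvar (w i)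
                | inr j => svar j
                end | k < p + p].

(* [double_schubert pi f] : f is obtained by the recursion defining the double
   Schubert polynomial of pi, along some choice of descents starting from the
   longest permutation. The quotient by t_i - t_(i+1) is the unique g solving
   the stated equation, {mpoly int[p + p]} being an integral domain.
   The group law of 'S_p reads (sigma i * pi) x = pi (sigma i x), so that
   left multiplication by [sigma i] exchanges the entries in positions i and
   i + 1 of the one-line notation of pi. The opposite composition convention
   replaces the polynomial of pi by that of its inverse. *)
Inductive double_schubert p : 'S_p -> {mpoly int[p + p]} -> Prop :=
| double_schubert_longest :
    double_schubert (longest_perm p)
      (\prod_(i < p) \prod_(j < p | (i.+1 + j.+1 <= p)%N) (tvar i - svar j))
| double_schubert_step pi f i g :
    double_schubert pi f ->
    (perm_length (sigma i * pi)%g < perm_length pi)%N ->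
    f - t_act (sigma i) f = (tvar (adj1 i) - tvar (adj2 i)) * g ->
    double_schubert (sigma i * pi)%g g.

Lemma t_actX p (w : 'S_p) (k : 'I_(p + p)) :
  t_act w 'X_k = match split k with
                     | inl i => tvar (w i)
                     | inr j => svar j
                     end.
Proof. by rewrite /t_act comp_mpolyXU -tnth_nth tnth_mktuple. Qed.

Lemma divided_difference_exists p (i : 'I_p.-1) (f : {mpoly int[p + p]}) :
  exists g, f - t_act (sigma i) f = (tvar (adj1 i) - tvar (adj2 i)) * g.
Proof.
set d := tvar _ - _; pose P h := exists g, h - t_act (sigma i) h = d * g.
rewrite -/(P f).
have PD u v : P u -> P v -> P (u + v).
  move=> [gu eu] [gv ev]; exists (gu + gv); rewrite mulrDr -eu -ev.
  by rewrite /t_act raddfD /= opprD addrACA.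
have PM u v : P u -> P v -> P (u * v).
  move=> [gu eu] [gv ev]; exists (gu * v + t_act (sigma i) u * gv).
  rewrite mulrDr mulrA -eu mulrCA -ev /t_act rmorphM /= mulrBl mulrBr.
  by rewrite addrA subrK.
have PC c : P c%:MP.
  by exists 0; rewrite /t_act comp_mpolyC subrr mulr0.
have PX k : P 'X_k.
  rewrite /P t_actX; case: splitP => j ej; last first.
    exists 0; rewrite mulr0; apply/eqP; rewrite subr_eq0 /svar; apply/eqP.
    by congr 'X_(_); apply: val_inj.
  have -> : k = lshift p j by apply: val_inj.
  rewrite -/(tvar j) /sigma; case: tpermP => [->|->|_ _].
  - by exists 1; rewrite mulr1.
  - by exists (-1); rewrite mulrN1 opprB.
  - by exists 0; rewrite mulr0 subrr.
have P1 : P 1 by rewrite -[1]/(1%:MP_[p + p]); apply: PC.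
rewrite [f]mpolyE; apply: (big_ind P) => [|u v|m _].
- by rewrite -(mpolyC0 (p + p)); apply: PC.
- exact: PD.
rewrite -mul_mpolyC; apply: (PM) => //; rewrite mpolyXE_id.
apply: (big_ind P) => // k _.
by elim: (m k) => [|n IH]; rewrite ?expr0 // exprS; apply: PM.
Qed.

Lemma double_schubert_exists p (pi : 'S_p) : exists f, double_schubert pi f.
Proof.
have bound (w : 'S_p) : (#|inversions w| <= #|{: 'I_p * 'I_p}|)%N.
  exact: max_card.
have [n] := ubnP (#|{: 'I_p * 'I_p}| - #|inversions pi|)%N.
elim: n pi => // n IH pi ltn.
have [/forallP dn|/forallPn[i]] :=
  boolP [forall i : 'I_p.-1, ~~ (pi (adj1 i) < pi (adj2 i))%N].
  have e : (pi * longest_perm p = 1)%g.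
    apply: no_descent => i; rewrite !permM !permE /=.
    have := dn i; have := adj_total pi i; have := ltn_ord (pi (adj1 i)).
    lia.
  suff -> : pi = longest_perm p by eexists; apply: double_schubert_longest.
  have ll : (longest_perm p * longest_perm p = 1)%g.
    by apply/permP => x; rewrite permM perm1 !permE rev_ordK.
  by rewrite -[pi]mulg1 -ll mulgA e mul1g.
rewrite negbK => up; have e := card_inversions_up up.
have [|f df] := IH (sigma i * pi)%g.
  by have := bound (sigma i * pi)%g; lia.
have [g eg] := divided_difference_exists i f.
exists g; rewrite -(sigmaKl i pi); apply: double_schubert_step df _ eg.
by rewrite sigmaKl !perm_lengthE e.
Qed.

(* Points of N^n are represented by 'X_{1..n}, the type of exponents of
   monomials in n variables, i.e. n-tuples of natural numbers. *)
Definition rank_function n (r : {set 'I_n} -> nat) : Prop :=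
  [/\ r set0 = 0%N,
      forall J1 J2 : {set 'I_n}, J1 \subset J2 -> (r J1 <= r J2)%N &
      forall J1 J2 : {set 'I_n},
        (r (J1 :&: J2) + r (J1 :|: J2) <= r J1 + r J2)%N].

Definition discrete_polymatroid n (A : {pred 'X_{1..n}}) : Prop :=
  exists2 r : {set 'I_n} -> nat, rank_function r &
    forall x : 'X_{1..n},
      x \in A <->
      (forall J : {set 'I_n}, J \proper [set: 'I_n] ->
         (\sum_(j in J) x j <= r J)%N) /\
      (\sum_(i < n) x i)%N = r [set: 'I_n].

Definition convex_hull (R : realType) n (A : 'rV[R]_n -> Prop) (v : 'rV[R]_n) :
    Prop :=
  exists (k : nat) (c : 'I_k -> R) (a : 'I_k -> 'rV[R]_n),
    [/\ forall i, 0 <= c i, \sum_(i < k) c i = 1, forall i, A (a i) &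
        v = \sum_(i < k) c i *: a i].

Definition real_point (R : realType) n (m : 'X_{1..n}) : 'rV[R]_n :=
  \row_(i < n) (m i)%:R.

Definition newton (R : realType) n (f : {mpoly int[n]}) : 'rV[R]_n -> Prop :=
  convex_hull (fun v => exists2 m, m \in msupp f & v = real_point R m).

Definition saturated_newton_polytope (R : realType) n (f : {mpoly int[n]}) :
    Prop :=
  forall m : 'X_{1..n}, m \in msupp f <-> newton f (real_point R m).

(* Main.v *)
(* By Fomin and Kirillov, the double Schubert polynomial of w is a coefficient of
   a product of factors 1 + (t_i - s_j) u_(i+j) over the boxes of a grid, where the
   u_a generate the nilCoxeter algebra.  So the coefficient of a monomial has the
   sign (-1)^(degree in s), nothing cancels, and the exponents are the loads of
   the reduced pipe dreams of w, each box (i,j) being charged to t_i or to s_j.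

   Pipe dreams are compared with the linear matroid on the boxes obtained from
   the unit matrices E_ij modulo T = {dA w B + A w dB}, the tangent space at a
   point A w B (A lower, B upper triangular) of the matrix Schubert variety.
   - For generic A and B the boxes of every pipe dream span modulo T: this holds
     for the staircase, and removing a box degenerates w' + tau E_ij.
   - Conversely, let S be a set of boxes that spans modulo T, each charged to its
     row or to its column.  By Hensel's lemma one solves, modulo any power of X,
     the equation saying that a matrix with entries (1-X)^(ij) y_ij z_ij has the
     form A(X) w B(X), where y_ij and z_ij are linear forms in one free
     variable per row and column and one per box of S, and move along a line from
     their values at X = 0 to Vandermonde forms at X = 1.  The minors larger than
     the ranks of w then vanish modulo powers of X, while at X = 1 the weights
     isolate their antidiagonals.  If no pipe dream had the loads of S, every set
     of boxes that large would contain such an antidiagonal, and the monomial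
     basis of a space of multihomogeneous polynomials would be spanned by
     multiples of minors; a determinant that is nonzero at X = 1 would be
     divisible by every power of X.
   Hence the support consists of the loads of the independent sets of full rank,
   which by Rado's theorem are described by r(J) = rank of the boxes (i,j) whose
   row i or column j lies in J.  The inequalities also give saturation. *)
Require Import Defs.
From mathcomp Require Import all_boot all_order all_algebra all_fingroup.
From mathcomp Require Import reals.
From mathcomp Require Import mpoly.
From mathcomp Require Import zify ring.
From Stdlib Require Import Classical FunctionalExtensionality.

Set Implicit Arguments.
Unset Strict Implicit.
Unset Printing Implicit Defensive.

Import Order.TTheory GRing.Theory Num.Theory.

Local Open Scope ring_scope.

(** * Words and chains of boxes *)

Section Words.

Variable p : nat.
Implicit Types (w : 'S_p) (a x : nat) (l D : seq (nat * nat)).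

(* Total versions: positions out of range are fixed, generators out of range trivial. *)
Definition entry w x : nat := if (insub x : option 'I_p) is Some i then w i else x.

Definition simple a : 'S_p :=
  if (insub a : option 'I_p.-1) is Some i then sigma i else 1%g.

Definition nat_swap a x := if x == a then a.+1 else if x == a.+1 then a else x.

Lemma nat_swapE a x :
  x = a /\ nat_swap a x = a.+1 \/ x = a.+1 /\ nat_swap a x = a \/ x <> a /\ x <> a.+1 /\ nat_swap a x = x.
Proof.
rewrite /nat_swap; case: eqP => [->|?]; first by left.
by case: eqP => [->|?]; right; [left|right].
Qed.

Lemma entryE w (i : 'I_p) : entry w i = w i.
Proof. by rewrite /entry valK. Qed.

Lemma entry_ge w x : (p <= x)%N -> entry w x = x.
Proof. by move=> h; rewrite /entry insubF // ltnNge h. Qed.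

Lemma entry_lt w x : (entry w x < p)%N = (x < p)%N.
Proof.
have [h|h] := ltnP x p; last by rewrite entry_ge // ltnNge h.
by rewrite -[x]/(nat_of_ord (Ordinal h)) entryE ltn_ord.
Qed.

Lemma entry_inj w : injective (entry w).
Proof.
move=> x y e; have := entry_lt w x; rewrite e entry_lt.
have [hx|hx] := ltnP x p => hy; last first.
  by move: e; rewrite !entry_ge // leqNgt hy.
move: e; rewrite -[x]/(nat_of_ord (Ordinal hx)) -[y]/(nat_of_ord (Ordinal hy)).
by rewrite !entryE => /val_inj/perm_inj ->.
Qed.

Lemma entry1 x : entry 1%g x = x.
Proof.
have [h|h] := ltnP x p; last by rewrite entry_ge.
by rewrite -[x]/(nat_of_ord (Ordinal h)) entryE perm1.
Qed.

Lemma entryP w1 w2 : (forall x, (x < p)%N -> entry w1 x = entry w2 x) -> w1 = w2.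
Proof. by move=> h; apply/permP => i; apply: val_inj; have := h i (ltn_ord i); rewrite !entryE. Qed.

Lemma simpleE a (h : (a < p.-1)%N) : simple a = sigma (Ordinal h).
Proof. by rewrite /simple insubT. Qed.

Lemma simple_out a : (p.-1 <= a)%N -> simple a = 1%g.
Proof. by move=> h; rewrite /simple insubF // ltnNge h. Qed.

Lemma entry_simple a w x : (a.+1 < p)%N -> entry (simple a * w)%g x = entry w (nat_swap a x).
Proof.
move=> h; have h' : (a < p.-1)%N by lia.
rewrite (simpleE h'); have [hx|hx] := ltnP x p; last first.
  rewrite entry_ge // /nat_swap; case: eqP => [e|_]; first lia.
  by case: eqP => [e|_]; [lia|rewrite entry_ge].
rewrite -[in LHS](_ : nat_of_ord (Ordinal hx) = x) // entryE permM -entryE; congr entry.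
by rewrite sigmaE.
Qed.

Lemma simpleK a w : (simple a * (simple a * w))%g = w.
Proof.
have [h|h] := ltnP a p.-1; first by rewrite (simpleE h) sigmaKl.
by rewrite simple_out // !mul1g.
Qed.

(** * Descents, reduced words and the grid of boxes *)

Definition descent w a := (a.+1 < p)%N && (entry w a.+1 < entry w a)%N.

Lemma descent_simple w a : descent w a -> ~~ descent (simple a * w)%g a.
Proof.
case/andP => h lt; rewrite /descent h !entry_simple // /nat_swap !eqxx.
have -> : (a.+1 == a) = false by lia.
by rewrite -leqNgt ltnW.
Qed.

(** The letter of a box is the index of its antidiagonal, as for pipe dreams; asking for a descent
    at every step makes the word reduced. *)
Fixpoint reduced_word l w : bool :=
  if l is b :: l' then descent w (b.1 + b.2) && reduced_word l' (simple (b.1 + b.2) * w)%g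
  else w == 1%g.

Lemma reduced_word_size l w : reduced_word l w -> size l = #|inversions w|.
Proof.
elim: l w => [|b l IH] w /=.
  move/eqP=> ->; apply/esym/eqP; rewrite cards_eq0; apply/eqP/setP => -[x y].
  by rewrite !inE /= !perm1; case: ltngtP.
case/andP => /andP[h lt] /IH ->; have h' : (b.1 + b.2 < p.-1)%N by lia.
rewrite (simpleE h') -card_inversions_down //.
by rewrite -!entryE /=.
Qed.

(** The subwords of [grid p p] that are reduced words of [w] are its reduced pipe dreams, row 0
    being read last. *)
Fixpoint grid k : seq (nat * nat) :=
  if k is k'.+1 then [seq (k', j) | j <- iota 0 p] ++ grid k' else [::].

Lemma mem_grid k (b : nat * nat) : (b \in grid k) = (b.1 < k)%N && (b.2 < p)%N.
Proof.
case: b => i j; elim: k => [|k IH] //=; rewrite mem_cat IH /=.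
have -> : ((i, j) \in [seq (k, j0) | j0 <- iota 0 p]) = (i == k) && (j < p)%N.
  apply/mapP/andP => [[j0]|[/eqP -> h]].
    by rewrite mem_iota => h [-> ->].
  by exists j; rewrite ?mem_iota.
lia.
Qed.

Lemma uniq_grid k : uniq (grid k).
Proof.
elim: k => [|k IH] //=; rewrite cat_uniq IH andbT map_inj_uniq ?iota_uniq //; last by move=> ? ? [].
apply/hasPn => -[i j]; rewrite mem_grid /= => h; apply/negP => /mapP[j0 _ [e _]].
lia.
Qed.

(** * Rank counts and subwords *)

Definition rank_count w a b := count (fun x => entry w x < b)%N (iota 0 a).

Lemma rank_countS w a b : rank_count w a.+1 b = (rank_count w a b + (entry w a < b))%N.
Proof. by rewrite /rank_count -addn1 iotaD count_cat /= add0n addn0. Qed.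

(** Exchanging positions a and a + 1 permutes the first x positions among themselves unless x = a +
    1. *)
Lemma rank_count_simple w a x b : (a.+1 < p)%N -> x != a.+1 -> rank_count (simple a * w)%g x b = rank_count w x b.
Proof.
move=> h hx; elim/ltn_ind: x hx => -[|x] IH hx; first by [].
rewrite rank_countS [RHS]rank_countS entry_simple //.
have [e|ne] := eqVneq x a.+1; last first.
  rewrite IH // /nat_swap; have -> : (x == a) = false by lia.
  by rewrite (negbTE ne).
subst x; rewrite !rank_countS IH ?entry_simple //; last lia.
rewrite /nat_swap !eqxx; have -> : (a.+1 == a) = false by lia.
by rewrite addnAC.
Qed.

Lemma rank_count_full w b : (b <= p)%N -> rank_count w p b = b.
Proof.
move=> hb; rewrite /rank_count.
have -> : count (fun x => entry w x < b)%N (iota 0 p) = count (fun y => y < b)%N (map (entry w) (iota 0 p)).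
  by rewrite count_map.
have /seq.permP -> : perm_eq (map (entry w) (iota 0 p)) (iota 0 p).
  have u : uniq (map (entry w) (iota 0 p)) by rewrite map_inj_uniq ?iota_uniq //; exact: entry_inj.
  have s : {subset map (entry w) (iota 0 p) <= iota 0 p}.
    by move=> y /mapP[x]; rewrite !mem_iota => hx ->; rewrite entry_lt; lia.
  apply: uniq_perm; rewrite ?iota_uniq //.
  by have [] := uniq_min_size u s _; rewrite ?size_map.
rewrite -{1}(subnKC hb) iotaD count_cat.
have -> : count (fun y => y < b)%N (iota 0 b) = b.
  rewrite -[RHS](size_iota 0); apply/eqP; rewrite -all_count; apply/allP => y.
  by rewrite mem_iota.
rewrite add0n; suff -> : count (fun y => y < b)%N (iota b (p - b)) = 0%N by rewrite addn0.
apply/eqP; rewrite -leqn0 leqNgt -has_count; apply/hasPn => y; rewrite mem_iota; lia.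
Qed.

(* The rank function of the Demazure product of the letters e.1 + e.2 of the
   boxes of l lying in Z.  It is compared with the ranks of w to find reduced words
   of w, and counts the longest chains of boxes outside Z. *)
Fixpoint demazure_table (Z : pred (nat * nat)) l a b : nat :=
  if l is e :: l' then
    if Z e && (a == (e.1 + e.2).+1) then maxn (demazure_table Z l' a.-1 b) (demazure_table Z l' a.+1 b).-1
    else demazure_table Z l' a b
  else minn a b.

Lemma demazure_table_step Z l a b : (demazure_table Z l a b <= demazure_table Z l a.+1 b <= (demazure_table Z l a b).+1)%N /\ (demazure_table Z l a b <= b)%N.
Proof.
elim: l a => [|e l IH] a /=; first lia.
have [h1 h2] := IH a; have [h3 h4] := IH a.+1; have [h5 h6] := IH a.+2.
case: (Z e) => //=; have [h7 h8] := IH a.-1.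
case: (a =P (e.1 + e.2).+1) => [e1|n1]; case: (a.+1 =P (e.1 + e.2).+1) => [e2|n2]; try lia.
have e0 : a.-1.+1 = a by lia.
rewrite e0 in h7; lia.
Qed.

(** A subword property for the Bruhat order: the hypothesis says that the Demazure product of the
    letters in [Z] dominates [w]. The head letter is used exactly when it lies in [Z] and is a
    descent of [w]. *)
Lemma reduced_subword Z l w :
  (forall a b, (a < p)%N -> (b <= p)%N -> (demazure_table Z l a b <= rank_count w a b)%N) ->
  exists D, [/\ subseq D l, all Z D & reduced_word D w].
Proof.
elim: l w => [|e l IH] w h.
  exists [::]; split=> //=; apply/eqP/entryP => x; rewrite entry1.
  have le y : (y < p)%N -> (entry w y <= y)%N.
    move=> hy; have [e|ne] := eqVneq y.+1 p.
      by have := entry_lt w y; rewrite hy -e ltnS.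
    (* At a = b = y + 1 the table of the empty word is y + 1, so the first y + 1 entries of [w] are
       all at most y. *)
    have := h y.+1 y.+1; rewrite /= minnn rank_countS.
    have := count_size (fun x => entry w x < y.+1)%N (iota 0 y); rewrite size_iota -/(rank_count w y y.+1).
    lia.
  elim/ltn_ind: x => x IH hx; have := le x hx; rewrite leq_eqVlt => /orP[/eqP //|lt].
  have e : entry w (entry w x) = entry w x by apply: IH => //; exact: ltn_trans hx.
  by move/entry_inj: e => e; move: lt; rewrite e ltnn.
(* The hypothesis stops at a < p; at a = p the rank count is b, which bounds every table entry. *)
have full x b : (x = p) -> (b <= p)%N -> (demazure_table Z l x b <= rank_count w x b)%N.
  by move=> -> hb; rewrite rank_count_full //; have [] := demazure_table_step Z l p b.
have [ze|nz] := boolP (Z e); last first.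
  have [|D [s a r]] := IH w; first by move=> a b ha hb; have := h a b ha hb; rewrite /= (negbTE nz).
  by exists D; split=> //; apply: subseq_trans s (subseq_cons _ _).
set a := (e.1 + e.2)%N in h *; rewrite /= ze /= in h.
have hne x b : x != a.+1 -> (x <= p)%N -> (b <= p)%N -> (demazure_table Z l x b <= rank_count w x b)%N.
  move=> ne; rewrite leq_eqVlt => /orP[/eqP ex|hx] hb; first exact: full.
  by have := h x b hx hb; rewrite -/a (negbTE ne).
have [ha|ha] := ltnP a.+1 p; last first.
  have [|D [s al r]] := IH w.
    by move=> x b hx; apply: hne; lia.
  by exists D; split=> //; apply: subseq_trans s (subseq_cons _ _).
have [da|nda] := boolP (descent w a).
  have [|D [s al r]] := IH (simple a * w)%g.
    move=> x b hx hb; have [->|ne] := eqVneq x a.+1; last by rewrite rank_count_simple //; apply: hne; lia.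
    rewrite rank_countS rank_count_simple ?entry_simple /nat_swap ?eqxx //; last lia.
    have := hne a b; have := hne a.+2 b; have [? ?] := demazure_table_step Z l a b; have [? ?] := demazure_table_step Z l a.+1 b.
    case/andP: da => _ lt; rewrite !rank_countS. lia.
  exists (e :: D); split; rewrite /= ?eqxx //; first by rewrite ze.
  by rewrite -/a da.
have [|D [s al r]] := IH w.
  move=> x b hx hb; have [->|ne] := eqVneq x a.+1; last by apply: hne; lia.
  have := hne a b; have := hne a.+2 b; have [? ?] := demazure_table_step Z l a b; have [? ?] := demazure_table_step Z l a.+1 b.
  have : entry w a <> entry w a.+1 by move/entry_inj; lia.
  move: nda; rewrite /descent ha /= -leqNgt !rank_countS; lia.
by exists D; split=> //; apply: subseq_trans s (subseq_cons _ _).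
Qed.

(* Chains are listed from their bottom left box up. *)
Definition south_west_of (b c : nat * nat) := (c.1 < b.1)%N && (b.2 < c.2)%N.

Definition chain (Z : pred (nat * nat)) k j m (c : seq (nat * nat)) :=
  pairwise south_west_of c && all (fun b => [&& b.1 < k, j <= b.2, b.2 < m & ~~ Z b]%N) c.

Lemma chain_weak Z k j m k' j' c : (k <= k')%N -> (j' <= j)%N ->
  chain Z k j m c -> chain Z k' j' m c.
Proof.
move=> hk hj /andP[h1 /allP h2]; apply/andP; split=> //.
by apply/allP => b /h2 /and4P[? ? -> ->]; rewrite !andbT; lia.
Qed.

(** Row k is added from the right, n counting the boxes already present. The table follows the
    recursion for longest chains: a box outside [Z] may start a chain continued in the rows above
    and the columns to its right, and a box in [Z] leaves the better of dropping its row or its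
    column. The next box uses the second conclusion, that low entries are still those of the rows
    above. *)
Lemma demazure_table_chain_row Z k b : (b <= p)%N ->
  (forall j, (j <= p)%N -> exists2 c, chain Z k j b c & (demazure_table Z (grid k) (k + j) b <= j + size c)%N) ->
  forall n, (n <= p)%N ->
  let l := [seq (k, j) | j <- iota (p - n) n] ++ grid k in
  (forall j, (p - n <= j <= p)%N -> exists2 c, chain Z k.+1 j b c & (demazure_table Z l (k.+1 + j) b <= j + size c)%N)
  /\ (forall a, (a <= k + (p - n))%N -> demazure_table Z l a b = demazure_table Z (grid k) a b).
Proof.
move=> hb IHk; elim=> [|n IH] hn.
  rewrite /= subn0; split=> // j hj; exists [::] => //=.
  by have [_ ?] := demazure_table_step Z (grid k) (k.+1 + j) b; lia.
have [IH1 IH2] := IH (ltnW hn).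
have e : (p - n = (p - n.+1).+1)%N by lia.
rewrite e in IH1 IH2; set j0 := (p - n.+1)%N in e IH1 IH2 *.
set l := [seq (k, j) | j <- iota j0.+1 n] ++ grid k in IH1 IH2 *.
split; last first.
  move=> a ha; rewrite /= -IH2; last lia.
  case: (Z _) => //=; have -> : (a == (k + j0).+1) = false by lia.
  by [].
move=> j hj; rewrite /=; have [ne|ej] := eqVneq j j0; last first.
  have -> : (k.+1 + j == (k + j0).+1)%N = false by lia.
  by rewrite andbF; apply: IH1; lia.
rewrite {j hj}ne addSn eqxx andbT /=; have [|c1 hc1 le1] := IH1 j0.+1; first lia.
have [|c0 hc0 le0] := IHk j0; first lia.
have E x : (x <= j0.+1)%N -> demazure_table Z l (k + x) b = demazure_table Z (grid k) (k + x) b.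
  by move=> hx; apply: IH2; lia.
case: (boolP (Z (k, j0))) => [z|nz].
  rewrite E //; have [hh|hh] := leqP (demazure_table Z (grid k) (k + j0) b) (demazure_table Z l (k + j0).+2 b).-1.
    exists c1; first exact: chain_weak hc1.
    by move: le1; rewrite addSn addnS; lia.
  by exists c0; first by apply: chain_weak hc0.
rewrite -addnS E //.
have [hjb|hjb] := leqP b j0.
  exists [::] => //=; have [_ ?] := demazure_table_step Z (grid k) (k + j0.+1) b; lia.
have [|c hc le] := IHk j0.+1; first lia.
exists ((k, j0) :: c); last by rewrite /=; lia.
case/andP: (hc) => hc1' hc2; rewrite /chain /= hc1' /= leqnn hjb nz /=.
rewrite andbT leqnn /=; apply/andP; split; first by apply: sub_all hc2 => x; rewrite /south_west_of /=; case/and4P=> -> ->.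
by have /andP[] := chain_weak (leqnSn k) (leqnSn j0) hc.
Qed.

Lemma demazure_table_chain Z k b j : (b <= p)%N -> (j <= p)%N ->
  exists2 c, chain Z k j b c & (demazure_table Z (grid k) (k + j) b <= j + size c)%N.
Proof.
move=> hb; elim: k j => [|k IH] j hj.
  by exists [::] => //=; lia.
by have /= [h _] := demazure_table_chain_row hb IH (leqnn p); rewrite subnn in h; apply: h; lia.
Qed.

(** Letters of rows of index at least k are at least k and change only entries beyond k. *)
Lemma demazure_table_stable Z k n a b : (a <= k)%N -> demazure_table Z (grid (k + n)) a b = demazure_table Z (grid k) a b.
Proof.
move=> ha; elim: n => [|n IH]; first by rewrite addn0.
rewrite addnS /= -IH; elim: (iota 0 p) => [|j s IHs] //=.
have -> : (a == (k + n + j).+1) = false by lia.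
by rewrite andbF.
Qed.

(** Either [Z] contains a reduced pipe dream of [w], or its complement contains the antidiagonal of
    a minor that is larger than the rank of [w] on the first a rows and b columns. *)
Lemma chain_or_subword Z w :
  (exists D, [/\ subseq D (grid p), all Z D & reduced_word D w]) \/
  (exists a b c, chain Z a 0 b c /\ [&& a < p, b <= p & rank_count w a b < size c]%N).
Proof.
have [h|h] := classic (forall a b, (a < p)%N -> (b <= p)%N -> (demazure_table Z (grid p) a b <= rank_count w a b)%N).
  by left; apply: reduced_subword.
right; apply: NNPP => h'; apply: h => a b ha hb; rewrite leqNgt; apply/negP => lt.
apply: h'; have [|c hc le] := demazure_table_chain Z a hb (j := 0); first by [].
exists a, b, c; split=> //; rewrite ha hb /=; apply: leq_trans lt _.
by rewrite -(subnKC (ltnW ha)) demazure_table_stable //; move: le; rewrite addn0 add0n.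
Qed.

End Words.

(** * The operators of Fomin and Kirillov *)

Section NilCoxeter.

Variables (p : nat) (R : comRingType).
Implicit Types (w : 'S_p) (a k n : nat) (F : 'S_p -> R) (c : nat -> R) (x y : R).

(* Multiplication by 1 + x u_a, u_a a generator of the nilCoxeter algebra, whose
   elements are written as families of coefficients. *)
Definition fk_factor a x F : 'S_p -> R :=
  fun w => F w + (if descent w a then x * F (simple p a * w)%g else 0).

Lemma fk_factor_out a x F : (p <= a.+1)%N -> fk_factor a x F = F.
Proof.
by move=> h; apply: functional_extensionality => w; rewrite /fk_factor /descent ltnNge h addr0.
Qed.

Lemma descentE w a : (a.+1 < p)%N -> descent w a = (entry w a.+1 < entry w a)%N.
Proof. by rewrite /descent => ->. Qed.

(** The square of u_a vanishes, because once a descent at a is removed none is left there. *)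
Lemma fk_factorD a x y F : fk_factor a x (fk_factor a y F) = fk_factor a (x + y) F.
Proof.
apply: functional_extensionality => w; rewrite /fk_factor.
case d: (descent w a); last by rewrite !addr0.
by rewrite (negbTE (descent_simple d)) addr0; ring.
Qed.

Lemma fk_factorC a b x y F : (a.+1 < b)%N -> fk_factor a x (fk_factor b y F) = fk_factor b y (fk_factor a x F).
Proof.
move=> ab; have [hb|hb] := leqP p b.+1; first by rewrite !(fk_factor_out _ _ hb).
have ha : (a.+1 < p)%N by lia.
apply: functional_extensionality => w; rewrite /fk_factor.
have e1 : descent (simple p a * w)%g b = descent w b.
  rewrite !descentE // !entry_simple // /nat_swap.
  by have [-> -> -> ->] : [/\ b == a = false, b == a.+1 = false, b.+1 == a = false & b.+1 == a.+1 = false] by split; lia.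
have e2 : descent (simple p b * w)%g a = descent w a.
  rewrite !descentE // !entry_simple // /nat_swap.
  by have [-> -> -> ->] : [/\ a == b = false, a == b.+1 = false, a.+1 == b = false & a.+1 == b.+1 = false] by split; lia.
have e3 : (simple p b * (simple p a * w) = simple p a * (simple p b * w))%g.
  apply: entryP => z _; rewrite !entry_simple //; congr entry.
  have [h1|h1] : nat_swap a z = z \/ nat_swap b z = z by have := nat_swapE a z; have := nat_swapE b z; lia.
    by rewrite h1; have := nat_swapE a z; have := nat_swapE b z; have := nat_swapE a (nat_swap b z); lia.
  by rewrite h1; have := nat_swapE a z; have := nat_swapE b z; have := nat_swapE b (nat_swap a z); lia.
by rewrite e1 e2 e3; case: (descent w a); case: (descent w b); ring.
Qed.

(** The Yang-Baxter equation. The relative order of the entries at a, a + 1 and a + 2 decides which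
    descents occur, and each order leaves a polynomial identity. *)
Lemma fk_factor_braid a x y F :
  fk_factor a.+1 x (fk_factor a (x + y) (fk_factor a.+1 y F)) = fk_factor a y (fk_factor a.+1 (x + y) (fk_factor a x F)).
Proof.
have [hb|hb] := leqP p a.+2; first by rewrite !(fk_factor_out _ _ hb) fk_factorD addrC.
have ha : (a.+1 < p)%N by lia.
apply: functional_extensionality => w; rewrite /fk_factor.
have S1 : nat_swap a a = a.+1 by rewrite /nat_swap eqxx.
have S2 : nat_swap a a.+1 = a by rewrite /nat_swap eqxx; case: eqP; lia.
have S3 : nat_swap a a.+2 = a.+2 by rewrite /nat_swap; repeat case: eqP; lia.
have S4 : nat_swap a.+1 a = a by rewrite /nat_swap; repeat case: eqP; lia.
have S5 : nat_swap a.+1 a.+1 = a.+2 by rewrite /nat_swap eqxx.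
have S6 : nat_swap a.+1 a.+2 = a.+1 by rewrite /nat_swap eqxx; case: eqP; lia.
have e3 : (simple p a.+1 * (simple p a * (simple p a.+1 * w)) = simple p a * (simple p a.+1 * (simple p a * w)))%g.
  apply: entryP => z _; rewrite !entry_simple //; congr entry.
  have [->|n1] := eqVneq z a; first by rewrite !(S1, S2, S3, S4, S5, S6).
  have [->|n2] := eqVneq z a.+1; first by rewrite !(S1, S2, S3, S4, S5, S6).
  have [->|n3] := eqVneq z a.+2; first by rewrite !(S1, S2, S3, S4, S5, S6).
  by have [S7 S8] : nat_swap a z = z /\ nat_swap a.+1 z = z by [rewrite /nat_swap (negbTE n1) (negbTE n2) (negbTE n3)]; rewrite !(S7, S8).
rewrite !descentE // !entry_simple // !(S1, S2, S3, S4, S5, S6) e3.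
have n1 : entry w a <> entry w a.+1 by move/entry_inj; lia.
have n2 : entry w a <> entry w a.+2 by move/entry_inj; lia.
have n3 : entry w a.+1 <> entry w a.+2 by move/entry_inj; lia.
move: (entry w a) (entry w a.+1) (entry w a.+2) n1 n2 n3 => u v z n1 n2 n3.
rewrite !simpleK.
by case: (ltngtP v u) n1 => // h1 _; case: (ltngtP z v) n3 => // h2 _; case: (ltngtP z u) n2 => // h3 _;
  try lia; rewrite ?addr0; ring.
Qed.

Fixpoint fk_row k x c n F : 'S_p -> R :=
  if n is n'.+1 then fk_factor k (x - c 0%N) (fk_row k.+1 x (fun j => c j.+1) n' F) else F.

Lemma fk_row_factorC k a x y c n F : (a.+1 < k)%N ->
  fk_row k x c n (fk_factor a y F) = fk_factor a y (fk_row k x c n F).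
Proof.
elim: n k c => [|n IH] k c h //=.
rewrite IH; last exact: ltnW.
by rewrite (fk_factorC (a := a) (b := k)).
Qed.

(** The factor with parameter x - x' splits off in the last column by additivity and is carried
    through the other columns to the left by Yang-Baxter moves. *)
Lemma fk_row_swap k x x' c n F :
  fk_row k.+1 x' c n (fk_row k x c n.+1 F) =
  fk_factor k (x - x') (fk_row k.+1 x c n (fk_row k x' c n.+1 F)).
Proof.
elim: n k c => [|n IH] k c.
  by rewrite /= fk_factorD; congr fk_factor; ring.
have sh j z z' : fk_factor j.+1 (z - c 0%N) (fk_row j.+2 z (fun j => c j.+1) n
    (fk_factor j (z' - c 0%N) (fk_row j.+1 z' (fun j => c j.+1) n.+1 F))) =
    fk_factor j.+1 (z - c 0%N) (fk_factor j (z' - c 0%N) (fk_row j.+2 z (fun j => c j.+1) n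
     (fk_row j.+1 z' (fun j => c j.+1) n.+1 F))).
  by rewrite fk_row_factorC.
transitivity (fk_factor k.+1 (x' - c 0%N) (fk_factor k (x - c 0%N) (fk_row k.+2 x' (fun j => c j.+1) n
     (fk_row k.+1 x (fun j => c j.+1) n.+1 F)))); first exact: sh.
rewrite IH.
have -> : x - c 0%N = (x' - c 0%N) + (x - x') by ring.
rewrite fk_factor_braid; congr fk_factor.
have -> : (x' - c 0%N) + (x - x') = x - c 0%N by ring.
by symmetry; apply: sh.
Qed.

Lemma fk_row_out k x c n F : (p <= k.+1)%N -> fk_row k x c n F = F.
Proof. by elim: n k c => [|n IH] k c h //=; rewrite fk_factor_out // IH //; lia. Qed.

Lemma fk_row_trunc k x c n m F : (p <= k + n.+1)%N -> fk_row k x c (n + m) F = fk_row k x c n F.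
Proof.
elim: n k c => [|n IH] k c h; first by rewrite add0n /= fk_row_out //; lia.
by rewrite addSn /= IH //; lia.
Qed.

Lemma fk_row_swap_full k x x' c F :
  fk_row k.+1 x' c p (fk_row k x c p F) =
  fk_factor k (x - x') (fk_row k.+1 x c p (fk_row k x' c p F)).
Proof.
have [hp|hp] := posnP p.
  have o j z G : fk_row j z c p G = G by rewrite fk_row_out //; lia.
  by rewrite !o fk_factor_out //; lia.
have e n : (p <= k + n.+1)%N -> (n <= p)%N -> forall z F, fk_row k z c p F = fk_row k z c n F.
  by move=> h1 h2 z G; rewrite -(fk_row_trunc z c (p - n) G h1) subnKC.
have e' n : (p <= k.+1 + n.+1)%N -> (n <= p)%N -> forall z F, fk_row k.+1 z c p F = fk_row k.+1 z c n F.
  by move=> h1 h2 z G; rewrite -(fk_row_trunc z c (p - n) G h1) subnKC.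
(* Rows k and k + 1 are cut to lengths p and p - 1, since the exchange wants one more factor in row
   k; the dropped letters are out of range. *)
have [a1 a2 a3 a4] : [/\ p <= k + p.-1.+2, p.-1.+1 <= p, p <= k.+1 + p.-1.+1 & p.-1 <= p]%N by split; lia.
rewrite (e _ a1 a2 x) (e _ a1 a2 x') (e' _ a3 a4 x) (e' _ a3 a4 x').
exact: fk_row_swap.
Qed.

Definition fk_start : 'S_p -> R := fun w => (w == 1%g)%:R.

Fixpoint fk_rows (t c : nat -> R) k : 'S_p -> R :=
  if k is k'.+1 then fk_row k' (t k') c p (fk_rows t c k') else fk_start.

(** * Exchanging two row variables *)

Section Semi.
Variables (phi : {rmorphism R -> R}).

Lemma fk_factor_rmorph a x F : (fun w => phi (fk_factor a x F w)) = fk_factor a (phi x) (fun w => phi (F w)).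
Proof.
apply: functional_extensionality => w; rewrite /fk_factor rmorphD; congr (_ + _).
by case: ifP => _; rewrite ?rmorph0 ?rmorphM.
Qed.

Lemma fk_row_rmorph k x c n F : (forall j, phi (c j) = c j) ->
  (fun w => phi (fk_row k x c n F w)) = fk_row k (phi x) c n (fun w => phi (F w)).
Proof.
by elim: n k c => [|n IH] k c h //=; rewrite fk_factor_rmorph rmorphB h IH.
Qed.

(** Here [phi] exchanges t_i and t_(i+1). It fixes the rows above i, rows i and i + 1 trade
    variables at the cost of one factor, and this factor commutes with all further rows. *)
Lemma fk_rows_swap t c i k : (forall j, phi (c j) = c j) ->
  phi (t i) = t i.+1 -> phi (t i.+1) = t i ->
  (forall j, j != i -> j != i.+1 -> phi (t j) = t j) ->
  (i.+1 < k)%N ->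
  fk_rows t c k = fk_factor i (t i - t i.+1) (fun w => phi (fk_rows t c k w)).
Proof.
move=> hc h1 h2 h3.
have lo j : (j <= i)%N -> (fun w => phi (fk_rows t c j w)) = fk_rows t c j.
  elim: j => [|j IH] hj /=.
    by apply: functional_extensionality => w; rewrite /fk_start rmorph_nat.
  by rewrite fk_row_rmorph // IH ?h3 //; lia.
elim: k => // k IH; rewrite ltnS leq_eqVlt => /orP[/eqP<- /=|hk].
  by rewrite [LHS]fk_row_swap_full !fk_row_rmorph // lo // h1 h2.
rewrite /= fk_row_rmorph // h3; [|lia..].
by rewrite {1}(IH hk) fk_row_factorC.
Qed.

(** The factorization read at [w] gives the difference in terms of the image under [phi] of the
    coefficient at [simple p i * w]; read at that element, which has no descent at i, it shows that
    this coefficient is fixed by [phi]. *)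
Lemma fk_rows_divided_difference t c i k w : (forall j, phi (c j) = c j) ->
  phi (t i) = t i.+1 -> phi (t i.+1) = t i ->
  (forall j, j != i -> j != i.+1 -> phi (t j) = t j) ->
  (i.+1 < k)%N -> descent w i ->
  fk_rows t c k w - phi (fk_rows t c k w) = (t i - t i.+1) * fk_rows t c k (simple p i * w)%g.
Proof.
move=> h0 h1 h2 h3 hk d; have e := fk_rows_swap h0 h1 h2 h3 hk.
rewrite {1}e [X in _ * X _]e /fk_factor d (negbTE (descent_simple d)); ring.
Qed.

End Semi.

End NilCoxeter.

(** * Supports of double Schubert polynomials *)

Lemma mcoeffXUM n (R : comRingType) (i : 'I_n) (G : {mpoly R[n]}) m :
  ('X_i * G)@_m = if (0 < m i)%N then G@_(m - U_(i))%MM else 0.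
Proof.
case: ifP => [h|/negbT h].
  have {1}-> : m = (U_(i) + (m - U_(i)))%MM.
    by rewrite addmC submK // lep1mP -lt0n.
  by rewrite mulrC mcoeffMX.
apply: memN_msupp_eq0; apply/negP; rewrite mulrC (perm_mem (msuppMX _ _)).
by case/mapP => m' _ e; move: h; rewrite e mnmDE mnm1E eqxx.
Qed.

Section Support.

Variable p : nat.
Implicit Types (w : 'S_p) (D l : seq (nat * nat)) (o : nat * nat -> bool).

Definition block_index (b : nat * nat) (s : bool) : nat := if s then b.1 else (p + b.2)%N.

(** The exponent of variable x in the monomial picked from the factors t_i - s_j over the boxes of
    [D], where [o] chooses t. *)
Definition load o D (x : nat) : nat := count (fun b => block_index b (o b) == x) D.

Fixpoint fk_word (R : comRingType) (wt : nat * nat -> R) l : 'S_p -> R :=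
  if l is b :: l' then fk_factor (b.1 + b.2) (wt b) (fk_word wt l') else @fk_start p R.

Lemma fk_word_row (R : comRingType) (t c : nat -> R) k j n l :
  fk_word (fun b => t b.1 - c b.2) ([seq (k, j0) | j0 <- iota j n] ++ l) =
  fk_row (k + j) (t k) (fun j0 => c (j + j0)%N) n (fk_word (fun b => t b.1 - c b.2) l).
Proof.
elim: n j => [|n IH] j //=.
rewrite addn0 IH addnS; congr (fk_factor _ _ (fk_row _ _ _ _ _)).
by apply: functional_extensionality => j0; rewrite addnS.
Qed.

Lemma fk_word_grid (R : comRingType) (t c : nat -> R) k :
  fk_word (fun b => t b.1 - c b.2) (grid p k) = @fk_rows p R t c k.
Proof.
elim: k => [|k IH] //=.
by rewrite fk_word_row IH addn0.
Qed.

Definition tv k : {mpoly int[p + p]} :=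
  if (insub k : option 'I_p) is Some i then tvar i else 0.
Definition sv k : {mpoly int[p + p]} :=
  if (insub k : option 'I_p) is Some i then svar i else 0.

Definition wt (b : nat * nat) := tv b.1 - sv b.2.

Lemma tvE (i : 'I_p) : tv i = tvar i. Proof. by rewrite /tv valK. Qed.
Lemma svE (i : 'I_p) : sv i = svar i. Proof. by rewrite /sv valK. Qed.

(** The grid product obeys the divided difference recursion, and t_i - t_(i+1) can be cancelled in a
    domain. The initial case at the longest permutation is kept as a hypothesis until staircases are
    available. *)
Lemma schubert_fk_word w f : double_schubert w f ->
  (forall w0, w0 = longest_perm p ->
    fk_word wt (grid p p) w0 = \prod_(i < p) \prod_(j < p | (i.+1 + j.+1 <= p)%N) (tvar i - svar j)) ->
  f = fk_word wt (grid p p) w.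
Proof.
move=> df h0; elim: df => [|{w f}w f i g _ IH lt e]; first by rewrite h0.
have ip : (i.+1 < p)%N by have := ltn_ord i; lia.
have d : descent w i.
  rewrite /descent ip /=; move: lt; rewrite !perm_lengthE.
  have /orP[h|h] := adj_total w i; first by rewrite card_inversions_up //; lia.
  by move=> _; rewrite -[i.+1]/(nat_of_ord (adj2 i)) -[nat_of_ord i]/(nat_of_ord (Defs.adj1 i)) !entryE.
have sgi : simple p i = sigma i by rewrite /simple valK.
have T k : t_act (sigma i) (tv k) = tv (nat_swap i k).
  have hs : nat_swap i k = (if k == i then i.+1 else if k == i.+1 then i : nat else k) by [].
  have [hk|hk] := ltnP k p; last first.
    rewrite /tv insubF ?ltnNge ?hk //.
    have -> : insub (nat_swap i k) = None :> option 'I_p.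
      by apply: insubF; have := nat_swapE i k; lia.
    by rewrite /t_act comp_mpoly0.
  rewrite -[k in LHS]/(nat_of_ord (Ordinal hk)) tvE /tvar t_actX.
  rewrite -[lshift p _]/(unsplit (inl _)) unsplitK.
  rewrite hs -[k]/(nat_of_ord (Ordinal hk)) -sigmaE tvE //.
have S k : t_act (sigma i) (sv k) = sv k.
  have [hk|hk] := ltnP k p; last first.
    by rewrite /sv insubF ?ltnNge ?hk // /t_act comp_mpoly0.
  rewrite -[k]/(nat_of_ord (Ordinal hk)) svE /svar t_actX.
  by rewrite -[rshift p _]/(unsplit (inr _)) unsplitK.
have := @fk_rows_divided_difference p _ (comp_mpoly [tuple match split k with
                | inl j => tvar (sigma i j)
                | inr j => svar j
                end | k < p + p]) tv sv i p w.
rewrite -fk_word_grid -/wt -IH sgi => /(_ _ _ _ _ ip d) E.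
have {}E : f - t_act (sigma i) f = (tv i - tv i.+1) * fk_word wt (grid p p) (sigma i * w)%g.
  apply: E; [exact: S | | | ].
  - by apply: etrans (T i) _; rewrite /nat_swap eqxx.
  - by apply: etrans (T i.+1) _; rewrite /nat_swap eqxx; case: eqP => //; lia.
  - move=> j n1 n2; apply: etrans (T j) _; congr tv.
    by rewrite /nat_swap (negbTE n1) (negbTE n2).
have t1 : tv i = tvar (Defs.adj1 i) by rewrite -tvE.
have t2 : tv i.+1 = tvar (adj2 i) by rewrite -tvE.
move: e; rewrite E t1 t2.
suff nz : tvar (Defs.adj1 i) - tvar (adj2 i) != 0 by move/(mulfI nz) ->.
rewrite subr_eq0; apply/eqP => /(congr1 (mcoeff U_(lshift p (Defs.adj1 i)))).
rewrite !mcoeffXU eqxx.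
have -> : (lshift p (adj2 i) == lshift p (Defs.adj1 i)) = false.
  by rewrite (inj_eq (@lshift_inj _ _)); apply/eqP => /(congr1 val) /=; lia.
by [].
Qed.

(** * Signs of coefficients and exponents of pipe dreams *)

Definition svar_sign (m : 'X_{1..p + p}) : int := (-1) ^+ (\sum_(j < p) m (rshift p j))%N.

Lemma svar_signU (m : 'X_{1..p + p}) (x : 'I_(p + p)) : (0 < m x)%N ->
  svar_sign (m - U_(x))%MM = (if (x < p)%N then 1 else -1) * svar_sign m.
Proof.
move=> hx; have e : m = (m - U_(x) + U_(x))%MM by rewrite submK // lep1mP -lt0n.
rewrite {2}e /svar_sign; set m' := (m - U_(x))%MM.
have -> : (\sum_(j < p) (m' + U_(x))%MM (rshift p j) = \sum_(j < p) m' (rshift p j) + ~~ (x < p))%N.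
  rewrite (eq_bigr (fun j : 'I_p => m' (rshift p j) + (x == rshift p j))%N); last first.
    by move=> j _; rewrite mnmDE mnm1E.
  rewrite big_split /=; congr (_ + _)%N.
  case: ltnP => hxp /=.
    by apply: big1 => j _; case: eqP => // ex; move: hxp; rewrite ex /=; lia.
  have hx' : (x - p < p)%N by have := ltn_ord x; lia.
  rewrite (bigD1 (Ordinal hx')) //= big1 ?addn0.
    by case: eqP => // ne; case: ne; apply: val_inj => /=; lia.
  by move=> j nj; case: eqP => // ex; case/eqP: nj; apply: val_inj; rewrite /= ex /=; lia.
rewrite exprD; case: ltnP => _ /=; first by rewrite expr0 mulr1 mul1r.
by rewrite expr1 mulrCA mulN1r opprK mulr1.
Qed.

Definition pipe_exponent l w (m : 'X_{1..p + p}) :=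
  exists D o, [/\ subseq D l, reduced_word D w & forall x : 'I_(p + p), m x = load o D x].

Lemma pipe_exponent_cons (b : nat * nat) l w m : b \notin l -> (b.1 < p)%N -> (b.2 < p)%N ->
  pipe_exponent (b :: l) w m <->
  (pipe_exponent l w m \/ descent w (b.1 + b.2) /\ exists s (x : 'I_(p + p)), [/\ block_index b s = x :> nat, 0 < m x &
    pipe_exponent l (simple p (b.1 + b.2) * w)%g (m - U_(x))%MM]%N).
Proof.
move=> nb h1 h2; split.
  case=> -[|b' D] [o [s r hm]].
    by left; exists [::], o; split=> //; exact: sub0seq.
  move: s; rewrite /=; case: eqP => [eb|ne] s; last by left; exists (b' :: D), o.
  subst b'; right; move: r => /= /andP[d r]; split=> //.
  have hx : (block_index b (o b) < p + p)%N by rewrite /block_index; case: (o b) => /=; lia.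
  exists (o b), (Ordinal hx); split=> //; first by rewrite hm /load /= eqxx.
  by exists D, o; split=> // x; rewrite mnmBE hm mnm1E /load /= -val_eqE /= addKn.
case=> [[D [o [s r hm]]]|[d [s [x [bx mx [D [o [sD r hm]]]]]]]].
  by exists D, o; split=> //; apply: subseq_trans s (subseq_cons _ _).
(* The charge is changed at [b] only, which leaves the loads of [D] alone since [b] is not in
   [l]. *)
exists (b :: D), (fun b' => if b' == b then s else o b'); split.
- by rewrite /= eqxx.
- by rewrite /= d.
move=> y; rewrite /load /= eqxx bx.
have -> : count (fun b0 => block_index b0 (if b0 == b then s else o b0) == y) D = load o D y.
  apply: eq_in_count => b' hb'; have [e|//] := eqVneq b' b.
  by move: nb; move: (mem_subseq sD hb'); rewrite e => ->.
rewrite -hm mnmBE mnm1E val_eqE; case: eqP => [e|_]; rewrite ?subn0 //= -e.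
by rewrite add1n subn1 prednK.
Qed.

(** Choosing t_i from a factor keeps the sign, and choosing -s_j changes it together with
    [svar_sign]. So the contributions to one monomial never cancel, and one of them suffices. *)
Lemma fk_word_support l w m : uniq l -> all (fun b => (b.1 < p) && (b.2 < p))%N l ->
  0 <= svar_sign m * (fk_word wt l w)@_m /\ ((fk_word wt l w)@_m != 0 <-> pipe_exponent l w m).
Proof.
elim: l w m => [|b l IH] w m /=.
  move=> _ _; rewrite /fk_start.
  have E : (w == 1%g)%:R@_m = ((w == 1%g) && (m == 0%MM))%:R :> int.
    by case: eqP => _; rewrite ?mcoeff1 ?mcoeff0.
  rewrite {}E; split.
    case: andP => [[_ /eqP ->]|]; last by rewrite mulr0.
    by rewrite /svar_sign big1 // => j _; rewrite mnmE.
  split; last first.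
    case=> D [o [/eqP -> /= -> hm]].
    have -> // : m = 0%MM by apply/mnmP => x; rewrite hm mnmE.
    by rewrite eqxx.
  case: andP => [[/eqP -> /eqP ->] _|]; last by rewrite eqxx.
  by exists [::], (fun=> true); split=> //= x; rewrite mnmE.
case/andP=> nb ul /andP[/andP[h1 h2] al].
rewrite (pipe_exponent_cons _ _ nb h1 h2) /fk_factor mcoeffD mulrDr.
have [ge0 iff0] := IH w m ul al.
case d : (descent w _); last first.
  by rewrite mcoeff0 mulr0 !addr0; split=> //; rewrite iff0; split; [left|case=> // -[]].
set w' := (_ * w)%g; set G := fk_word wt l w'.
have [x hx] : exists x : 'I_(p + p), x = lshift p (Ordinal h1) by eexists.
have [y hy] : exists y : 'I_(p + p), y = rshift p (Ordinal h2) by eexists.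
have E : (wt b * G)@_m = (if (0 < m x)%N then G@_(m - U_(x))%MM else 0)
                       - (if (0 < m y)%N then G@_(m - U_(y))%MM else 0).
  rewrite mulrBl mcoeffB hx hy -!mcoeffXUM.
  by rewrite -[b.1 in LHS]/(nat_of_ord (Ordinal h1)) -[b.2 in LHS]/(nat_of_ord (Ordinal h2)) tvE svE.
have [gx ix] := IH w' (m - U_(x))%MM ul al.
have [gy iy] := IH w' (m - U_(y))%MM ul al.
rewrite -/G in gx ix gy iy.
have {}gx : (0 < m x)%N -> 0 <= svar_sign m * G@_(m - U_(x))%MM.
  by move=> mx; move: gx; rewrite svar_signU // hx /= h1 mul1r.
have {}gy : (0 < m y)%N -> 0 <= - (svar_sign m * G@_(m - U_(y))%MM).
  move=> my; move: gy; rewrite svar_signU // hy /=.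
  by rewrite ltnNge leq_addr /= mulN1r mulNr.
pose cx := svar_sign m * (if (0 < m x)%N then G@_(m - U_(x))%MM else 0).
pose cy := - (svar_sign m * (if (0 < m y)%N then G@_(m - U_(y))%MM else 0)).
have cx0 : 0 <= cx by rewrite /cx; case: ifP => [/gx//|]; rewrite mulr0.
have cy0 : 0 <= cy by rewrite /cy; case: ifP => [/gy//|]; rewrite mulr0 oppr0.
have sn0 a : (svar_sign m * a != 0) = (a != 0).
  by rewrite mulf_eq0 negb_or /svar_sign signr_eq0.
rewrite E mulrBr -/cx -/cy; split; first by rewrite !addr_ge0.
rewrite -(sn0 (_ + _)) mulrDr mulrBr -/cx -/cy.
rewrite paddr_eq0 ?addr_ge0 // paddr_eq0 // !negb_and sn0.
have Hx : cx != 0 <-> (0 < m x)%N /\ pipe_exponent l w' (m - U_(x))%MM.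
  rewrite /cx sn0; case: ifP => hm; last by rewrite eqxx; split=> // -[].
  by rewrite ix; split=> [|[]].
have Hy : cy != 0 <-> (0 < m y)%N /\ pipe_exponent l w' (m - U_(y))%MM.
  rewrite /cy oppr_eq0 sn0; case: ifP => hm; last by rewrite eqxx; split=> // -[].
  by rewrite iy; split=> [|[]].
split.
  case/or3P; first by move/iff0; left.
    by case/Hx => ? ?; right; split=> //; exists true, x; split=> //; rewrite hx.
  by case/Hy => ? ?; right; split=> //; exists false, y; split=> //; rewrite hy.
case=> [/iff0 -> //|[_ [s [z [bz mz dz]]]]].
case: s bz => bz; apply/or3P; [constructor 2; apply/Hx|constructor 3; apply/Hy].
  by have <- : z = x by [apply: val_inj; rewrite /= -bz hx].
by have <- : z = y by [apply: val_inj; rewrite /= -bz hy].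
Qed.

End Support.

(** * Adding a box to a pipe dream *)

Section Insertion.

Variable p : nat.
Implicit Types (w : 'S_p) (D l : seq (nat * nat)) (P : pred (nat * nat)).

Lemma reduced_word_inj l w w' : reduced_word l w -> reduced_word l w' -> w = w'.
Proof.
elim: l w w' => [|b l IH] w w' /=; first by move=> /eqP -> /eqP ->.
case/andP=> _ r /andP[_ r']; have e := IH _ _ r r'.
by rewrite -(simpleK (b.1 + b.2) w) e simpleK.
Qed.

Lemma reduced_word_range l w : reduced_word l w -> all (fun b => (b.1 + b.2).+1 < p)%N l.
Proof.
elim: l w => [|b l IH] w //= /andP[/andP[h _] r].
by rewrite h /= (IH _ r).
Qed.

(** The boxes strictly above the main antidiagonal, whose letters are in range; together they are a
    pipe dream of the longest permutation. *)
Definition stair (b : nat * nat) := ((b.1 + b.2).+1 < p)%N.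

Lemma filter_stair_row k : [seq b <- [seq (k, j) | j <- iota 0 p] | stair b] =
  [seq (k, j) | j <- iota 0 (p - k.+1)].
Proof.
have -> : iota 0 p = iota 0 (p - k.+1) ++ iota (p - k.+1) (p - (p - k.+1)).
  by rewrite -iotaD subnKC // leq_subr.
rewrite map_cat filter_cat.
have /all_filterP -> : all stair [seq (k, j) | j <- iota 0 (p - k.+1)].
  by apply/allP => b /mapP[j]; rewrite mem_iota /stair => h -> /=; lia.
have /eqP -> : [seq b <- [seq (k, j) | j <- iota (p - k.+1) (p - (p - k.+1))] | stair b] == [::].
  rewrite -size_eq0 size_filter -leqn0 leqNgt -has_count; apply/hasPn => b /mapP[j].
  by rewrite mem_iota /stair => h -> /=; lia.
by rewrite cats0.
Qed.

(** Prepending the boxes of row k from right to left moves the value p - k - 1 from the last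
    position to position k. *)
Lemma full_rows k : (k <= p)%N -> exists2 w, reduced_word [seq b <- grid p k | stair b] w &
  forall x, (x < p)%N -> @entry p w x = if (x < k)%N then (p - x.+1)%N else (x - k)%N.
Proof.
elim: k => [|k IH] hk; first by exists 1%g; rewrite /= ?eqxx // => x _; rewrite entry1 subn0.
have [w r hw] := IH (ltnW hk).
rewrite /= filter_cat filter_stair_row.
have /(_ (p - k.+1)%N) : forall n, (n <= p - k.+1)%N ->
  exists2 w, reduced_word ([seq (k, j) | j <- iota (p - k.+1 - n) n] ++ [seq b <- grid p k | stair b]) w &
   forall x, (x < p)%N -> @entry p w x = if (x < k)%N then (p - x.+1)%N else
     if (x < k + (p - k.+1 - n))%N then (x - k)%N else
     if x == (k + (p - k.+1 - n))%N then (p - k.+1)%N else (x - k.+1)%N.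
  elim=> [|n IHn] hn.
    exists w => // x hx; rewrite hw //; case: ltnP => // h1; case: ltnP => // h2.
    by case: eqP => ?; lia.
  have [w1 r1 hw1] := IHn (ltnW hn).
  set j0 := (p - k.+1 - n.+1)%N.
  have e : (p - k.+1 - n = j0.+1)%N by rewrite /j0; lia.
  rewrite e in r1 hw1; have ha : ((k + j0).+1 < p)%N by rewrite /j0; lia.
  have v1 : entry w1 (k + j0) = j0.
    by rewrite hw1; [|lia]; case: ltnP => h1; [lia|]; case: ltnP => h2; lia.
  have v2 : entry w1 (k + j0).+1 = (p - k.+1)%N.
    by rewrite hw1; [|lia]; case: ltnP => h1; [lia|]; case: ltnP => h2; [lia|]; case: eqP; lia.
  exists (simple p (k + j0) * w1)%g.
    rewrite /= simpleK r1 andbT /descent ha !entry_simple // /nat_swap eqxx.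
    by have -> : ((k + j0).+1 == k + j0)%N = false by [lia]; rewrite eqxx v1 v2 /j0; lia.
  move=> x hx; rewrite entry_simple //; have := nat_swapE (k + j0) x.
  case=> [[-> ->]|[[-> ->]|[n1 [n2 ->]]]].
  - by rewrite v2 eqxx ltnn; case: ltnP => //; lia.
  - rewrite v1; case: ltnP => h1; first lia.
    by case: ltnP => h2; first lia; case: eqP => ?; lia.
  by rewrite hw1 //; repeat (case: ltnP => ?); repeat (case: eqP => ?); lia.
move=> /(_ (leqnn _)) [w1]; rewrite subnn addn0 => r1 hw1; exists w1 => // x hx.
by rewrite hw1 //; repeat (case: ltnP => ?); repeat (case: eqP => ?); lia.
Qed.

Lemma full_longest : reduced_word [seq b <- grid p p | stair b] (longest_perm p).
Proof.
have [w r hw] := full_rows (leqnn p); suff <- : w = longest_perm p by [].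
apply: entryP => x hx; rewrite hw // hx -[x in RHS]/(nat_of_ord (Ordinal hx)) entryE permE /=.
by [].
Qed.

Lemma fk_word_short (R : comRingType) (wt : nat * nat -> R) l w :
  (size l < #|inversions w|)%N -> fk_word wt l w = 0.
Proof.
elim: l w => [|b l IH] w /= h.
  rewrite /fk_start; case: eqP => // e; move: h; rewrite e.
  suff -> : #|inversions (1%g : 'S_p)| = 0%N by [].
  by rewrite -(@reduced_word_size p [::] 1%g) //= eqxx.
rewrite /fk_factor IH; last exact: ltnW.
rewrite add0r; case d: (descent w _) => //; rewrite IH ?mulr0 //.
case/andP: d => h1 h2; have h' : (b.1 + b.2 < p.-1)%N by lia.
rewrite (simpleE h'); move: h; rewrite (@card_inversions_down _ w (Ordinal h')) //.
by rewrite -!entryE /=.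
Qed.

(** The tail is too short to reach [w], so every factor has to contribute its letter. *)
Lemma fk_word_reduced (R : comRingType) (wt : nat * nat -> R) l w :
  reduced_word l w -> fk_word wt l w = \prod_(b <- l) wt b.
Proof.
elim: l w => [|b l IH] w /=; first by move/eqP=> ->; rewrite big_nil /fk_start eqxx.
case/andP=> d r; rewrite big_cons /fk_factor d -(IH _ r) fk_word_short ?add0r //.
have : reduced_word (b :: l) w by rewrite /= d.
by move/reduced_word_size => <- /=.
Qed.

Lemma fk_word_stair (R : comRingType) (wt : nat * nat -> R) l :
  fk_word (p := p) wt l = fk_word wt [seq b <- l | stair b].
Proof.
elim: l => [|b l IH] //=; rewrite IH; case: ifP => //= h.
by rewrite fk_factor_out // leqNgt -/(stair b) h.
Qed.

(** Boxes off the staircase have letters out of range and act trivially; the others form a reduced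
    word. *)
Lemma fk_word_longest :
  fk_word (@wt p) (grid p p) (longest_perm p) =
    \prod_(i < p) \prod_(j < p | (i.+1 + j.+1 <= p)%N) (tvar i - svar j).
Proof.
rewrite fk_word_stair (fk_word_reduced _ full_longest) big_filter.
have E k : \prod_(b <- grid p k | stair b) @wt p b =
    \prod_(0 <= i < k) \prod_(0 <= j < p | (i.+1 + j.+1 <= p)%N) (tv p i - sv p j).
  elim: k => [|k IH]; first by rewrite big_nil big_geq.
  rewrite /= big_cat IH big_nat_recr //= mulrC; congr (_ * _).
  rewrite big_map /index_iota subn0; apply: eq_bigl => j.
  by rewrite /stair /= addSn addnS.
rewrite E big_mkord; apply: eq_bigr => i _; rewrite big_mkord; apply: eq_bigr => j _.
by rewrite tvE svE.
Qed.

Lemma schubert_support w f : double_schubert w f ->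
  forall m : 'X_{1..p + p}, m \in msupp f <-> pipe_exponent (grid p p) w m.
Proof.
move=> /schubert_fk_word -> => [m|w0 ->]; last exact: fk_word_longest.
rewrite mcoeff_msupp; have [] // := @fk_word_support p (grid p p) w m.
  exact: uniq_grid.
by apply/allP => b; rewrite mem_grid.
Qed.

(** * Inserting the first missing staircase box *)

Section Add.
Variables (i j v : nat).

(* Relates the permutations before and after adding the box (i, j), while the boxes
   (i, c), c < j, are prepended. *)
Definition addrel c (w w' : 'S_p) :=
  [/\ entry w (i + c) = j, entry w' (i + c) = v,
      forall x, x != (i + c)%N -> entry w' x = if entry w x == v then j else entry w x,
      forall x, (x < i)%N -> entry w x = (p - x.+1)%N &
      (forall x, (i <= x < i + c)%N -> entry w x = (x - i)%N) /\
      (forall x y, (i + c < x)%N -> (i + c < y)%N -> entry w x = v -> (j < entry w y < v)%N -> (x < y)%N)].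

Hypotheses (hj : ((i + j).+1 < p)%N) (hv : (j < v)%N).

(** The box (i, c) moves the entry that was changed, j or v, from position i + c + 1 to i + c, past
    the value c, which is smaller than both. *)
Lemma addrel_left c l l' : (c < j)%N ->
  (forall w, reduced_word l w -> exists2 w', reduced_word l' w' & addrel c.+1 w w') ->
  forall w, reduced_word ((i, c) :: l) w -> exists2 w', reduced_word ((i, c) :: l') w' & addrel c w w'.
Proof.
move=> hc IH w /= /andP[_ /IH]; set w1 := (_ * w)%g => -[w1' r' [h1 h2 h3 h4 [h5 h6]]].
have ha : ((i + c).+1 < p)%N by lia.
have Ew x : entry w x = entry w1 (nat_swap (i + c) x) by rewrite -(simpleK (i + c) w) -/w1 entry_simple.
have S1 : nat_swap (i + c) (i + c) = (i + c).+1 by rewrite /nat_swap eqxx.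
have S2 : nat_swap (i + c) (i + c).+1 = (i + c)%N by rewrite /nat_swap eqxx; case: eqP; lia.
have v1 : entry w1 (i + c) = c by rewrite h5; lia.
exists (simple p (i + c) * w1')%g; first rewrite simpleK r' andbT /descent ha !entry_simple // S1 S2.
  rewrite -addnS h2 h3; last lia.
  rewrite v1; case: eqP => ?; lia.
split.
- by rewrite Ew S1 -addnS.
- by rewrite entry_simple // S1 -addnS.
- move=> x nx; rewrite Ew entry_simple //; apply: h3.
  by have := nat_swapE (i + c) x; lia.
- by move=> x hx; rewrite Ew; have -> : nat_swap (i + c) x = x by [have := nat_swapE (i + c) x; lia]; exact: h4.
split=> [x hx|x y hx hy].
  by rewrite Ew; have -> : nat_swap (i + c) x = x by [have := nat_swapE (i + c) x; lia]; apply: h5; lia.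
rewrite !Ew; have := nat_swapE (i + c) x; case=> [|[[ex ->]|[n1 [n2 ->]]]]; first lia.
  by rewrite v1; lia.
have := nat_swapE (i + c) y; case=> [|[[ey ->]|[n3 [n4 ->]]]]; first lia.
  by rewrite v1; lia.
by apply: h6; lia.
Qed.

(** Replacing v by j could destroy a descent only if a value between j and v stood just before v,
    which the last clause of [addrel] forbids. *)
Lemma addrel_later b l l' : (i < b.1)%N ->
  (forall w, reduced_word l w -> exists2 w', reduced_word l' w' & addrel 0 w w') ->
  forall w, reduced_word (b :: l) w -> exists2 w', reduced_word (b :: l') w' & addrel 0 w w'.
Proof.
move=> hb IH w /= /andP[/andP[ha d] /IH]; set a := (b.1 + b.2)%N in ha d *.
set w1 := (_ * w)%g => -[w1' r' [h1 h2 h3 h4 [h5 h6]]].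
have hia : (i < a)%N by rewrite /a; lia.
have Ew x : entry w x = entry w1 (nat_swap a x) by rewrite -(simpleK a w) -/w1 entry_simple.
have S1 : nat_swap a a = a.+1 by rewrite /nat_swap eqxx.
have S2 : nat_swap a a.+1 = a by rewrite /nat_swap eqxx; case: eqP; lia.
have Si x : (x <= i)%N -> nat_swap a x = x by have := nat_swapE a x; lia.
rewrite addn0 in h1 h2 h3 h5 h6.
move: d; rewrite !Ew S1 S2 => d.
have nj x : (i < x)%N -> entry w1 x <> j by rewrite -h1 => ? /entry_inj; lia.
exists (simple p a * w1')%g; first rewrite simpleK r' andbT /descent ha !entry_simple // S1 S2.
  rewrite !h3; [|lia..].
  have := nj a; have := nj a.+1; have := h6 a.+1 a.
  by case: eqP => e1; case: eqP => e2; lia.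
split; rewrite ?addn0.
- by rewrite Ew Si.
- by rewrite entry_simple // Si.
- by move=> x nx; rewrite Ew entry_simple //; apply: h3; have := nat_swapE a x; lia.
- by move=> x hx; rewrite Ew Si ?h4 //; lia.
split=> [x|x y hx hy]; first lia.
rewrite !Ew; have hh := h6 (nat_swap a x) (nat_swap a y).
move: hh d; have := nat_swapE a x; have := nat_swapE a y.
case=> [[-> ->]|[[-> ->]|[n1 [n2 ->]]]]; case=> [[-> ->]|[[-> ->]|[n3 [n4 ->]]]]; lia.
Qed.

End Add.

Lemma reduced_word_prefix a l l0 w : all (fun b => a < b.1 + b.2)%N l -> reduced_word (l ++ l0) w ->
  exists2 w0, reduced_word l0 w0 & forall x, (x <= a)%N -> entry w x = @entry p w0 x.
Proof.
elim: l w => [|b l IH] w /=; first by exists w.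
case/andP=> hb al /andP[/andP[h _] /(IH _ al)[w0 r0 h0]]; exists w0 => // x hx.
rewrite -h0 // entry_simple //; congr entry.
by have := nat_swapE (b.1 + b.2) x; lia.
Qed.

Lemma grid_split i n : exists2 l, grid p (n + i) = l ++ grid p i & all (fun b => i <= b.1)%N l.
Proof.
elim: n => [|n [l e al]]; first by exists [::].
exists ([seq (n + i, j) | j <- iota 0 p] ++ l)%N; first by rewrite addSn /= e catA.
rewrite all_cat al andbT; apply/allP => b /mapP[j _ ->] /=; exact: leq_addl.
Qed.

(** The rows above i are complete, so the permutation to which the new letter is applied is known on
    the first i + j + 1 positions. All boxes prepended afterwards preserve [addrel], whose net
    effect is an exchange of two values. *)
Lemma add_box P i j w :
  reduced_word [seq b <- grid p p | P b] w -> stair (i, j) -> ~~ P (i, j) ->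
  (forall b, stair b -> (b.1 < i)%N || (b.1 == i) && (b.2 < j)%N -> P b) ->
  exists w' b, [/\ reduced_word [seq b <- grid p p | (b == (i, j)) || P b] w',
    (i < b < p)%N /\ (forall x, (x < i)%N -> entry w x = (p - x.+1)%N),
    entry w i = j /\ (j < entry w b)%N &
    [/\ entry w' i = entry w b, entry w' b = j & forall x, x != i -> x != b -> entry w' x = entry w x]].
Proof.
move=> r hs nP hP; have hj : ((i + j).+1 < p)%N := hs.
set P' := fun b : nat * nat => (b == (i, j)) || P b.
have [l1 e1 al1] := grid_split i.+1 (p - i.+1).
have ep : (p - i.+1 + i.+1 = p)%N by lia.
rewrite ep in e1.
have eqf l : (i, j) \notin l -> [seq b <- l | P' b] = [seq b <- l | P b].
  move=> nl; apply: eq_in_filter => b var_block; rewrite /P'; case: eqP => // e.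
  by rewrite -e var_block in nl.
have fl1 : [seq b <- l1 | P' b] = [seq b <- l1 | P b].
  by apply: eqf; apply/negP => /(allP al1) /=; rewrite ltnn.
have e2 : iota 0 p = iota 0 j ++ j :: iota j.+1 (p - j.+1).
  by rewrite -[RHS]/(iota 0 j ++ iota j (p - j.+1).+1) -iotaD; congr iota; lia.
(* The part of the word after (i, j): the remaining boxes of row i and the rows above. *)
set A0 := [seq b <- [seq (i, c) | c <- iota j.+1 (p - j.+1)] | P b] ++ [seq b <- grid p i | P b].
have EP : [seq b <- grid p p | P b] = [seq b <- l1 | P b] ++ [seq (i, c) | c <- iota 0 j] ++ A0.
  rewrite e1 /= e2 !filter_cat map_cat filter_cat -!catA /=; congr (_ ++ (_ ++ _)).
    apply/all_filterP/allP => b /mapP[c]; rewrite mem_iota => hc ->; apply: hP; rewrite /stair /=; lia.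
  by rewrite (negbTE nP).
have EP' : [seq b <- grid p p | P' b] = [seq b <- l1 | P b] ++ [seq (i, c) | c <- iota 0 j] ++ (i, j) :: A0.
  rewrite e1 /= e2 !filter_cat map_cat filter_cat -!catA /= fl1; congr (_ ++ (_ ++ _)).
    apply/all_filterP/allP => b /mapP[c]; rewrite mem_iota => hc ->.
    by apply/orP; right; apply: hP; rewrite /stair /=; lia.
  rewrite {1}/P' eqxx /= /A0; congr (_ :: (_ ++ _)); apply: eqf.
    by apply/negP => /mapP[c]; rewrite mem_iota => hc [e]; lia.
  by rewrite mem_grid /= ltnn.
have A0st w0 : reduced_word A0 w0 -> forall x, (x <= i + j)%N -> entry w0 x = if (x < i)%N then (p - x.+1)%N else (x - i)%N.
  move=> r0 x hx.
  have al : all (fun b => i + j < b.1 + b.2)%N [seq b <- [seq (i, c) | c <- iota j.+1 (p - j.+1)] | P b].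
    rewrite all_filter; apply/allP => b /mapP[c]; rewrite mem_iota => hc -> /=; apply/implyP => _; lia.
  have [w1 r1 h1] := reduced_word_prefix al r0; rewrite h1 //.
  have hi : (i <= p)%N by lia.
  have [w2 r2 hw2] := full_rows hi; rewrite -hw2; last lia.
  congr entry; apply: (reduced_word_inj r1).
  suff -> : [seq b <- grid p i | P b] = [seq b <- grid p i | stair b] by [].
  apply: eq_in_filter => b; rewrite mem_grid => /andP[hb1 hb2]; apply/idP/idP => hb; last by apply: hP; rewrite ?hb1.
  by have := allP (reduced_word_range r1) b; rewrite mem_filter hb mem_grid hb1 hb2 => /(_ isT).
have [v [hvj hvi [w' r' [a1 a2 a3 a4 [a5 a6]]]]] 
  : exists v, [/\ (j < v)%N, forall x, (x < i)%N -> v <> (p - x.+1)%N & exists2 w', reduced_word [seq b <- grid p p | P' b] w' & addrel i j v 0 w w'].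
  have [v hv] : exists v, exists2 w0, reduced_word A0 w0 & v = @entry p w0 (i + j).+1.
    have := r; rewrite EP catA; move: ([seq b <- l1 | P b] ++ [seq (i, c) | c <- iota 0 j]) => l.
    elim: l (w) => [|bb l IH] wz /=; last by case/andP=> _ /IH.
    by move=> rz; exists (entry wz (i + j).+1), wz.
  have base w0 : reduced_word A0 w0 -> exists2 w', reduced_word ((i, j) :: A0) w' & (j < v)%N /\ addrel i j v j w0 w'.
    case: hv => w0' r0' -> r0; rewrite (reduced_word_inj r0' r0) {w0' r0'}.
    have st := A0st _ r0.
    have vj : entry w0 (i + j) = j by rewrite st // ltnNge leq_addr addKn.
    have gt : (j < entry w0 (i + j).+1)%N.
      (* A value at most j already stands at one of the positions i, ..., i + j. *)
      rewrite ltnNge; apply/negP => le.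
      have : entry w0 (i + entry w0 (i + j).+1) = entry w0 (i + j).+1.
        by rewrite st ?leq_add2l // ltnNge leq_addr addKn.
      by move/entry_inj; lia.
    have S1 : nat_swap (i + j) (i + j) = (i + j).+1 by rewrite /nat_swap eqxx.
    have S2 : nat_swap (i + j) (i + j).+1 = (i + j)%N by rewrite /nat_swap eqxx; case: eqP; lia.
    exists (simple p (i + j) * w0)%g.
      by rewrite /= simpleK r0 andbT /descent hj !entry_simple // S1 S2 vj.
    split=> //; split=> //.
    - by rewrite entry_simple // S1.
    - move=> x nx; rewrite entry_simple //.
      have := nat_swapE (i + j) x; case=> [[e]|[[-> ->]|[n1 [n2 ->]]]]; first by rewrite e eqxx in nx.
        by rewrite eqxx.
      by case: eqP => // /entry_inj.
    - by move=> x hx; rewrite st ?hx //; lia.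
    split=> [x /andP[hx1 hx2]|x y hx hy]; first by rewrite st ?ltnNge ?hx1 //; lia.
    move/entry_inj => -> hh; suff : y <> (i + j).+1 by lia.
    by move=> e; move: hh; rewrite e; lia.
  have hvj : (j < v)%N by case: hv => w0 r0 e; have [w' _ []] := base w0 r0.
  have left n : (n <= j)%N -> forall w0, reduced_word ([seq (i, c) | c <- iota (j - n) n] ++ A0) w0 ->
     exists2 w', reduced_word ([seq (i, c) | c <- iota (j - n) n] ++ (i, j) :: A0) w' & addrel i j v (j - n) w0 w'.
    elim: n => [|n IH] hn.
      by rewrite subn0 => w0 /base[w' r' [_ a']]; exists w'.
    have e : (j - n = (j - n.+1).+1)%N by lia.
    rewrite /= -e; apply: (addrel_left hj hvj); first lia.
    by rewrite -e; apply: IH; lia.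
  have {}left := left j (leqnn j); rewrite subnn in left.
  exists v; split=> //.
    move=> x hx; case: hv => w0 r0 -> e; have := A0st _ r0 x; rewrite hx -e => h.
    by have hh : (x <= i + j)%N by [lia]; have /entry_inj := h hh; lia.
  rewrite EP'; move: r; rewrite EP.
  elim: l1 al1 w {EP EP' e1 fl1} => [|b l IH] /=; first by move=> _ w0 /left.
  case/andP=> hb al w0.
  case: (P b) => /= h; last exact: IH.
  exact: (addrel_later hj hvj hb (IH al) h).
rewrite addn0 in a1 a2 a3.
rewrite addn0 in a5 a6.
have vp : (v < p)%N by rewrite -a2 entry_lt; lia.
have [b eb] : exists b, entry w b = v.
  by exists (w^-1%g (Ordinal vp)); rewrite entryE permKV.
have hb : (i < b < p)%N.
  have bp : (b < p)%N by rewrite -(entry_lt w) eb.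
  rewrite bp andbT ltnNge leq_eqVlt; apply/negP => /orP[/eqP e|lt].
    by move: eb; rewrite e a1; lia.
  by have := hvi b lt; rewrite -(a4 b lt) eb.
exists w', b; split=> //.
- by rewrite eb.
split.
- by rewrite a2 eb.
- rewrite a3 ?eb ?eqxx //; apply/eqP => e; move: eb; rewrite e a1; lia.
by move=> x nx nb; rewrite a3 //; case: eqP => //; rewrite -eb => /entry_inj e; rewrite e eqxx in nb.
Qed.

End Insertion.

(** * Tangent spaces *)

Lemma poly_nonroot (K : numFieldType) (q : {poly K}) : q != 0 -> exists s, q.[s] != 0.
Proof.
move=> nz; apply: NNPP => h.
have r s : root q s by rewrite /root; apply/negPn/negP => hs; apply: h; exists s.
pose rs : seq K := [seq n%:R | n <- iota 0 (size q)].
have ar : all (root q) rs by apply/allP => s _; exact: r.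
have ur : uniq rs by rewrite map_inj_uniq ?iota_uniq // => m n /eqP; rewrite eqr_nat => /eqP.
by have := max_poly_roots nz ar ur; rewrite size_map size_iota ltnn.
Qed.

Section Span.

Variables (p : nat) (K : numFieldType).

Definition is_lower (R : nzRingType) (A : 'M[R]_p) := forall i j : 'I_p, (i < j)%N -> A i j = 0.
Definition is_upper (R : nzRingType) (B : 'M[R]_p) := forall i j : 'I_p, (j < i)%N -> B i j = 0.
Definition supported_on (P : pred (nat * nat)) (Y : 'M[K]_p) :=
  forall i j : 'I_p, ~~ P (i : nat, j : nat) -> Y i j = 0.

Definition tangent (A V B : 'M[K]_p) (P : pred (nat * nat)) (X : 'M[K]_p) :=
  exists dA dB Y, [/\ is_lower dA, is_upper dB, supported_on P Y & X = dA *m V *m B + A *m V *m dB + Y].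

Definition spans A V B P := forall X, tangent A V B P X.

Lemma mxDE (R : nzRingType) m n (M N : 'M[R]_(m, n)) x y : (M + N) x y = M x y + N x y.
Proof. by rewrite mxE. Qed.
Lemma mxZE (R : nzRingType) m n a (M : 'M[R]_(m, n)) x y : (a *: M) x y = a * M x y.
Proof. by rewrite mxE. Qed.
Lemma mxNE (R : nzRingType) m n (M : 'M[R]_(m, n)) x y : (- M) x y = - M x y.
Proof. by rewrite mxE. Qed.

Lemma mul_deltal (R : comNzRingType) m n q (M : 'M[R]_(n, q)) (a : 'I_m) b x y :
  (delta_mx a b *m M) x y = (x == a)%:R * M b y.
Proof.
rewrite mxE (bigD1 b) //= big1 ?addr0 => [|k nk]; rewrite mxE ?eqxx ?andbT //.
by rewrite (negbTE nk) andbF mul0r.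
Qed.
Lemma mul_deltar (R : comNzRingType) m n q (M : 'M[R]_(m, n)) a (b : 'I_q) x y :
  (M *m delta_mx a b) x y = M x a * (y == b)%:R.
Proof.
rewrite mxE (bigD1 a) //= big1 ?addr0 => [|k nk]; rewrite mxE ?eqxx //.
by rewrite (negbTE nk) mulr0.
Qed.

Lemma is_lowerM (R : nzRingType) (A L : 'M[R]_p) : is_lower A -> is_lower L -> is_lower (A *m L).
Proof.
move=> hA hL i j lt; rewrite mxE big1 // => k _.
have [h|h] := ltnP i k; first by rewrite hA ?mul0r.
by rewrite hL ?mulr0 //; lia.
Qed.

Lemma is_upperM (R : nzRingType) (A L : 'M[R]_p) : is_upper A -> is_upper L -> is_upper (A *m L).
Proof.
move=> hA hL i j lt; rewrite mxE big1 // => k _.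
have [h|h] := ltnP k i; first by rewrite hA ?mul0r.
by rewrite hL ?mulr0 //; lia.
Qed.

Lemma is_lower_diag (R : nzRingType) (A L : 'M[R]_p) i : is_lower A -> is_lower L ->
  (A *m L) i i = A i i * L i i.
Proof.
move=> hA hL; rewrite mxE (bigD1 i) //= big1 ?addr0 // => k nk.
have [h|h|h] := ltngtP i k; first by rewrite hA ?mul0r.
  by rewrite hL ?mulr0.
by case/eqP: nk; apply: val_inj.
Qed.

Lemma is_upper_diag (R : nzRingType) (A L : 'M[R]_p) i : is_upper A -> is_upper L ->
  (A *m L) i i = A i i * L i i.
Proof.
move=> hA hL; rewrite mxE (bigD1 i) //= big1 ?addr0 // => k nk.
have [h|h|h] := ltngtP i k; first by rewrite hL ?mulr0.
  by rewrite hA ?mul0r.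
by case/eqP: nk; apply: val_inj.
Qed.

Lemma is_lowerD (R : nzRingType) c (A L : 'M[R]_p) : is_lower A -> is_lower L -> is_lower (c *: A + L).
Proof. by move=> hA hL i j lt; rewrite !mxE hA // hL // mulr0 addr0. Qed.

Lemma is_upperD (R : nzRingType) c (A L : 'M[R]_p) : is_upper A -> is_upper L -> is_upper (c *: A + L).
Proof. by move=> hA hL i j lt; rewrite !mxE hA // hL // mulr0 addr0. Qed.

Lemma tangentD A V B P c X Y : tangent A V B P X -> tangent A V B P Y -> tangent A V B P (c *: X + Y).
Proof.
case=> dA [dB [Z [h1 h2 h3 ->]]] [dA' [dB' [Z' [h1' h2' h3' ->]]]].
exists (c *: dA + dA'), (c *: dB + dB'), (c *: Z + Z'); split.
- exact: is_lowerD.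
- exact: is_upperD.
- by move=> i j n; rewrite !mxE h3 // h3' // mulr0 addr0.
rewrite !mulmxDl !mulmxDr -!scalemxAl -!scalemxAr !scalerDr.
by apply/matrixP => x y; rewrite !(mxDE, mxZE, mxNE); ring.
Qed.

Lemma tangent0 A V B P : tangent A V B P 0.
Proof.
exists 0, 0, 0; split; try by move=> *; rewrite mxE.
by rewrite !mul0mx mulmx0 !addr0.
Qed.

Local Notation ev s := (map_mx (horner_eval s)).

(** Spanning is an open condition: the unit matrices are lifted to polynomial families inside [S],
    and the determinant of the lifts is 1 at [s0]. *)
Lemma generic_span (S : K -> 'M[K]_p -> Prop) (good : K -> Prop) s0 :
  (forall s a X Y, S s X -> S s Y -> S s (a *: X + Y)) -> (forall s, S s 0) ->
  (forall X, exists2 G : 'M[{poly K}]_p, ev s0 G = X & forall s, good s -> S s (ev s G)) ->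
  exists2 q : {poly K}, q.[s0] != 0 & forall s, good s -> q.[s] != 0 -> forall X, S s X.
Proof.
move=> SD S0 hG.
have [G hG1] : exists G : 'I_(p * p) -> 'M[{poly K}]_p,
    forall k, ev s0 (G k) = vec_mx (delta_mx 0 k) /\ forall s, good s -> S s (ev s (G k)).
  have h (k : 'I_(p * p)) : exists G, ev s0 G = vec_mx (delta_mx 0 k) /\ forall s, good s -> S s (ev s G).
    by have [G ? ?] := hG (vec_mx (delta_mx 0 k)); exists G.
  by have [G hG1] := fin_all_exists h; exists G.
pose M := \matrix_k mxvec (G k).
have evM s k : row k (map_mx (horner_eval s) M) = mxvec (ev s (G k)).
  by rewrite -map_row rowK map_mxvec.
exists (\det M).
  rewrite -/(horner_eval s0 _) -det_map_mx.
  suff -> : map_mx (horner_eval s0) M = 1%:M by rewrite det1 oner_eq0.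
  apply/row_matrixP => k; rewrite evM (hG1 k).1 vec_mxK.
  by rewrite row1.
move=> s gs; rewrite -/(horner_eval s _) -det_map_mx => nz X.
have uM : map_mx (horner_eval s) M \in unitmx by rewrite unitmxE unitfE.
rewrite -[X]mxvecK -[mxvec X]mulmx1 -(mulVmx uM) mulmxA.
set x := _ *m invmx _; rewrite mulmx_sum_row linear_sum.
apply: big_ind => [|Y Z hY hZ|k _]; first exact: S0.
  by rewrite -[Y]scale1r; exact: SD.
rewrite linearZ /= evM mxvecK -[_ *: _]addr0; apply: SD => //.
exact: (hG1 k).2.
Qed.

(** A lower triangular matrix times the longest permutation fills all entries outside the
    staircase. *)
Lemma spans_longest (P : pred (nat * nat)) : (forall b, stair p b -> P b) ->
  spans 1%:M (perm_mx (longest_perm p)) 1%:M P.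
Proof.
move=> hP X.
exists (\matrix_(i, k) (if (k <= i)%N then X i (longest_perm p k) else 0)), 0,
  (\matrix_(i, j) (if P (i : nat, j : nat) && ~~ (longest_perm p j <= i)%N then X i j else 0)); split.
- by move=> i j lt; rewrite mxE leqNgt lt.
- by move=> i j _; rewrite mxE.
- by move=> i j n; rewrite mxE (negbTE n).
rewrite mulmx0 addr0 mulmx1; apply/matrixP => i j; rewrite !mxE.
have ll k : longest_perm p (longest_perm p k) = k by rewrite !permE rev_ordK.
rewrite (bigD1 (longest_perm p j)) //= big1 ?addr0; last first.
  move=> k nk; rewrite !mxE; case: (_ =P j) => [e|]; last by rewrite mulr0.
  by case/eqP: nk; rewrite -e ll.
rewrite !mxE ll eqxx mulr1; case: ifP => h; rewrite ?andbF ?addr0 // andbT add0r.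
rewrite hP // /stair; move: h; rewrite !permE /=; have := ltn_ord i; have := ltn_ord j; lia.
Qed.

Lemma mul_low_upp_zero (A B : 'M[K]_p) (w : 'S_p) (i j : 'I_p) : is_lower A -> is_upper B ->
  (forall a : 'I_p, (a <= i)%N -> (j < w a)%N) -> (A *m perm_mx w *m B) i j = 0.
Proof.
move=> hA hB h; rewrite -mulmxA -row_permE mxE big1 // => a _; rewrite mxE.
have [lt|le] := ltnP i a; first by rewrite hA ?mul0r.
by rewrite hB ?mulr0 //; exact: h.
Qed.

Lemma spans_step (P : pred (nat * nat)) A B (w w' : 'S_p) (i j b v : 'I_p) :
  is_lower A -> is_upper B -> (forall x, A x x != 0) -> (forall x, B x x != 0) ->
  (i < b)%N -> (j < v)%N -> w i = j -> w b = v -> w' i = v -> w' b = j ->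
  (forall x, x != i -> x != b -> w' x = w x) ->
  (forall a : 'I_p, (a <= i)%N -> (j < w' a)%N) -> ~~ P (i : nat, j : nat) ->
  spans A (perm_mx w') B (fun c => (c == (i : nat, j : nat)) || P c) ->
  exists A1 B1, [/\ is_lower A1, is_upper B1, forall x, A1 x x != 0, forall x, B1 x x != 0 &
    spans A1 (perm_mx w) B1 P].
Proof.
move=> hA hB dA0 dB0 ib jv wi wb wi' wb' wx zz nP hsp.
pose E : 'M[K]_p := delta_mx i j.
pose W' : 'M[K]_p := perm_mx w'.
have AEB x y : (A *m E *m B) x y = A x i * B j y.
  by rewrite -mulmxA mxE (bigD1 i) //= big1 ?addr0 => [|k nk]; rewrite mul_deltal ?eqxx ?mul1r // (negbTE nk) mul0r mulr0.
have claim1 X : exists dA dB c Y, [/\ is_lower dA, is_upper dB, supported_on P Y &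
    X = dA *m W' *m B + A *m W' *m dB + (c *: (A *m E *m B) + Y)].
  have [dA1 [dB1 [Y1 [h1 h2 h3 e1]]]] := hsp (A *m E *m B).
  (* Tangent vectors at w' vanish at (i, j), since w' has no entry weakly north-west of it; so [Y1]
     carries the nonzero entry of A E_ij B. *)
  have base_value : Y1 i j != 0.
    have := congr1 (fun M : 'M_p => M i j) e1; rewrite AEB [RHS]mxE [X in X + _]mxE.
    rewrite !mul_low_upp_zero // !add0r => <-.
    by rewrite mulf_neq0.
  have [dA [dB [Y [g1 g2 g3 e]]]] := hsp X.
  pose c := Y i j / Y1 i j.
  exists (- c *: dA1 + dA), (- c *: dB1 + dB), c, (- c *: Y1 + Y); split.
  - exact: is_lowerD.
  - exact: is_upperD.
  - move=> x y n; rewrite !mxE; have [/eqP[ex ey]|ne] := boolP ((x : nat, y : nat) == (i : nat, j : nat)).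
      have -> : x = i by apply: val_inj.
      have -> : y = j by apply: val_inj.
      by rewrite /c mulNr divfK // addNr.
    by rewrite h3 ?g3 ?mulr0 ?addr0 // negb_or ne.
  rewrite e {1}e1 !mulmxDl !mulmxDr -!scalemxAl -!scalemxAr !scalerDr !scaleNr.
  by apply/matrixP => x y; rewrite !(mxDE, mxZE, mxNE); ring.
pose V s : 'M[K]_p := W' + s *: E.
pose PV : 'M[{poly K}]_p := map_mx polyC W' + 'X *: map_mx polyC E.
have evC s (M : 'M[K]_p) : map_mx (horner_eval s) (map_mx polyC M) = M.
  by apply/matrixP => x y; rewrite !mxE /horner_eval hornerC.
have evV s : map_mx (horner_eval s) PV = V s.
  rewrite map_mxD evC; congr (_ + _); apply/matrixP => x y.
  by rewrite !mxE /= /horner_eval hornerM hornerX hornerC.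
have [|||q q0 hq] := @generic_span (fun s => tangent A (V s) B P) (fun s => s != 0) 0.
- by move=> s a X Y; exact: tangentD.
- by move=> s; exact: tangent0.
- move=> X; have [dA [dB [c [Y [h1 h2 h3 e]]]]] := claim1 X.
  exists (map_mx polyC dA *m PV *m map_mx polyC B + map_mx polyC A *m PV *m map_mx polyC dB
     + map_mx polyC (c *: (A *m E *m B) + Y)).
    by rewrite !map_mxD !map_mxM !evC evV /V scale0r addr0 e.
  move=> s s0; rewrite 2!map_mxD !map_mxM !evC evV.
  have t1 : tangent A (V s) B P (dA *m V s *m B + A *m V s *m dB + Y) by exists dA, dB, Y.
  have t2 : tangent A (V s) B P (A *m E *m B).
    (* Row i of [V s] is E_iv + s E_ij and its column v is E_iv alone, so their difference divided
       by s is E_ij. *)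
    exists (s^-1 *: (A *m delta_mx i i)), (- s^-1 *: (delta_mx v v *m B)), 0; split.
    - move=> x y lt; rewrite mxE; have -> : (A *m delta_mx i i) x y = 0; last by rewrite mulr0.
      rewrite mxE big1 // => k _; rewrite !mxE; case: eqP => [->|_]; last by rewrite mulr0.
      by case: eqP => [e'|_]; rewrite ?mulr0 // hA ?mul0r // -e'.
    - move=> x y lt; rewrite mxE; have -> : (delta_mx v v *m B) x y = 0; last by rewrite mulr0.
      rewrite mxE big1 // => k _; rewrite !mxE; case: eqP => [e'|_]; last by rewrite mul0r.
      by case: eqP => [e''|_]; rewrite ?mul0r // hB ?mulr0 // e'' -e'.
    - by move=> x y _; rewrite mxE.
    have d1 : delta_mx i i *m V s = delta_mx i v + s *: E.
      rewrite /V mulmxDr -scalemxAr mul_delta_mx; congr (_ + _).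
      apply/matrixP => x y; rewrite mul_deltal !mxE wi' [v == y]eq_sym.
      by case: (x == i); rewrite ?mul1r ?mul0r.
    have d2 : V s *m delta_mx v v = delta_mx i v.
      apply/matrixP => x y; rewrite mul_deltar !mxE -wi' (inj_eq perm_inj).
      have -> : (w' i == j) = false by apply/eqP => e'; move: jv; rewrite -e' wi' ltnn.
      by rewrite andbF mulr0 addr0; case: (x == i); rewrite ?mul1r ?mul0r.
    rewrite addr0 -scalemxAl -scalemxAl -scalemxAr -(mulmxA A (delta_mx i i)) d1 (mulmxA (A *m V s) (delta_mx v v)) -(mulmxA A (V s)) d2.
    rewrite mulmxDr mulmxDl -scalemxAr -scalemxAl scaleNr scalerDr scalerA mulVf // scale1r.
    by rewrite addrAC subrr add0r.
  by rewrite addrCA; apply: tangentD t2 t1.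
have [s hs] : exists s, (q * 'X).[s] != 0.
  apply: poly_nonroot; rewrite mulf_neq0 ?polyX_eq0 //.
  by apply: contraNneq q0 => ->; rewrite horner0.
move: hs; rewrite hornerM hornerX mulf_eq0 negb_or => /andP[qs s0].
have {hq} sp := hq s s0 qs.
(* Chosen so that L w U = [V s], which turns spanning for [V s] at (A, B) into spanning for w at (A
   L, U B). *)
pose L : 'M[K]_p := 1%:M + s^-1 *: delta_mx b i.
pose U : 'M[K]_p := 1%:M + (s - 1) *: delta_mx j j + (- s^-1 - 1) *: delta_mx v v + delta_mx j v.
have nij : (i == b) = false by apply/eqP => e; move: ib; rewrite e ltnn.
have njv : (j == v) = false by apply/eqP => e; move: jv; rewrite e ltnn.
have lowL : is_lower L.
  move=> x y lt; rewrite !mxE; case: eqP => [e|_]; first by move: lt; rewrite e ltnn.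
  rewrite add0r; case: eqP => [e1|_]; case: eqP => [e2|_]; rewrite ?mulr0 //.
  by move: lt; rewrite e1 e2 ltnNge (ltnW ib).
have uppU : is_upper U.
  move=> x y lt; rewrite !mxE; case: (x =P y) => [e|nxy]; first by move: lt; rewrite e ltnn.
  case: (x =P j) => [e1|n1]; case: (y =P j) => [e2|n2]; case: (x =P v) => [e3|n3]; case: (y =P v) => [e4|n4];
    rewrite /= ?mulr0 ?addr0 //; try by case: nxy; congruence.
  by move: lt; rewrite e1 e4 ltnNge (ltnW jv).
have LWU : L *m perm_mx w *m U = V s.
  rewrite -mulmxA -row_permE; apply/matrixP => x y.
  rewrite mulmxDl mul1mx -scalemxAl mxE [X in _ + X]mxE.
  have -> : (delta_mx b i *m row_perm w U) x y = (x == b)%:R * U j y.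
    by rewrite mul_deltal mxE wi.
  rewrite [row_perm w U x y]mxE /V [in RHS]mxE [X in _ = X + _]mxE [X in _ = _ + X]mxE [E x y]mxE.
  have [->|nx] := eqVneq x i.
    rewrite nij wi wi' !mxE eqxx njv /= mul0r mulr0 addr0.
    have [->|ny] := eqVneq y j; first by rewrite ?eqxx ?njv [v == j]eq_sym njv /=; ring.
    by rewrite ?[j == y]eq_sym ?(negbTE ny) [v == y]eq_sym; case: (y == v) => /=; ring.
  have [->|nb] := eqVneq x b.
    rewrite wb wb' !mxE eqxx [v == j]eq_sym njv /= eqxx.
    have [->|ny] := eqVneq y j; first by rewrite ?njv ?[v == j]eq_sym ?njv ?eqxx /=; field.
    by rewrite ?[j == y]eq_sym ?(negbTE ny) [v == y]eq_sym; case: (y == v) => /=; ring.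
  rewrite wx // !mxE.
  have -> : (w x == j) = false by rewrite -wi (inj_eq perm_inj) (negbTE nx).
  have -> : (w x == v) = false by rewrite -wb (inj_eq perm_inj) (negbTE nb).
  by rewrite /=; ring.
exists (A *m L), (U *m B); split.
- exact: is_lowerM.
- exact: is_upperM.
- by move=> x; rewrite is_lower_diag // mulf_neq0 // !mxE eqxx; case: (x =P b) => [->|_]; rewrite ?[b == i]eq_sym ?nij /= mulr0 addr0 oner_eq0.
- move=> x; rewrite is_upper_diag // mulf_neq0 // !mxE eqxx.
  have [ex|nx] := eqVneq x j; first by rewrite ex ?njv /= mulr1 mulr0 !addr0 addrC subrK.
  have [ex|nx'] := eqVneq x v; last by rewrite /= !mulr0 !addr0 oner_eq0.
  by rewrite /= mulr0 mulr1 !addr0 addrC subrK oppr_eq0 invr_eq0.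
move=> X; have [dA [dB [Y [h1 h2 h3 ->]]]] := sp X.
exists (dA *m L), (U *m dB), Y; split=> //; [exact: is_lowerM|exact: is_upperM|].
by rewrite -LWU !mulmxA.
Qed.

End Span.

Lemma count_lt (T : eqType) (a1 a2 : pred T) s x : x \in s -> a1 x -> ~~ a2 x ->
  (forall y, a2 y -> a1 y) -> (count a2 s < count a1 s)%N.
Proof.
move=> xs h1 h2 sub; elim: s xs => //= y s IH; rewrite inE => /orP[/eqP <-|/IH lt].
  by rewrite h1 (negbTE h2) add0n ltnS sub_count.
by have := sub y; case: (a2 y) => [->//|_]; lia.
Qed.

(** * Frames for which pipe dreams span *)

Section PipeSpan.

Variables (p : nat) (K : numFieldType).

(** Induction on the number of missing staircase boxes: [add_box] passes to a larger pipe dream and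
    [spans_step] removes the added box again. *)
Lemma pipe_span (P : pred (nat * nat)) (w : 'S_p) : reduced_word [seq b <- grid p p | P b] w ->
  exists A B : 'M[K]_p, [/\ is_lower A, is_upper B, forall x, A x x != 0, forall x, B x x != 0 &
    spans A (perm_mx w) B P].
Proof.
have [n] := ubnP (count (fun b => stair p b && ~~ P b) (grid p p)).
elim: n P w => // n IH P w lt r.
have instair b : stair p b -> b \in grid p p.
  by rewrite mem_grid /stair; lia.
have [full|nfull] := boolP (all (fun b => stair p b ==> P b) (grid p p)).
  have hP b : stair p b -> P b by move=> hb; have /implyP := allP full b (instair b hb); apply.
  have -> : w = longest_perm p.
    apply: (reduced_word_inj r); rewrite (eq_in_filter (a2 := stair p)) ?full_longest // => b hb.
    apply/idP/idP => [h|/hP //].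
    by have := allP (reduced_word_range r) b; rewrite mem_filter h hb => /(_ isT).
  exists 1%:M, 1%:M; split=> [i j h|i j h|x|x|].
  - by rewrite mxE; case: eqP => // e; move: h; rewrite e ltnn.
  - by rewrite mxE; case: eqP => // e; move: h; rewrite e ltnn.
  - by rewrite mxE eqxx oner_eq0.
  - by rewrite mxE eqxx oner_eq0.
  exact: spans_longest.
have ex1 : exists i, has (fun j => stair p (i, j) && ~~ P (i, j)) (iota 0 p).
  case/allPn: nfull => -[i j]; rewrite mem_grid => /andP[hi hj]; rewrite negb_imply => h.
  by exists i; apply/hasP; exists j; rewrite ?mem_iota.
case: (ex_minnP ex1) => i /hasP[j0 _ hj0] mini.
have ex2 : exists j, stair p (i, j) && ~~ P (i, j) by exists j0.
case: (ex_minnP ex2) => j /andP[sij nP] minj.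
have hP b : stair p b -> (b.1 < i)%N || (b.1 == i) && (b.2 < j)%N -> P b.
  case: b => bi bj sb /= /orP[h|/andP[/eqP e h]]; apply/negPn/negP => nb.
    have : (i <= bi)%N.
      apply: mini; apply/hasP; exists bj; last by rewrite sb.
      by rewrite mem_iota; move: sb; rewrite /stair /=; lia.
    by rewrite leqNgt h.
  have : (j <= bj)%N by apply: minj; rewrite -e sb.
  by rewrite leqNgt h.
have [w' [b [r' [/andP[ib bp] wlow] [wi jb] [wi' wb' wx]]]] := add_box r sij nP hP.
have [A [B [hA hB dA dB sp]]] : exists A B : 'M[K]_p, [/\ is_lower A, is_upper B, forall x, A x x != 0,
    forall x, B x x != 0 & spans A (perm_mx w') B (fun c => (c == (i, j)) || P c)].
  apply: (IH _ _ _ r'); move: lt; rewrite ltnS; apply: leq_trans.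
  apply: (@count_lt _ _ _ _ (i, j)); rewrite ?sij ?instair //=.
    by rewrite ?eqxx /= ?andbF.
  by move=> c /andP[-> /=]; rewrite negb_or => /andP[].
have io : (i < p)%N by lia.
have jp : (j < p)%N by rewrite -wi entry_lt.
have vp : (entry w b < p)%N by rewrite entry_lt.
have pvo (u : 'S_p) x y (hx : (x < p)%N) (hy : (y < p)%N) : entry u x = y -> u (Ordinal hx) = Ordinal hy.
  by rewrite -[x in entry u x]/(nat_of_ord (Ordinal hx)) entryE => e; apply: val_inj.
have [||||||||A1 [B1 [h1 h2 h3 h4 h5]]] :=
    @spans_step p K P A B w w' (Ordinal io) (Ordinal jp) (Ordinal bp) (Ordinal vp) hA hB dA dB ib jb.
- exact: pvo.
- exact: pvo.
- exact: pvo.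
- exact: pvo.
- move=> x nx nb; apply: val_inj; rewrite /= -!entryE; apply: wx; first by apply: contraNneq nx => e; apply/eqP/val_inj.
  by apply: contraNneq nb => e; apply/eqP/val_inj.
- move=> a; rewrite leq_eqVlt -entryE /= => /orP[/eqP -> |h]; first by rewrite wi'.
  rewrite wx ?wlow //; [|lia|lia].
  by move: sij; rewrite /stair /=; have := ltn_ord a; lia.
- exact: nP.
- exact: sp.
by exists A1, B1.
Qed.

(** Each condition is open and satisfiable; a common solution lies on the line joining a frame good
    for the tail to one good for the head. *)
Lemma common_span (w : 'S_p) (Ps : seq (pred (nat * nat))) :
  (forall P, List.In P Ps -> exists A B : 'M[K]_p, [/\ is_lower A, is_upper B & spans A (perm_mx w) B P]) ->
  exists A B : 'M[K]_p, [/\ is_lower A, is_upper B & forall P, List.In P Ps -> spans A (perm_mx w) B P].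
Proof.
elim: Ps => [|P0 Ps IH] h.
  by exists 0, 0; split=> // i j _; rewrite mxE.
have [|A1 [B1 [hA1 hB1 sp1]]] := IH; first by move=> P hP; apply: h; right.
have [A2 [B2 [hA2 hB2 sp2]]] := h P0 (or_introl erefl).
pose At s : 'M[K]_p := s *: (A2 - A1) + A1.
pose Bt s : 'M[K]_p := s *: (B2 - B1) + B1.
pose PA : 'M[{poly K}]_p := 'X *: map_mx polyC (A2 - A1) + map_mx polyC A1.
pose PB : 'M[{poly K}]_p := 'X *: map_mx polyC (B2 - B1) + map_mx polyC B1.
have evC s (M : 'M[K]_p) : map_mx (horner_eval s) (map_mx polyC M) = M.
  by apply/matrixP => x y; rewrite !mxE /horner_eval hornerC.
have evL s (M N : 'M[K]_p) : map_mx (horner_eval s) ('X *: map_mx polyC M + map_mx polyC N) = s *: M + N.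
  rewrite map_mxD evC; congr (_ + _); apply/matrixP => x y.
  by rewrite !mxE /= /horner_eval hornerM hornerX hornerC.
have gen P s0 : spans (At s0) (perm_mx w) (Bt s0) P ->
    exists2 q : {poly K}, q != 0 & forall s, q.[s] != 0 -> spans (At s) (perm_mx w) (Bt s) P.
  move=> sp; have [|||q q0 hq] := @generic_span p K (fun s => tangent (At s) (perm_mx w) (Bt s) P) (fun=> True) s0.
  - by move=> s a X Y; exact: tangentD.
  - by move=> s; exact: tangent0.
  - move=> X; have [dA [dB [Y [h1 h2 h3 e]]]] := sp X.
    exists (map_mx polyC dA *m map_mx polyC (perm_mx w) *m PB + PA *m map_mx polyC (perm_mx w) *m map_mx polyC dB + map_mx polyC Y).
      by rewrite !map_mxD !map_mxM !evC !evL e.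
    move=> s _; rewrite 2!map_mxD !map_mxM !evC !evL.
    by exists dA, dB, Y.
  exists q; last by move=> s hs; exact: hq.
  by apply: contraNneq q0 => ->; rewrite horner0.
have [q nq hq] : exists2 q : {poly K}, q != 0 & forall s, q.[s] != 0 ->
    forall P, List.In P Ps -> spans (At s) (perm_mx w) (Bt s) P.
  elim: Ps sp1 {IH h} => [|P Ps IH] sp1; first by exists 1; rewrite ?oner_eq0.
  have [|q nq hq] := IH; first by move=> Q hQ; apply: sp1; right.
  have [|q' nq' hq'] := gen P 0.
    by rewrite /At /Bt !scale0r !add0r; apply: sp1; left.
  exists (q * q'); first by rewrite mulf_neq0.
  move=> s; rewrite hornerM mulf_eq0 negb_or => /andP[h1 h2] Q [<-|hQ]; first exact: hq'.
  exact: hq.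
have [|q' nq' hq'] := gen P0 1; first by rewrite /At /Bt !scale1r !subrK.
have [s hs] := poly_nonroot (mulf_neq0 nq nq').
move: hs; rewrite hornerM mulf_eq0 negb_or => /andP[h1 h2].
exists (At s), (Bt s); split.
- by apply: is_lowerD => //; rewrite -scaleN1r addrC; apply: is_lowerD.
- by apply: is_upperD => //; rewrite -scaleN1r addrC; apply: is_upperD.
by move=> P [<-|hP]; [exact: hq'|exact: hq].
Qed.

End PipeSpan.

(** * Monomials as products of linear forms *)

Section MonomialSpan.

Variables (X Vt Fl : finType) (var_block : Vt -> option X) (flag_block : Fl -> X) (pos : Fl -> nat).
Variable (K : numFieldType).
Hypothesis pos_inj : forall f g, flag_block f = flag_block g -> pos f = pos g -> f = g.

(** The forms of one block have Vandermonde coefficients with the positions as nodes, so that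
    distinct forms, at most as many as the variables of the block, are independent. *)
Definition vander_coef (f : Fl) (v : Vt) : K :=
  if var_block v == Some (flag_block f) then (pos f)%:R ^+ index v (enum [pred v | var_block v == Some (flag_block f)]) else 0.

(** A relation between the rows of the matrix is a polynomial of degree below n with at least n
    roots. So the rows are independent, and a right inverse supplies the coefficients. *)
Lemma vandermonde_dual (s : {set Fl}) x v : (forall f, f \in s -> flag_block f = x) -> var_block v = Some x ->
  (#|[pred v | var_block v == Some x]| <= #|s|)%N ->
  exists a : Fl -> K, forall v', \sum_(f in s) a f * vander_coef f v' = (v' == v)%:R.
Proof.
move=> hs bv le; set E := enum [pred v | var_block v == Some x]; set n := #|[pred v | var_block v == Some x]| in le.
have sE : size E = n by rewrite -cardE.
pose V : 'M[K]_(n, #|s|) := \matrix_(r, c) (pos (enum_val c))%:R ^+ r.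
have rfV : row_free V.
  apply: inj_row_free => u uV; pose q := \poly_(r < n) (if insub r is Some r' then u 0 r' else 0) : {poly K}.
  have qE (r : 'I_n) : q`_r = u 0 r by rewrite coef_poly ltn_ord valK.
  suff q0 : q = 0 by apply/rowP => r; rewrite -qE q0 coef0 mxE.
  apply/eqP; apply: contraTT le => nq; rewrite -ltnNge.
  have ar : all (root q) [seq (pos (enum_val c))%:R | c : 'I_(#|s|)].
    apply/allP => z /mapP[c _ ->]; apply/rootP; rewrite (@horner_coef_wide _ n) ?size_poly //.
    transitivity ((u *m V) 0 c); last by rewrite uV mxE.
    by rewrite mxE; apply: eq_bigr => r _; rewrite qE mxE.
  have ur : uniq [seq ((pos (enum_val c))%:R : K) | c : 'I_(#|s|)].
    rewrite map_inj_uniq ?enum_uniq // => c c' /eqP; rewrite eqr_nat => /eqP h.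
    by apply/enum_val_inj/pos_inj => //; rewrite !hs ?enum_valP.
  have := max_poly_roots nq ar ur; rewrite size_image card_ord => lt.
  exact: leq_trans lt (size_poly _ _).
have iv v' : var_block v' = Some x -> (index v' E < n)%N.
  by move=> h; rewrite -sE index_mem mem_enum inE h.
pose r0 := Ordinal (iv _ bv).
exists (fun f => \sum_(c : 'I_(#|s|) | enum_val c == f) pinvmx V c r0) => v'.
have -> : \sum_(f in s) (\sum_(c : 'I_(#|s|) | enum_val c == f) pinvmx V c r0) * vander_coef f v' =
    \sum_(c : 'I_(#|s|)) pinvmx V c r0 * vander_coef (enum_val c) v'.
  rewrite [RHS](partition_big (fun c : 'I_(#|s|) => enum_val c) (mem s)) => [|c _]; last exact: enum_valP.
  by apply: eq_bigr => f _; rewrite mulr_suml; apply: eq_bigr => c /eqP ->.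
have [hv'|hv'] := eqVneq (var_block v') (Some x); last first.
  rewrite big1 => [|c _]; last by rewrite /vander_coef hs ?enum_valP // (negbTE hv') mulr0.
  by case: eqP => // e; case/eqP: hv'; rewrite e.
pose r := Ordinal (iv _ hv').
transitivity ((V *m pinvmx V) r r0).
  rewrite mxE; apply: eq_bigr => c _.
  by rewrite [V r c]mxE /vander_coef hs ?enum_valP // hv' eqxx mulrC.
rewrite mulmxVp // mxE -val_eqE /=.
congr (nat_of_bool _)%:R; apply/eqP/eqP => [h|-> //].
by apply: (index_inj v _ _ h); rewrite mem_enum inE ?hv' ?bv.
Qed.

Local Notation nv := #|Vt|.
Definition Xv (R : comRingType) (v : Vt) : {mpoly R[nv]} := 'X_(enum_rank v).

Definition ystar (f : Fl) : {mpoly K[nv]} := \sum_v vander_coef f v *: Xv K v.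

Definition block_deg (x : option X) (m : 'X_{1..nv}) := (\sum_(v | var_block v == x) m (enum_rank v))%N.

Definition in_block (G : {set Fl}) x := #|[set f in G | flag_block f == x]|.

Lemma block_degD x m m' : block_deg x (m + m')%MM = (block_deg x m + block_deg x m')%N.
Proof. by rewrite /block_deg -big_split; apply: eq_bigr => v _; rewrite mnmDE. Qed.

Lemma block_degU x v : block_deg x U_(enum_rank v) = (var_block v == x).
Proof.
rewrite /block_deg; case: eqP => h.
  rewrite (bigD1 v) /=; last exact/eqP.
  rewrite mnm1E eqxx big1 ?addn0 // => v' /andP[_ n].
  by rewrite mnm1E (inj_eq enum_rank_inj) eq_sym (negbTE n).
rewrite big1 // => v' /eqP h'; rewrite mnm1E (inj_eq enum_rank_inj).
by case: eqP => // e; case: h; rewrite e.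
Qed.

Definition block_vars x := #|[pred v | var_block v == Some x]|.

(** Split off a variable of block x. The degree condition leaves at least as many forms of [G] in
    this block as there are variables, so the variable is a combination of them; removing the form
    used from [G] restores the condition for the smaller monomial. *)
Lemma monomial_span m (G : {set Fl}) :
  (forall x, block_deg (Some x) m + block_vars x = (in_block G x).+1)%N -> block_deg None m = 0%N ->
  exists L : seq (K * {set Fl}),
    (forall b, b \in L -> b.2 \subset G /\ forall x, (in_block b.2 x + block_vars x = (in_block G x).+1)%N) /\
    'X_[m] = \sum_(b <- L) b.1 *: \prod_(f in b.2) ystar f.
Proof.
have [k] := ubnP (mdeg m); elim: k m G => // k IH m G lt hG h0.
have [e0|nm] := eqVneq m 0%MM.
  exists [:: (1, set0)]; split; last by rewrite big_seq1 big_set0 scale1r e0 mpolyX0.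
  move=> b; rewrite inE => /eqP -> /=; split=> [|x]; first exact: sub0set.
  rewrite -hG /in_block; have -> : [set f in set0 | flag_block f == x] = set0 by apply/setP => f; rewrite !inE.
  by rewrite cards0 /block_deg big1 // => v _; rewrite e0 mnm0E.
have [i mi] : exists i, (0 < m i)%N.
  apply/existsP; apply: contraNT nm; rewrite negb_exists => /forallP h.
  by apply/eqP/mnmP => i; rewrite mnm0E; have := h i; rewrite lt0n negbK => /eqP.
have [v ev] : exists v, i = enum_rank v by exists (enum_val i); rewrite enum_valK.
have em : m = (U_(i) + (m - U_(i)))%MM by rewrite addmC submK // lep1mP -lt0n.
set m' := (m - U_(i))%MM in em.
have [x bv] : exists x, var_block v = Some x.
  case e: (var_block v) => [x|]; first by exists x.
  by move: h0; rewrite em block_degD ev block_degU e eqxx.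
have dx y : block_deg (Some y) m = ((x == y) + block_deg (Some y) m')%N.
  by rewrite em block_degD ev block_degU bv (inj_eq Some_inj).
have d0 : block_deg None m' = 0%N by move: h0; rewrite em block_degD ev block_degU bv.
pose s := [set f in G | flag_block f == x].
have [||a ha] := @vandermonde_dual s x v _ bv.
- by move=> f; rewrite inE => /andP[_ /eqP].
- by have := hG x; rewrite dx eqxx -/(block_vars x) -/(in_block G x); lia.
have Xve : Xv K v = \sum_(f in s) a f *: ystar f.
  rewrite /ystar; under eq_bigr do rewrite scaler_sumr.
  rewrite exchange_big /= (bigD1 v) //= [X in _ + X]big1 => [|v' nv'].
    by rewrite addr0; under eq_bigr do rewrite scalerA; rewrite -scaler_suml ha eqxx scale1r.
  by under eq_bigr do rewrite scalerA; rewrite -scaler_suml ha (negbTE nv') scale0r.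
have inbD f y : f \in s -> (in_block G y = (x == y) + in_block (G :\ f) y)%N.
  rewrite inE => /andP[fG /eqP bx]; rewrite /in_block.
  have [e|ne] := eqVneq x y.
    rewrite (cardsD1 f) inE fG bx e eqxx; congr (_ + _)%N; apply: eq_card => g.
    by rewrite !inE andbA.
  apply: eq_card => g; rewrite !inE; case: (g =P f) => // ->.
  by rewrite bx (negbTE ne) !andbF.
have step f : f \in s -> exists L : seq (K * {set Fl}),
    (forall b, b \in L -> b.2 \subset G /\ forall x, (in_block b.2 x + block_vars x = (in_block G x).+1)%N) /\
    ystar f * 'X_[m'] = \sum_(b <- L) b.1 *: \prod_(f in b.2) ystar f.
  move=> fs; have fG : f \in G by move: fs; rewrite inE => /andP[].
  have [|y|//|L [hL eL]] := IH m' (G :\ f).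
  - by move: lt; rewrite ltnS {1}em mdegD mdeg1 add1n.
  - by have := hG y; rewrite dx (inbD _ _ fs); lia.
  exists [seq (b.1, f |: b.2) | b <- L]; split.
    move=> _ /mapP[b bL ->] /=; have [h1 h2] := hL b bL; split.
      by rewrite subUset sub1set fG (subset_trans h1) // subsetDl.
    have nf : f \notin b.2 by apply/negP => /(subsetP h1); rewrite !inE eqxx.
    move=> y; rewrite (inbD _ _ fs) -addnS -h2 addnA; congr (_ + _)%N.
    rewrite /in_block; move: fs; rewrite inE fG => /eqP bx.
    have [e|ne] := eqVneq x y.
      rewrite (cardsD1 f) !inE eqxx bx e eqxx /=; congr (_ + _)%N; apply: eq_card => g.
      by rewrite !inE; case: (g =P f) => // ->; rewrite (negbTE nf).
    apply: eq_card => g; rewrite !inE; case: (g =P f) => // ->.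
    by rewrite bx (negbTE ne) !andbF.
  rewrite eL big_distrr big_map /= !big_seq; apply: eq_bigr => b bL.
  have [h1 _] := hL b bL.
  have nf : f \notin b.2 by apply/negP => /(subsetP h1); rewrite !inE eqxx.
  by rewrite big_setU1 //= scalerAr.
rewrite em mpolyXD -/(Xv K v) {1}ev -/(Xv K v) Xve big_distrl /=.
have : {subset enum s <= s} by move=> f; rewrite mem_enum.
rewrite -big_enum; elim: (enum s) => [|f l IHl] hl.
  by exists [::]; rewrite !big_nil.
have [L1 [hL1 e1]] := step f (hl f (mem_head _ _)).
have [|L2 [hL2 e2]] := IHl; first by move=> g hg; apply: hl; rewrite inE hg orbT.
exists ([seq (a f * b.1, b.2) | b <- L1] ++ L2); split.
  move=> b; rewrite mem_cat => /orP[/mapP[b' hb' ->]|]; last exact: hL2.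
  exact: (hL1 b' hb').
rewrite big_cons big_cat big_map e2 /= -scalerAl e1 scaler_sumr; congr (_ + _).
by apply: eq_bigr => b _; rewrite scalerA.
Qed.

End MonomialSpan.

(** * Minors and congruences modulo powers of X *)

(** Exchanging the two entries of a descent lowers the sum strictly, so a minimizing permutation has
    no descent and is the identity. *)
Lemma rearrangement n (f g : 'I_n -> nat) :
  (forall t u : 'I_n, (t < u)%N -> (f u < f t)%N) ->
  (forall t u : 'I_n, (t < u)%N -> (g t < g u)%N) ->
  forall s : 'S_n, (\sum_t f t * g t <= \sum_t f t * g (s t))%N /\
    (s != 1%g -> (\sum_t f t * g t < \sum_t f t * g (s t))%N).
Proof.
move=> hf hg; pose om (s : 'S_n) := (\sum_t f t * g (s t))%N.
have om1 : om 1%g = (\sum_t f t * g t)%N by apply: eq_bigr => t _; rewrite perm1.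
have key s : (forall s', (om s <= om s')%N) -> s = 1%g.
  move=> smin; apply: no_descent => i.
  have /orP[//|lt] := adj_total s i; exfalso.
  have := smin (sigma i * s)%g; rewrite leqNgt => /negP; apply.
  have n12 : Defs.adj2 i != Defs.adj1 i by rewrite -val_eqE /=; lia.
  rewrite /om (bigD1 (Defs.adj1 i)) //= (bigD1 (Defs.adj2 i)) //=.
  rewrite [X in (_ < X)%N](bigD1 (Defs.adj1 i)) //= [X in (_ < _ + X)%N](bigD1 (Defs.adj2 i)) //=.
  rewrite !addnA.
  have -> : (\sum_(t | (t != Defs.adj1 i) && (t != Defs.adj2 i)) f t * g ((sigma i * s)%g t) =
     \sum_(t | (t != Defs.adj1 i) && (t != Defs.adj2 i)) f t * g (s t))%N.
    by apply: eq_bigr => t /andP[n1 n2]; rewrite permM tpermD // eq_sym.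
  rewrite ltn_add2r !permM tpermL tpermR.
  have h1 := hf (Defs.adj1 i) (Defs.adj2 i) (ltnSn _).
  have h2 := hg _ _ lt.
  by nia.
have [s0 _ s0min] := @arg_minnP _ (1%g : 'S_n) xpredT om isT.
have s01 := key s0 (fun s' => s0min s' isT).
move=> s; rewrite -om1 -s01 -/(om s); split; first exact: s0min.
move=> ns; rewrite ltn_neqAle s0min // andbT; apply: contraNneq ns => e.
by apply/eqP; rewrite s01; apply: key => s'; rewrite -e; apply: s0min.
Qed.

(** The matrix is a product of two square matrices padded with zero columns and zero rows. *)
Lemma det_low_rank (R : comNzRingType) n (T : finType) (Rs : {set T}) (P : 'I_n -> T -> R) (Q : T -> 'I_n -> R) :
  (#|Rs| < n)%N -> \det (\matrix_(t, u) \sum_(x in Rs) P t x * Q x u) = 0.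
Proof.
move=> lt; pose P' := \matrix_(t < n, u < n) if (insub (u : nat) : option 'I_(#|Rs|)) is Some k then P t (enum_val k) else 0.
pose Q' := \matrix_(t < n, u < n) if (insub (t : nat) : option 'I_(#|Rs|)) is Some k then Q (enum_val k) u else 0.
have -> : \matrix_(t, u) \sum_(x in Rs) P t x * Q x u = P' *m Q'.
  apply/matrixP => t u; rewrite !mxE.
  pose F (k : nat) := if (insub k : option 'I_(#|Rs|)) is Some k' then P t (enum_val k') * Q (enum_val k') u else 0.
  rewrite big_enum_val (eq_bigr (fun k : 'I_(#|Rs|) => F k)); last by move=> k _; rewrite /F valK.
  rewrite (big_ord_widen _ F (ltnW lt)) [RHS](bigID (fun k : 'I_n => (k < #|Rs|)%N)) /=.
  rewrite [X in _ = _ + X]big1 ?addr0 => [|k nk]; last by rewrite !mxE insubF ?mul0r // (negbTE nk).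
  by apply: eq_bigr => k hk; rewrite !mxE /F insubT.
rewrite det_mulmx (expand_det_col P' (Ordinal lt)) big1 ?mul0r // => t _.
by rewrite mxE insubF ?mul0r // ltnn.
Qed.

(** * Congruences modulo powers of X *)

Section XAdic.

Variable K : fieldType.
Implicit Types (a b q : {poly K}).

Definition xcong k a b := exists r, a - b = 'X^k * r.

Lemma xcong_refl k a : xcong k a a.
Proof. by exists 0; rewrite subrr mulr0. Qed.

Lemma xcongD k a a' b b' : xcong k a a' -> xcong k b b' -> xcong k (a + b) (a' + b').
Proof. by move=> [r e] [r' e']; exists (r + r'); rewrite mulrDr -e -e'; ring. Qed.

Lemma xcongM k a a' b b' : xcong k a a' -> xcong k b b' -> xcong k (a * b) (a' * b').
Proof.
move=> [r e] [r' e']; exists (r * b + a' * r'); rewrite mulrDr mulrA -e mulrCA -e'; ring.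
Qed.

Lemma xcong_det n k (M N : 'M[{poly K}]_n) : (forall i j, xcong k (M i j) (N i j)) -> xcong k (\det M) (\det N).
Proof.
move=> h; rewrite /determinant; apply: (big_ind2 (xcong k)).
- exact: xcong_refl.
- by move=> *; apply: xcongD.
move=> s _; apply: xcongM; first exact: xcong_refl.
apply: (big_ind2 (xcong k)); [exact: xcong_refl|by move=> *; apply: xcongM|by move=> *].
Qed.

Lemma xcong_unit k m q : xcong k ((1 - 'X) ^+ m * q) 0 -> xcong k q 0.
Proof.
case=> r; rewrite subr0 => e.
have : 'X^k %| (1 - 'X) ^+ m * q by rewrite e dvdp_mulIl.
rewrite Gauss_dvdpr.
  by case/dvdpP => r' ->; exists r'; rewrite subr0 mulrC.
rewrite coprimep_expl // coprimep_expr // -(subr0 'X) -polyC0 coprimep_sym coprimep_XsubC.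
by rewrite rootE !hornerE oppr0 subr0 oner_eq0.
Qed.

Lemma xcong_all q : (forall k, xcong k q 0) -> q = 0.
Proof.
move=> h; apply/eqP; apply: contraT => nq; have [r] := h (size q); rewrite subr0 => e.
have : 'X^(size q) %| q by rewrite {2}e dvdp_mulIl.
by move/(dvdp_leq nq); rewrite size_polyXn ltnn.
Qed.

Lemma poly_factorX q : q.[0] = 0 -> exists r, q = 'X * r.
Proof.
move=> h; have /factor_theorem[r e] : root q 0 by rewrite rootE h.
by exists r; rewrite e subr0 mulrC.
Qed.

End XAdic.

(** * Lifting to power series *)

Section Hensel.

Variables (p : nat) (K : numFieldType) (w : 'S_p) (A B : 'M[K]_p).
Local Notation box := ('I_p * 'I_p)%type.
Local Notation flag := (box * bool)%type.
Local Notation vt := ('I_(p + p) + box)%type.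
Local Notation O := {poly K}.
Variables (S : {set box}) (o : box -> bool).

(** A flag is a box with a choice of its row (true) or column (false); it carries a linear form in
    the variables of that line. *)
Definition flag_block (f : flag) : 'I_(p + p) := if f.2 then lshift p f.1.1 else rshift p f.1.2.
(* One variable per row and column, and one per box of S; the boxes outside S give
   idle variables, which have no block. *)
Definition var_block (v : vt) : option 'I_(p + p) :=
  match v with
  | inl x => Some x
  | inr e => if e \in S then Some (flag_block (e, o e)) else None
  end.
Definition pos (f : flag) : nat := if f.2 then f.1.2 : nat else f.1.1.

Lemma pos_inj f g : flag_block f = flag_block g -> pos f = pos g -> f = g.
Proof.
move: f g => [[i j] s] [[i' j'] s']; rewrite /flag_block /pos /=.
case: s; case: s' => /=.
- by move=> /lshift_inj -> /val_inj ->.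
- by move/eqP; rewrite eq_lrshift.
- by move/eqP; rewrite eq_rlshift.
by move=> /rshift_inj -> /val_inj ->.
Qed.

(** The values of the two flags of a box multiply to its entry in A w B, all of which is put on the
    charged flag. *)
Definition base_value (f : flag) : K :=
  if f.2 == o f.1 then (A *m perm_mx w *m B) f.1.1 f.1.2 else 1.

(** The charged form of a box of [S] also contains the variable of that box, which makes the entry
    adjustable. *)
Definition base_coef (f : flag) (v : vt) : K :=
  match v with
  | inl x => if x == flag_block f then base_value f else 0
  | inr e => ((e == f.1) && (e \in S) && (f.2 == o e))%:R
  end.

Definition path_coef (f : flag) (v : vt) : O :=
  (1 - 'X) * (base_coef f v)%:P + 'X * (vander_coef var_block flag_block pos K f v)%:P.

Definition form_value (nu : vt -> O) f : O := \sum_v path_coef f v * nu v.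

Lemma path_coef_at0 f v : (path_coef f v).[0] = base_coef f v.
Proof. by rewrite !hornerE oppr0 addr0 mul1r. Qed.

Lemma path_coef_at1 f v : (path_coef f v).[1] = vander_coef var_block flag_block pos K f v.
Proof. by rewrite !hornerE subrr mul0r add0r. Qed.

Lemma path_coef_block f v : path_coef f v != 0 -> var_block v = Some (flag_block f).
Proof.
move=> h; apply/eqP; apply: contraNT h => n; rewrite /path_coef /vander_coef (negbTE n) polyC0 mulr0 addr0.
suff -> : base_coef f v = 0 by rewrite polyC0 mulr0.
case: v n => [x|e] /= n; first by rewrite -(inj_eq Some_inj) (negbTE n).
have [he|he] := boolP (e \in S); last by rewrite andbF.
have [ee|//] := eqVneq e f.1; have [es|//] := eqVneq f.2 (o e).
by move: n; rewrite he -es ee; case: (f) => ? ?; rewrite eqxx.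
Qed.

Definition based (nu : vt -> O) :=
  (forall x, nu (inl x) = 1) /\ forall e, (nu (inr e)).[0] = 0.

Lemma form_value0 nu f : based nu -> (form_value nu f).[0] = base_value f.
Proof.
case=> h1 h2; rewrite /form_value horner_sum (bigD1 (inl (flag_block f))) //= big1 ?addr0.
  by rewrite hornerM path_coef_at0 h1 /= eqxx hornerC mulr1.
move=> [x|e] n; rewrite hornerM path_coef_at0 ?h1 ?h2 ?mulr0 //=.
case: eqP => [e|_]; last by rewrite mul0r.
by case/eqP: n; rewrite e.
Qed.

(* The exponents i j satisfy the strict rearrangement inequality, so that at X = 1
   the least weight of a minor is attained on its antidiagonal only. *)
Definition approx_mx nu : 'M[O]_p :=
  \matrix_(i, j) ((1 - 'X) ^+ (i * j) * (form_value nu ((i, j), true) * form_value nu ((i, j), false))).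

Definition approx_solution k (nu : vt -> O) (PA PB : 'M[O]_p) :=
  [/\ is_lower PA, is_upper PB, forall x, nu (inl x) = 1 &
    forall i j, xcong k (approx_mx nu i j) ((PA *m perm_mx w *m PB) i j)].

Hypotheses (hA : is_lower A) (hB : is_upper B).
Hypothesis hsp : forall X : 'M[K]_p, exists dA dB (Y : 'M[K]_p), [/\ is_lower dA, is_upper dB,
  forall i j, (i, j) \notin S -> Y i j = 0 &
  X = dA *m perm_mx w *m B + A *m perm_mx w *m dB + Y].

Local Notation C := (map_mx polyC).
Local Notation ev0 := (map_mx (horner_eval 0)).

Lemma tau0 m : ((1 - 'X : O) ^+ m).[0] = 1.
Proof. by rewrite horner_exp !hornerE oppr0 addr0 expr1n. Qed.

Lemma ev0C m n (M : 'M[K]_(m, n)) : ev0 (C M) = M.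
Proof. by apply/matrixP => x y; rewrite !mxE /horner_eval hornerC. Qed.

Lemma map_polyC_perm : C (perm_mx w) = perm_mx w :> 'M[O]_p.
Proof. by rewrite map_perm_mx. Qed.

Lemma is_lowerC (M : 'M[K]_p) : is_lower M -> is_lower (C M).
Proof. by move=> h i j lt; rewrite mxE h. Qed.

Lemma is_upperC (M : 'M[K]_p) : is_upper M -> is_upper (C M).
Proof. by move=> h i j lt; rewrite mxE h. Qed.

(** The constant term of the error R is decomposed along the tangent space and the boxes of [S]:
    [dA] and [dB] correct the two triangular factors, and -Y corrects the box variables, because the
    uncharged form of a box is 1 at X = 0. *)
Lemma hensel k : exists nu PA PB, [/\ approx_solution k.+1 nu PA PB, based nu, ev0 PA = A & ev0 PB = B].
Proof.
elim: k => [|k [nu [PA [PB [[lA uB h1 hc] g eA eB]]]]].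
  pose nu (v : vt) : O := if v is inl _ then 1 else 0.
  have g : based nu by split=> // e; rewrite /nu horner0.
  exists nu, (C A), (C B); split=> //; [split=> //|exact: ev0C|exact: ev0C].
  - exact: is_lowerC.
  - exact: is_upperC.
  move=> i j; have [r e] : exists r, approx_mx nu i j - (C A *m perm_mx w *m C B) i j = 'X * r.
    apply: poly_factorX; rewrite -map_polyC_perm -!map_mxM hornerD hornerN [(C _) i j]mxE hornerC.
    rewrite mxE !hornerM tau0 !form_value0 // mul1r /base_value /=.
    by case: (o (i, j)) => /=; rewrite ?mulr1 ?mul1r subrr.
  by exists r; rewrite expr1.
have [R hR] : exists R : 'M[O]_p, approx_mx nu - PA *m perm_mx w *m PB = 'X^(k.+1) *: R.
  have h (ij : box) : exists r, approx_mx nu ij.1 ij.2 - (PA *m perm_mx w *m PB) ij.1 ij.2 = 'X^(k.+1) * r by exact: hc.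
  have [R hR] := fin_all_exists h; exists (\matrix_(i, j) R (i, j)).
  by apply/matrixP => i j; rewrite !(mxDE, mxNE, mxZE) (hR (i, j)) [in RHS]mxE.
have [dA [dB [Y [l u hY eY]]]] := hsp (ev0 R).
pose de (v : vt) : O := if v is inr e then (- Y e.1 e.2)%:P else 0.
pose nu' v := nu v + 'X^(k.+1) * de v.
have yE f : form_value nu' f = form_value nu f + 'X^(k.+1) * form_value de f.
  rewrite /form_value mulr_sumr -big_split /=; apply: eq_bigr => v _; rewrite /nu'; ring.
have de0 f : (form_value de f).[0] = if (f.1 \in S) && (f.2 == o f.1) then - Y f.1.1 f.1.2 else 0.
  rewrite /form_value horner_sum (bigD1 (inr f.1)) //= big1 ?addr0.
    rewrite hornerM path_coef_at0 /= hornerC eqxx /=.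
    by case: ifP; rewrite ?mul1r ?mul0r.
  move=> [x|e] n; rewrite hornerM path_coef_at0 /= ?horner0 ?mulr0 //.
  by case: eqP => [e'|_]; [case/eqP: n; rewrite e'|rewrite mul0r].
exists nu', (PA + 'X^(k.+1) *: C dA), (PB + 'X^(k.+1) *: C dB); split.
- split.
  + by rewrite addrC; apply: is_lowerD => //; exact: is_lowerC.
  + by rewrite addrC; apply: is_upperD => //; exact: is_upperC.
  + by move=> x; rewrite /nu' mulr0 addr0.
  move=> i j.
  pose W : 'M[O]_p := perm_mx w.
  pose u1 := form_value nu ((i, j), true); pose u2 := form_value nu ((i, j), false).
  pose v1 := form_value de ((i, j), true); pose v2 := form_value de ((i, j), false).
  pose t : O := (1 - 'X) ^+ (i * j).
  (* The new error divided by X^(k+1); the corrections are made to kill its constant term. *)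
  pose Q := R i j + t * (v1 * u2 + u1 * v2) + t * 'X^(k.+1) * (v1 * v2)
     - (C dA *m W *m PB) i j - (PA *m W *m C dB) i j - 'X^(k.+1) * (C dA *m W *m C dB) i j.
  have eQ : approx_mx nu' i j - ((PA + 'X^(k.+1) *: C dA) *m W *m (PB + 'X^(k.+1) *: C dB)) i j = 'X^(k.+1) * Q.
    have eR := congr1 (fun M : 'M_p => M i j) hR; rewrite !(mxDE, mxNE, mxZE) -/W in eR.
    have {}eR : approx_mx nu i j = 'X^(k.+1) * R i j + (PA *m W *m PB) i j by rewrite -eR subrK.
    rewrite !mulmxDl !mulmxDr -!scalemxAl -!scalemxAr !(mxDE, mxNE, mxZE).
    move: eR; rewrite ![approx_mx _ _ _]mxE !yE -/u1 -/u2 -/v1 -/v2 -/t /Q => eR.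
    have -> : t * ((u1 + 'X^(k.+1) * v1) * (u2 + 'X^(k.+1) * v2)) =
      t * (u1 * u2) + 'X^(k.+1) * (t * (v1 * u2 + u1 * v2) + t * 'X^(k.+1) * (v1 * v2)) by ring.
    by rewrite eR; ring.
  have [r er] : exists r, Q = 'X * r; last by exists r; rewrite eQ er mulrA -exprSr.
  apply: poly_factorX.
  have E0 (M : 'M[O]_p) : (M i j).[0] = ev0 M i j by rewrite mxE.
  have k0 : ('X^(k.+1) : O).[0] = 0 by rewrite hornerXn expr0n.
  rewrite /Q !(hornerD, hornerN, hornerM) k0 !(mulr0, mul0r, subr0, addr0).
  rewrite !E0 !map_mxM !ev0C eA eB /W -map_polyC_perm ev0C eY !(mxDE).
  rewrite !de0 !form_value0 //= /t tau0 mul1r /base_value /=.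
  have [hS|hS] := boolP ((i, j) \in S); last by rewrite hY //= !(mul0r, mulr0); ring.
  by case: (o (i, j)) => /=; ring.
- split=> [x|e]; rewrite /nu' /=; first by rewrite mulr0 addr0 h1.
  by rewrite hornerD hornerM hornerXn expr0n mul0r addr0 g.2.
- rewrite map_mxD eA; suff -> : ev0 ('X^(k.+1) *: C dA) = 0 by rewrite addr0.
  by apply/matrixP => x y; rewrite !mxE /= /horner_eval hornerM hornerXn expr0n mul0r.
rewrite map_mxD eB; suff -> : ev0 ('X^(k.+1) *: C dB) = 0 by rewrite addr0.
by apply/matrixP => x y; rewrite !mxE /= /horner_eval hornerM hornerXn expr0n mul0r.
Qed.

End Hensel.

(** * Degenerating the minors *)

Lemma rank_count_card p (w : 'S_p) a b : (a <= p)%N ->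
  rank_count w a b = #|[set x : 'I_p | (x < a)%N && (w x < b)%N]|.
Proof.
move=> ha; have -> : rank_count w a b = (\sum_(x < a) (entry w x < b))%N.
  elim: a ha => [|a IH] ha; first by rewrite big_ord0.
  by rewrite rank_countS IH ?big_ord_recr //; exact: ltnW.
rewrite (big_ord_widen _ (fun x => (entry w x < b) : nat) ha) -sum1_card big_mkcond /= [RHS]big_mkcond /=.
by apply: eq_bigr => x _; rewrite inE entryE; case: (x < a)%N; case: (_ < b)%N.
Qed.

(** * Multihomogeneous polynomials *)

Section Homog.

Variables (X Vt : finType) (var_block : Vt -> option X) (R : idomainType).
Local Notation nv := #|Vt|.
Implicit Types (P Q : {mpoly R[nv]}) (d : option X -> nat).

Definition bhomog d P := forall m, m \in msupp P -> forall x, block_deg var_block x m = d x.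

Lemma bhomog_eq d d' P : d =1 d' -> bhomog d P -> bhomog d' P.
Proof. by move=> e h m hm x; rewrite -e; exact: h. Qed.

Lemma bhomogM d d' P Q : bhomog d P -> bhomog d' Q -> bhomog (fun x => d x + d' x)%N (P * Q).
Proof.
move=> h h' m /msuppM_le/allpairsP[[m1 m2] /= [h1 h2 ->]] x.
by rewrite block_degD (h _ h1) (h' _ h2).
Qed.

Lemma bhomog1 : bhomog (fun=> 0%N) 1.
Proof.
by move=> m; rewrite msupp1 inE => /eqP -> x; rewrite /block_deg big1 // => v _; rewrite mnm0E.
Qed.

Lemma bhomogZ d c P : bhomog d P -> bhomog d (c *: P).
Proof. by move=> h m /msuppZ_le; exact: h. Qed.

Lemma bhomog0 d : bhomog d 0.
Proof. by move=> m; rewrite msupp0. Qed.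

Lemma bhomog_sum d (I : Type) (r : seq I) (C : pred I) (F : I -> {mpoly R[nv]}) :
  (forall i, C i -> bhomog d (F i)) -> bhomog d (\sum_(i <- r | C i) F i).
Proof.
move=> h; apply: (big_ind (bhomog d)) => //; first exact: bhomog0.
by move=> P Q hP hQ m /msuppD_le; rewrite mem_cat => /orP[]; [exact: hP|exact: hQ].
Qed.

Lemma bhomog_prod (I : Type) (r : seq I) (C : pred I) (d : I -> option X -> nat) (F : I -> {mpoly R[nv]}) :
  (forall i, C i -> bhomog (d i) (F i)) ->
  bhomog (fun x => \sum_(i <- r | C i) d i x)%N (\prod_(i <- r | C i) F i).
Proof.
move=> h; elim: r => [|i r IH].
  by rewrite big_nil; apply: bhomog_eq bhomog1 => x; rewrite big_nil.
rewrite big_cons; case: ifP => hi.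
  by apply: bhomog_eq (bhomogM (h _ hi) IH) => x; rewrite big_cons hi.
by apply: bhomog_eq IH => x; rewrite big_cons hi.
Qed.

Lemma bhomog_form (x : X) (c : Vt -> R) : (forall v, c v != 0 -> var_block v = Some x) ->
  bhomog (fun y => Some x == y) (\sum_v c v *: Xv R v).
Proof.
move=> h; apply: bhomog_sum => v _; have [->|nz] := eqVneq (c v) 0.
  by rewrite scale0r; exact: bhomog0.
apply: bhomogZ => m; rewrite msuppX inE => /eqP -> y.
by rewrite block_degU (h _ nz).
Qed.

End Homog.

(** * Deforming products of linear forms into multiples of minors *)

Section Perturb.

Variables (p : nat) (K : numFieldType) (w : 'S_p) (A B : 'M[K]_p).
Local Notation box := ('I_p * 'I_p)%type.
Local Notation flag := (box * bool)%type.
Local Notation vt := ('I_(p + p) + box)%type.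
Local Notation O := {poly K}.
Variables (S : {set box}) (o : box -> bool).
Local Notation nv := #|{: vt}|.
Local Notation ys := (ystar (var_block S o) (@flag_block p) (@pos p) K).
Local Notation coefs := (path_coef w A B S o).
Local Notation yevs := (form_value w A B S o).

Definition path_form f : {mpoly O[nv]} := \sum_v coefs f v *: Xv O v.

Definition var_eval (nu : vt -> O) (i : 'I_nv) := nu (enum_val i).

Lemma path_form_eval nu f : (path_form f).@[var_eval nu] = yevs nu f.
Proof.
rewrite /path_form raddf_sum; apply: eq_bigr => v _ /=.
by rewrite mevalZ mevalXU /var_eval enum_rankK.
Qed.

Lemma path_form_at1 f : map_mpoly (horner_eval 1) (path_form f) = ys f.
Proof.
rewrite /path_form raddf_sum; apply: eq_bigr => v _ /=.
by rewrite map_mpolyZ /Xv map_mpolyX /= /horner_eval path_coef_at1.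
Qed.

Lemma path_form_bhomog f : bhomog (var_block S o) (fun y => Some (flag_block f) == y) (path_form f).
Proof. by apply: bhomog_form => v; exact: path_coef_block. Qed.

Lemma ystar_bhomog f : bhomog (var_block S o) (fun y => Some (flag_block f) == y) (ys f).
Proof. by apply: bhomog_form => v; rewrite /vander_coef; case: (var_block S o v =P _) => [-> //|_]; rewrite eqxx. Qed.

Lemma bhomog_map (Q : {mpoly K[nv]}) d : bhomog (var_block S o) d Q -> bhomog (var_block S o) d (map_mpoly polyC Q).
Proof.
move=> h m; rewrite mcoeff_msupp mcoeff_map_mpoly polyC_eq0 -mcoeff_msupp; exact: h.
Qed.

Definition flag_deg (F : {set flag}) (x : option 'I_(p + p)) := (\sum_(f in F) (Some (flag_block f) == x))%N.

(** The polynomial is the minor of [approx_mx] on rows [f] and columns [g], divided by its least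
    power of 1 - X, times the Vandermonde forms of the remaining flags. By rearrangement only the
    antidiagonal term survives at X = 1. *)
Lemma perturbed_exists (F : {set flag}) n (f g : 'I_n -> 'I_p) a b :
  (forall t u : 'I_n, (t < u)%N -> (f u < f t)%N) ->
  (forall t u : 'I_n, (t < u)%N -> (g t < g u)%N) ->
  (forall t, f t < a)%N -> (forall t, g t < b)%N ->
  (#|[set x : 'I_p | (x < a)%N && (w x < b)%N]| < n)%N ->
  (forall t s, ((f t, g t), s) \in F) ->
  exists PF : {mpoly O[nv]}, [/\ bhomog (var_block S o) (flag_deg F) PF,
    map_mpoly (horner_eval 1) PF = \prod_(e in F) ys e &
    forall k nu PA PB, approx_solution w A B S o k nu PA PB -> xcong k (PF.@[var_eval nu]) 0].
Proof.
move=> hf hg fa gb card_lt inF.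
pose om (s : 'S_n) := (\sum_t f t * g (s t))%N.
pose om1 := (\sum_t f t * g t)%N.
have [om_le om_lt] : (forall s, om1 <= om s)%N /\ (forall s, s != 1%g -> om1 < om s)%N.
  split=> s; have [] := @rearrangement n (fun t => f t : nat) (fun t => g t : nat) hf hg s; first by [].
  by move=> _.
have f_inj : injective f.
  by move=> t u e; apply: val_inj; case: (ltngtP t u) => [/hf|/hf|//]; rewrite e ltnn.
pose h (x : 'I_n * bool) : flag := ((f x.1, g x.1), x.2).
have h_inj : injective h by move=> [t s] [t' s'] [/f_inj -> _ ->].
pose C := h @: setT.
have CF : C \subset F by apply/subsetP => _ /imsetP[[t s] _ ->]; exact: inF.
have big_split_F (R : Type) (idx : R) (op : Monoid.com_law idx) (G : flag -> R) :
    \big[op/idx]_(e in F) G e =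
    op (\big[op/idx]_t (op (G ((f t, g t), true)) (G ((f t, g t), false)))) (\big[op/idx]_(e in F :\: C) G e).
  rewrite (big_setID C) /= (setIidPr CF) /C (big_imset _ (in2W h_inj)) /=; congr (op _ _).
  rewrite (eq_bigl xpredT) => [|x]; last by rewrite inE.
  rewrite -(pair_bigA _ (fun t s => G (h (t, s)))) /=; apply: eq_bigr => t _.
  rewrite (bigD1 true) //= (big_pred1 false) //; by case.
pose tau : O := 1 - 'X.
pose XX i j : {mpoly O[nv]} := path_form ((i, j), true) * path_form ((i, j), false).
pose detP : {mpoly O[nv]} := \sum_(s : 'S_n) ((-1) ^+ s * tau ^+ (om s - om1)) *: \prod_t XX (f t) (g (s t)).
pose rest : {mpoly K[nv]} := \prod_(e in F :\: C) ys e.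
exists (detP * map_mpoly polyC rest); split.
- have hrest : bhomog (var_block S o) (fun x => \sum_(e in F :\: C) (Some (flag_block e) == x))%N (map_mpoly polyC rest).
    by apply: bhomog_map; apply: bhomog_prod => e _; exact: ystar_bhomog.
  apply: (@bhomog_eq _ _ _ _ (fun x => (\sum_t ((Some (lshift p (f t)) == x) + (Some (rshift p (g t)) == x)))
       + \sum_(e in F :\: C) (Some (flag_block e) == x))%N).
    by move=> x; rewrite /flag_deg big_split_F.
  apply: bhomogM hrest; apply: bhomog_sum => s _; apply: bhomogZ.
  apply: (@bhomog_eq _ _ _ _ (fun x => \sum_t ((Some (lshift p (f t)) == x) + (Some (rshift p (g (s t))) == x)))%N).
    move=> x; rewrite !big_split /=; congr (_ + _)%N.
    by rewrite [RHS](reindex_inj (@perm_inj _ s)).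
  by apply: bhomog_prod => t _; apply: bhomogM; exact: path_form_bhomog.
- rewrite big_split_F rmorphM /=; congr (_ * _); last first.
    by apply/mpolyP => m; rewrite !mcoeff_map_mpoly /= /horner_eval hornerC.
  rewrite /detP raddf_sum (bigD1 1%g) //= [X in _ + X]big1 ?addr0 => [|s ns].
    rewrite map_mpolyZ odd_perm1 expr0 mul1r.
    have -> : om 1%g = om1 by apply: eq_bigr => t _; rewrite perm1.
    rewrite subnn expr0 rmorph1 scale1r (rmorph_prod (map_mpoly (horner_eval 1))); apply: eq_bigr => t _.
    by rewrite perm1 rmorphM /= !path_form_at1.
  rewrite map_mpolyZ; apply: (etrans (congr1 (fun c => c *: _) (_ : _ = 0))); last exact: scale0r.
  rewrite /= /horner_eval hornerM [X in _ * X]horner_exp hornerD hornerN hornerX hornerC subrr.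
  by rewrite expr0n subn_eq0 leqNgt om_lt //= mulr0.
move=> k nu PA PB [lA uB _ hc]; rewrite mevalM.
suff h0 : xcong k detP.@[var_eval nu] 0.
  by rewrite -(mul0r (map_mpoly polyC rest).@[var_eval nu]); apply: xcongM => //; exact: xcong_refl.
apply: (@xcong_unit _ _ om1).
have -> : (1 - 'X) ^+ om1 * detP.@[var_eval nu] = \det (\matrix_(t, u) approx_mx w A B S o nu (f t) (g u)).
  rewrite /detP raddf_sum /= mulr_sumr; apply: eq_bigr => s _.
  rewrite mevalZ (rmorph_prod (meval (var_eval nu))).
  transitivity ((-1) ^+ s * (tau ^+ om s * \prod_t (XX (f t) (g (s t))).@[var_eval nu])).
    by rewrite -[in RHS](subnKC (om_le s)) exprD !mulrA; congr (_ * _ * _); exact: mulrC.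
  congr (_ * _); rewrite /om -prodrXr -big_split; apply: eq_bigr => t _.
  by rewrite !mxE mevalM !path_form_eval.
pose M0 := \matrix_(t < n, u < n) ((PA *m perm_mx w *m PB) (f t) (g u)).
have <- : \det M0 = 0; last by apply: xcong_det => t u; rewrite [X in xcong _ X _]mxE [X in xcong _ _ X]mxE; exact: hc.
rewrite -(@det_low_rank _ n _ _ (fun t x => PA (f t) x) (fun x u => PB (w x) (g u)) card_lt); congr (\det _).
apply/matrixP => t u; rewrite mxE [RHS]mxE -mulmxA -row_permE mxE.
(* Triangularity leaves only the indices x < a with w x < b, too few for an n by n minor. *)
rewrite [LHS](bigID (mem [set x : 'I_p | (x < a)%N && (w x < b)%N])) /= [X in _ + X]big1 ?addr0.
  by apply: eq_bigr => x _; rewrite mxE.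
move=> x; rewrite inE negb_and -!leqNgt mxE => /orP[h1|h1].
  by rewrite lA ?mul0r //; apply: leq_trans (fa t) h1.
by rewrite uB ?mulr0 //; apply: leq_trans (gb u) h1.
Qed.

End Perturb.

(** * From spanning sets of boxes to pipe dreams *)

Section PipeOfSpan.

Variables (p : nat) (K : numFieldType) (w : 'S_p) (A B : 'M[K]_p).
Local Notation box := ('I_p * 'I_p)%type.
Local Notation flag := (box * bool)%type.
Local Notation vt := ('I_(p + p) + box)%type.
Local Notation O := {poly K}.
Variables (S : {set box}) (o : box -> bool).
Local Notation nv := #|{: vt}|.
Local Notation ys := (ystar (var_block S o) (@flag_block p) (@pos p) K).

Definition box_load (x : 'I_(p + p)) := #|[set e in S | flag_block (e, o e) == x]|.

Lemma block_vars_load x : block_vars (var_block S o) x = (box_load x).+1.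
Proof.
rewrite /block_vars -sum1_card (eq_bigl (fun v => var_block S o v == Some x)) //.
rewrite big_sumType /= -[RHS]add1n; congr (_ + _)%N.
  by rewrite (big_pred1 x) // => y; rewrite (inj_eq Some_inj).
rewrite /box_load -sum1_card; apply: eq_bigl => e; rewrite !inE /=.
by case: ifP => // _; rewrite (inj_eq Some_inj).
Qed.

Lemma in_block_setT x : in_block (@flag_block p) setT x = p.
Proof.
rewrite /in_block; case: (split_ordP x) => i ->.
  have -> : [set f in setT | flag_block f == lshift p i] = [set ((i, j), true) | j in 'I_p].
    apply/setP => -[[i' j] s]; rewrite !inE /flag_block /=; apply/eqP/imsetP.
      by case: s => /= [/lshift_inj -> | /eqP]; [exists j|rewrite eq_rlshift].
    by case=> j' _ [-> _ ->].
  by rewrite card_imset ?card_ord // => j j' [].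
have -> : [set f in setT | flag_block f == rshift p i] = [set ((j, i), false) | j in 'I_p].
  apply/setP => -[[j i'] s]; rewrite !inE /flag_block /=; apply/eqP/imsetP.
    by case: s => /= [/eqP|/rshift_inj ->]; [rewrite eq_lrshift|exists j].
  by case=> j' _ [_ -> ->].
by rewrite card_imset ?card_ord // => j j' [].
Qed.

Lemma in_block_setC (F : {set flag}) x : (in_block (@flag_block p) F x + in_block (@flag_block p) (~: F) x = p)%N.
Proof.
rewrite -[RHS](in_block_setT x) /in_block -cardsUI addnC.
have -> : [set f in F | flag_block f == x] :&: [set f in ~: F | flag_block f == x] = set0.
  by apply/setP => f; rewrite !inE; case: (f \in F); rewrite ?andbF.
rewrite cards0 add0n; apply: eq_card => f; rewrite !inE.
by case: (f \in F); rewrite ?orbF.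
Qed.

Lemma box_load_le x : (box_load x <= p)%N.
Proof.
rewrite -[X in (_ <= X)%N](in_block_setT x) /box_load /in_block.
have inj : injective (fun e => (e, o e)) by move=> e e' [].
rewrite -(card_imset _ inj).
by apply: subset_leq_card; apply/subsetP => f /imsetP[e he ->]; move: he; rewrite !inE => /andP[_].
Qed.

Hypotheses (hA : is_lower A) (hB : is_upper B).
Hypothesis hsp : forall X : 'M[K]_p, exists dA dB (Y : 'M[K]_p), [/\ is_lower dA, is_upper dB,
  forall i j, (i, j) \notin S -> Y i j = 0 &
  X = dA *m perm_mx w *m B + A *m perm_mx w *m dB + Y].

(** Outside this set of boxes both flags lie in [F], as the antidiagonal of a perturbed minor
    requires. *)
Definition flag_pred (F : {set flag}) (b : nat * nat) :=
  [exists e : box, [&& (e.1 == b.1 :> nat), (e.2 == b.2 :> nat) & ((e, true) \notin F) || ((e, false) \notin F)]].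

(** In block x such a set has p minus the load of [S] elements, the size given by [monomial_span]
    for the set of all flags. *)
Definition large_flag_set (F : {set flag}) := [forall x, in_block (@flag_block p) F x + block_vars (var_block S o) x == p.+1]%N.

Lemma flag_deg_Some F x : flag_deg F (Some x) = in_block (@flag_block p) F x.
Proof.
rewrite /flag_deg /in_block -sum1_card big_mkcond [RHS]big_mkcond; apply: eq_bigr => f _ /=.
by rewrite inE (inj_eq Some_inj); case: (f \in F) => //=; case: eqP.
Qed.

Lemma flag_deg_None (F : {set flag}) : flag_deg F None = 0%N.
Proof. by rewrite /flag_deg big1. Qed.

Definition perturbation F (PF : {mpoly O[nv]}) :=
  [/\ bhomog (var_block S o) (flag_deg F) PF, map_mpoly (horner_eval 1) PF = \prod_(e in F) ys e &
    forall k nu PA PB, approx_solution w A B S o k nu PA PB -> xcong k (PF.@[var_eval nu]) 0].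

Lemma chain_perturbation F a b c : chain (flag_pred F) a 0 b c -> (a < p)%N -> (b <= p)%N ->
  (rank_count w a b < size c)%N -> exists PF, perturbation F PF.
Proof.
case/andP=> pw al ha hb lt; set n := size c in lt.
have ac (t : 'I_n) : [&& (nth (0, 0) c t).1 < a, (nth (0, 0) c t).2 < b & ~~ flag_pred F (nth (0, 0) c t)]%N.
  have := all_nthP (0, 0)%N al t (ltn_ord t) => /and4P[-> _ -> ->]; by [].
have pf (t : 'I_n) : ((nth (0, 0) c t).1 < p)%N by case/and3P: (ac t) => h _ _; exact: ltn_trans h ha.
have pg (t : 'I_n) : ((nth (0, 0) c t).2 < p)%N by case/and3P: (ac t) => _ h _; exact: leq_trans h hb.
have mono (t u : 'I_n) : (t < u)%N -> south_west_of (nth (0, 0)%N c t) (nth (0, 0)%N c u).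
  by move=> tu; have /pairwiseP := pw; apply; rewrite ?inE ?ltn_ord.
apply: (@perturbed_exists p K w A B S o F n (fun t => Ordinal (pf t)) (fun t => Ordinal (pg t)) a b).
- by move=> t u /mono/andP[].
- by move=> t u /mono/andP[].
- by move=> t; case/and3P: (ac t).
- by move=> t; case/and3P: (ac t).
- by rewrite -rank_count_card // ltnW.
move=> t s; case/and3P: (ac t) => _ _; apply: contraNT => h.
by apply/existsP; exists (Ordinal (pf t), Ordinal (pg t)); rewrite /= !eqxx /=; case: s h => ->; rewrite ?orbT.
Qed.

(** Each box is charged to a flag missing from [F], the row flag if possible; the complement of [F]
    has exactly the loads of [S]. *)
Lemma subword_loads F D : large_flag_set F -> subseq D (grid p p) -> all (flag_pred F) D ->
  exists o', forall x : 'I_(p + p), (load p o' D x <= box_load x)%N.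
Proof.
move=> cF sD aD.
pose o' (b : nat * nat) := [exists e : box, [&& (e.1 == b.1 :> nat), (e.2 == b.2 :> nat) & ((e, true) \notin F)]].
exists o' => x.
have -> : box_load x = in_block (@flag_block p) (~: F) x.
  have := forallP cF x => /eqP; rewrite block_vars_load; have := in_block_setC F x; lia.
have [p0|pp] := posnP p; first by have := ltn_ord x; lia.
pose tyb (b : nat * nat) : flag := ((insubd (Ordinal pp) b.1, insubd (Ordinal pp) b.2), o' b).
have tyE b : b \in D -> ((tyb b).1.1 = b.1 :> nat) /\ ((tyb b).1.2 = b.2 :> nat).
  by move/(mem_subseq sD); rewrite mem_grid => /andP[h1 h2]; rewrite /tyb /= !val_insubd h1 h2.
have uD : uniq D by apply: subseq_uniq sD _; exact: uniq_grid.
rewrite /load -size_filter -(size_map tyb) /in_block cardE; apply: uniq_leq_size.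
  rewrite map_inj_in_uniq ?filter_uniq // => b b'; rewrite !mem_filter => /andP[_ /tyE[h1 h2]] /andP[_ /tyE[h1' h2']] e.
  by rewrite [b]surjective_pairing [b']surjective_pairing -h1 -h2 -h1' -h2' e.
move=> q /mapP[b]; rewrite mem_filter => /andP[/eqP bx bD] ->.
have [h1 h2] := tyE b bD; rewrite mem_enum !inE; apply/andP; split; last first.
  apply/eqP/val_inj; rewrite /= -bx /flag_block /block_index /=; case: (o' b) => /=; first exact: h1.
  by congr (_ + _)%N; exact: h2.
have /existsP[e /and3P[/eqP e1 /eqP e2 he]] := allP aD b bD.
have te : (tyb b).1 = e.
  by rewrite [e]surjective_pairing [(tyb b).1]surjective_pairing; congr (_, _);
    apply: val_inj; [exact: (etrans h1 (esym e1))|exact: (etrans h2 (esym e2))].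
rewrite [tyb b]surjective_pairing te /=; case ob: (o' b).
  move: ob => /existsP[e' /and3P[/eqP e1' /eqP e2' he']].
  suff -> : e = e' by [].
  by rewrite [e]surjective_pairing [e']surjective_pairing; congr (_, _);
    apply: val_inj; [exact: (etrans e1 (esym e1'))|exact: (etrans e2 (esym e2'))].
case/orP: he => // he; move/negbT: ob; rewrite negb_exists => /forallP/(_ e).
by rewrite e1 e2 !eqxx he.
Qed.

(** Otherwise every large set of flags contains both flags of each box on the antidiagonal of a
    minor too large for w, and its product of forms deforms to a polynomial vanishing modulo X^k on
    solutions. A transition matrix between monomials then has determinant 1 at X = 1, yet divisible
    by every power of X. *)
Theorem pipe_of_span : exists D o', [/\ subseq D (grid p p), reduced_word D w &
  forall x : 'I_(p + p), (load p o' D x <= box_load x)%N].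
Proof.
apply: NNPP => none.
have [PF hPF] : exists PF : {set flag} -> {mpoly O[nv]}, forall F, large_flag_set F -> perturbation F (PF F).
  have h F : exists PF, large_flag_set F -> perturbation F PF.
    have [cF|] := boolP (large_flag_set F); last by exists 0.
    have [[D [sD aD rD]]|[a [b [c [hc /and3P[h1 h2 h3]]]]]] := chain_or_subword (flag_pred F) w.
      by case: none; have [o' ho'] := subword_loads cF sD aD; exists D, o'.
    by have [PF hPF] := chain_perturbation hc h1 h2 h3; exists PF.
  by have [PF hPF] := fin_all_exists h; exists PF.
pose cm (m : 'X_{1..nv}) := (forall x, block_deg (var_block S o) (Some x) m + block_vars (var_block S o) x = p.+1)%N /\ block_deg (var_block S o) None m = 0%N.
(* A monomial of the required degree in the row and column variables only; they equal 1 on a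
   solution, and so does [m0]. *)
pose m0 : 'X_{1..nv} := [multinom (if enum_val i is inl x then p - box_load x else 0)%N | i < nv].
have cm0 : cm m0.
  split=> [x|]; rewrite /block_deg big_sumType /=.
    rewrite (big_pred1 x) => [|y]; last by rewrite (inj_eq Some_inj).
    rewrite mnmE enum_rankK block_vars_load big1 => [|e _]; last by rewrite mnmE enum_rankK.
    by rewrite addn0 addnS subnK // box_load_le.
  by rewrite big_pred0 // big1 // => e _; rewrite mnmE enum_rankK.
(* All monomials of the perturbations together with [m0], so that W is square and acts on every
   value that occurs. *)
pose Lm := undup (m0 :: flatten [seq msupp (PF F) | F <- enum {set flag} & large_flag_set F]).
have cmL m : m \in Lm -> cm m.
  rewrite mem_undup inE => /orP[/eqP -> //|/flattenP[l /mapP[F]]].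
  rewrite mem_filter => /andP[cF _] -> hm; have [hb _ _] := hPF F cF.
  split=> [x|]; rewrite (hb _ hm); last exact: flag_deg_None.
  by rewrite flag_deg_Some; exact/eqP/(forallP cF).
have suppL F : large_flag_set F -> {subset msupp (PF F) <= Lm}.
  move=> cF m hm; rewrite mem_undup inE; apply/orP; right; apply/flattenP.
  by exists (msupp (PF F)) => //; apply/mapP; exists F; rewrite // mem_filter cF mem_enum.
set n := size Lm; pose mon (a : 'I_n) := nth 0%MM Lm a.
have monL a : mon a \in Lm by exact: mem_nth.
have mon_inj : injective mon.
  by move=> a b /eqP; rewrite nth_uniq ?undup_uniq // => /eqP h; apply: val_inj.
have [Ls hLs] : exists Ls : 'I_n -> seq (K * {set flag}), forall a,
    (forall b, b \in Ls a -> large_flag_set b.2) /\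
    'X_[mon a] = \sum_(b <- Ls a) b.1 *: \prod_(f in b.2) ys f.
  have h (a : 'I_n) : exists L : seq (K * {set flag}),
      (forall b, b \in L -> large_flag_set b.2) /\ 'X_[mon a] = \sum_(b <- L) b.1 *: \prod_(f in b.2) ys f.
    have [h1 h2] := cmL _ (monL a).
    have [||L [hL eL]] := @monomial_span _ _ _ (var_block S o) (@flag_block p) (@pos p) K (@pos_inj p) (mon a) setT.
    - by move=> x; rewrite in_block_setT.
    - exact: h2.
    exists L; split=> // b bL; apply/forallP => x; have [_ /(_ x)] := hL b bL.
    by rewrite in_block_setT => ->.
  by have [Ls hLs] := fin_all_exists h; exists Ls.
(* W expresses the monomials through multiples of minors: the identity at X = 1,
   but it kills a nonzero vector modulo every power of X. *)
pose W := \matrix_(a < n, b < n) \sum_(c <- Ls a) c.1%:P * (PF c.2)@_(mon b).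
have W1 : (\det W).[1] = 1.
  rewrite -/(horner_eval 1 _) -det_map_mx; suff -> : map_mx (horner_eval 1) W = 1%:M by rewrite det1.
  apply/matrixP => a b; rewrite !mxE /= /horner_eval horner_sum.
  transitivity (('X_[mon a] : {mpoly K[nv]})@_(mon b)); last by rewrite mcoeffX (inj_eq mon_inj).
  rewrite (hLs a).2 raddf_sum /= !big_seq; apply: eq_bigr => c hc.
  have [_ e _] := hPF _ ((hLs a).1 c hc).
  by rewrite hornerM hornerC mcoeffZ -e mcoeff_map_mpoly.
have W0 : \det W = 0.
  apply: xcong_all => k.
  have [nu [PA [PB [hs _ _ _]]]] := hensel o hA hB hsp k.
  have {}hs : approx_solution w A B S o k nu PA PB.
    case: hs => h1 h2 h3 h4; split=> // i j; have [r e] := h4 i j.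
    by exists ('X * r); rewrite e mulrA -exprSr.
  pose v := \col_(b < n) ('X_[mon b] : {mpoly O[nv]}).@[var_eval nu].
  have Wv a : xcong k ((W *m v) a 0) 0.
    rewrite mxE.
    have -> : \sum_b W a b * v b 0 = \sum_(c <- Ls a) c.1%:P * (PF c.2).@[var_eval nu].
      under eq_bigr do rewrite !mxE mulr_suml.
      rewrite exchange_big /= !big_seq; apply: eq_bigr => c hc.
      under eq_bigr do rewrite -mulrA; rewrite -mulr_sumr; congr (_ * _).
      rewrite [X in _ = X.@[_]]mpolyE raddf_sum /=.
      under [RHS]eq_bigr do rewrite mevalZ.
      have sub := suppL _ ((hLs a).1 c hc).
      transitivity (\sum_(m <- Lm) (PF c.2)@_m * ('X_[m] : {mpoly O[nv]}).@[var_eval nu]).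
        by rewrite (big_nth 0%MM) big_mkord.
      rewrite (bigID (fun m => m \in msupp (PF c.2))) /= [X in _ + X]big1 ?addr0 => [|m nm]; last first.
        by rewrite (memN_msupp_eq0 nm) mul0r.
      rewrite -big_filter; apply: perm_big; apply: uniq_perm; rewrite ?filter_uniq ?undup_uniq ?msupp_uniq //.
      by move=> m; rewrite mem_filter; case hm: (m \in msupp _) => //=; exact: sub.
    rewrite big_seq; apply: (big_ind (fun q => xcong k q 0)) => [|x y hx hy|c hc]; first exact: xcong_refl.
      by rewrite -[0]addr0; exact: xcongD.
    rewrite -[X in xcong _ _ X](mulr0 c.1%:P); apply: xcongM; first exact: xcong_refl.
    by have [_ _ h] := hPF _ ((hLs a).1 c hc); exact: h hs.
  have m0L : m0 \in Lm by rewrite mem_undup mem_head.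
  have i0 : (index m0 Lm < n)%N by rewrite index_mem.
  pose a0 := Ordinal i0.
  have va0 : v a0 0 = 1.
    rewrite mxE mevalX /mon nth_index // big1 // => i _; rewrite mnmE /var_eval.
    case e: (enum_val i) => [x|x]; last by rewrite expr0.
    by case: hs => _ _ -> _; rewrite expr1n.
  (* The adjugate turns W v = 0 into det W = 0 modulo X^k, read at the coordinate of [m0]. *)
  have : \det W = (\adj W *m (W *m v)) a0 0 by rewrite mulmxA mul_adj_mx mul_scalar_mx mxE va0 mulr1.
  move=> ->; rewrite mxE; apply: (big_ind (fun q => xcong k q 0)) => [|x y hx hy|b _]; first exact: xcong_refl.
    by rewrite -[0]addr0; exact: xcongD.
  rewrite -[X in xcong _ _ X](mulr0 (\adj W a0 b)); apply: xcongM; [exact: xcong_refl|exact: Wv].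
by move: W1; rewrite W0 horner0 => /eqP; rewrite eq_sym oner_eq0.
Qed.

End PipeOfSpan.

(** * Matroid ranks *)

Section Rado.

Variables (T : finType) (r : {set T} -> nat).
Hypothesis r_mono : forall E F : {set T}, E \subset F -> (r E <= r F)%N.
Hypothesis r_sub : forall E F : {set T}, (r (E :&: F) + r (E :|: F) <= r E + r F)%N.
Hypothesis r_set0 : r set0 = 0%N.
Hypothesis r_set1 : forall e, (r [set e] <= 1)%N.

(** If some set has two elements a and b, one of them can be deleted: otherwise the violating
    families K1 and K2 both contain i0 and contradict submodularity for their unions. When all sets
    are singletons their union is the transversal. *)
Lemma rado (I : finType) (V : I -> {set T}) :
  (forall K : {set I}, #|K| <= r (\bigcup_(i in K) V i))%N ->
  exists e : I -> T, (forall i, e i \in V i) /\ (#|I| <= r [set e i | i in I])%N.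
Proof.
have [n] := ubnP (\sum_i #|V i|)%N; elim: n V => // n IH V lt hV.
have [/forallP small|/forallPn[i0]] := boolP [forall i, #|V i| <= 1]%N.
  have ne i : exists x, x \in V i.
    have := hV [set i]; rewrite cards1 big_set1 => h.
    by apply/set0Pn; apply: contraTneq h => ->; rewrite r_set0.
  have [e he] := fin_all_exists ne; exists e; split=> //.
  have := hV setT; rewrite cardsT => /leq_trans; apply; apply: r_mono.
  apply/bigcupsP => i _; apply/subsetP => x xV; apply/imsetP; exists i => //.
  have := small i; rewrite leqNgt => h; apply/eqP; apply: contraNT h => nx.
  rewrite (cardsD1 x) xV (cardsD1 (e i)) !inE he andbT eq_sym nx.
  by rewrite add1n.
rewrite -ltnNge => /card_gt1P[a [b [aV bV nab]]].
pose Vx x i := if i == i0 then V i :\ x else V i.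
have step x : x \in V i0 -> (exists e : I -> T, (forall i, e i \in V i) /\ (#|I| <= r [set e i | i in I])%N) \/
    exists2 K : {set I}, i0 \in K & (r (\bigcup_(i in K) Vx x i) < #|K|)%N.
  move=> xV; have [/forallP h|/forallPn[K]] := boolP [forall K : {set I}, #|K| <= r (\bigcup_(i in K) Vx x i)]%N.
    left; have [|//|e [h1 h2]] := IH (Vx x); last first.
      exists e; split=> // i; have := h1 i; rewrite /Vx; case: eqP => // _.
      by rewrite !inE => /andP[].
    move: lt; rewrite ltnS; apply: leq_trans.
    rewrite (bigD1 i0) // [X in (_ < X)%N](bigD1 i0) //= {1}/Vx eqxx.
    have -> : (\sum_(i | i != i0) #|Vx x i| = \sum_(i | i != i0) #|V i|)%N.
      by apply: eq_bigr => i ni; rewrite /Vx (negbTE ni).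
    by rewrite [X in (_ < X + _)%N](cardsD1 x) xV.
  rewrite -ltnNge => h; right; exists K => //; apply: contraTT h => ni.
  rewrite -leqNgt; have -> : \bigcup_(i in K) Vx x i = \bigcup_(i in K) V i; last exact: hV.
  by apply: eq_bigr => i iK; rewrite /Vx; case: eqP => // e; rewrite -e iK in ni.
have [//|[K1 i1 h1]] := step a aV; have [//|[K2 i2 h2]] := step b bV.
exfalso; set U1 := \bigcup_(i in K1) _ in h1; set U2 := \bigcup_(i in K2) _ in h2.
have s1 : (#|K1 :|: K2| <= r (U1 :|: U2))%N.
  apply: leq_trans (hV _) _; apply: r_mono; apply/bigcupsP => i; rewrite inE => iK.
  have [->|ni] := eqVneq i i0.
    apply/subsetP => x xV; rewrite inE; have [xa|nxa] := eqVneq x a.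
      by apply/orP; right; apply/bigcupP; exists i0; rewrite // /Vx eqxx !inE xa nab aV.
    by apply/orP; left; apply/bigcupP; exists i0; rewrite // /Vx eqxx !inE nxa.
  case/orP: iK => iK.
    by apply: subset_trans (subsetUl _ _); apply: (bigcup_max i); rewrite // /Vx (negbTE ni).
  by apply: subset_trans (subsetUr _ _); apply: (bigcup_max i); rewrite // /Vx (negbTE ni).
have s2 : (#|(K1 :&: K2) :\ i0| <= r (U1 :&: U2))%N.
  apply: leq_trans (hV _) _; apply: r_mono; apply/bigcupsP => i; rewrite !inE => /and3P[ni iK1 iK2].
  rewrite subsetI; apply/andP; split.
    by apply: (bigcup_max i); rewrite // /Vx (negbTE ni).
  by apply: (bigcup_max i); rewrite // /Vx (negbTE ni).
have := r_sub U1 U2; have := cardsUI K1 K2; have := cardsD1 i0 (K1 :&: K2).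
by rewrite inE i1 i2; lia.
Qed.

Lemma rank_setU (E F : {set T}) : (r (E :|: F) <= r E + #|F|)%N.
Proof.
have [n] := ubnP #|F|; elim: n F => // n IH F lt.
have [->|[x xF]] := set_0Vmem F; first by rewrite setU0 leq_addr.
rewrite -(setD1K xF) setUCA cardsU1 !inE eqxx /=.
have := IH (F :\ x); have := r_sub [set x] (E :|: F :\ x); have := r_set1 x.
by move: lt; rewrite (cardsD1 x) xF; lia.
Qed.

Lemma rank_card (E : {set T}) : (r E <= #|E|)%N.
Proof. by have := rank_setU set0 E; rewrite set0U r_set0. Qed.

Lemma basis_exists (E : {set T}) : exists2 S : {set T}, S \subset E & r S = r E /\ #|S| = r E.
Proof.
have [n] := ubnP #|E|; elim: n E => // n IH E lt.
have [->|[x xE]] := set_0Vmem E; first by exists set0; rewrite ?r_set0 ?cards0.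
have [|S sS [e1 e2]] := IH (E :\ x); first by move: lt; rewrite (cardsD1 x) xE; lia.
have sE : S \subset E by apply: subset_trans sS (subsetDl _ _).
have nx : x \notin S by apply/negP => /(subsetP sS); rewrite !inE eqxx.
have [e|ne] := eqVneq (r E) (r (E :\ x)); first by exists S => //; rewrite e.
have m1 := r_mono (subsetDl E [set x]).
have m2 : (r E <= r (E :\ x) + 1)%N.
  by have := rank_setU (E :\ x) [set x]; rewrite cards1 setUC setD1K.
have m3 : (r E <= r (x |: S))%N.
  have := r_sub (x |: S) (E :\ x).
  have -> : (x |: S) :|: (E :\ x) = E.
    by rewrite -setUA (setUidPr sS) setD1K.
  have := @r_mono S ((x |: S) :&: (E :\ x)); rewrite subsetI subsetUr sS => /(_ isT); lia.
have sxE : x |: S \subset E by rewrite subUset sub1set xE.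
exists (x |: S) => //; have := r_mono sxE; have := rank_card (x |: S); rewrite cardsU1 nx; lia.
Qed.

End Rado.

(** * Ranks of sets of boxes modulo the tangent space *)

Section RankFunction.

Variables (p : nat) (K : numFieldType) (w : 'S_p) (A B : 'M[K]_p).
Local Notation box := ('I_p * 'I_p)%type.
Local Notation W := (perm_mx w).

(** The space of all dA w B + A w dB as a row space, generated by triangular matrix units. *)
Definition tanmx : 'M[K]_(p * p) :=
  (\sum_(e : box | (e.2 <= e.1)%N) <<mxvec (delta_mx e.1 e.2 *m W *m B)>> +
   \sum_(e : box | (e.1 <= e.2)%N) <<mxvec (A *m W *m delta_mx e.1 e.2)>>)%MS.

Definition coordmx (E : {set box}) : 'M[K]_(p * p) :=
  (\sum_(e in E) <<mxvec (delta_mx e.1 e.2)>>)%MS.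

Definition tangent_span E := (tanmx + coordmx E)%MS.
Definition box_rank E := (\rank (tangent_span E) - \rank tanmx)%N.

Lemma coordmxS (E F : {set box}) : E \subset F -> (coordmx E <= coordmx F)%MS.
Proof.
move=> /subsetP s; apply/sumsmx_subP => e eE.
by apply: (sumsmx_sup e) => //; exact: s.
Qed.

Lemma tangent_spanS (E F : {set box}) : E \subset F -> (tangent_span E <= tangent_span F)%MS.
Proof. by move=> s; rewrite addsmxS ?coordmxS. Qed.

Lemma tanmx_rank_le E : (\rank tanmx <= \rank (tangent_span E))%N.
Proof. by rewrite mxrankS // addsmxSl. Qed.

Lemma box_rank_mono (E F : {set box}) : E \subset F -> (box_rank E <= box_rank F)%N.
Proof. by move=> s; rewrite leq_sub2r // mxrankS // tangent_spanS. Qed.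

(** The dimension formula for two spans: the union spans their sum, while the intersection spans a
    subspace of their intersection. *)
Lemma box_rank_sub (E F : {set box}) : (box_rank (E :&: F) + box_rank (E :|: F) <= box_rank E + box_rank F)%N.
Proof.
have h1 : (\rank (tangent_span (E :|: F)) <= \rank (tangent_span E + tangent_span F)%MS)%N.
  apply: mxrankS; rewrite addsmx_sub (submx_trans (addsmxSl tanmx (coordmx E))) ?addsmxSl //=.
  apply/sumsmx_subP => e; rewrite inE => /orP[eE|eF].
    apply: submx_trans (addsmxSl _ _); apply: submx_trans (addsmxSr _ _).
    by apply: (sumsmx_sup e).
  apply: submx_trans (addsmxSr _ _); apply: submx_trans (addsmxSr _ _).
  by apply: (sumsmx_sup e).
have h2 : (\rank (tangent_span (E :&: F)) <= \rank (tangent_span E :&: tangent_span F)%MS)%N.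
  by apply: mxrankS; rewrite sub_capmx !tangent_spanS ?subsetIl ?subsetIr.
have := mxrank_sum_cap (tangent_span E) (tangent_span F).
have := tanmx_rank_le E; have := tanmx_rank_le F; have := tanmx_rank_le (E :&: F); have := tanmx_rank_le (E :|: F).
by rewrite /box_rank; lia.
Qed.

Lemma box_rank0 : box_rank set0 = 0%N.
Proof. by rewrite /box_rank /tangent_span /coordmx big_set0 addsmx0 subnn. Qed.

Lemma box_rank1 e : (box_rank [set e] <= 1)%N.
Proof.
rewrite /box_rank /tangent_span /coordmx big_set1 leq_subLR.
apply: leq_trans (mxrank_adds_leqif _ _) _; rewrite leq_add2l genmxE; exact: rank_leq_row.
Qed.

Definition decomposes (E : {set box}) (X : 'M[K]_p) := exists dA dB (Y : 'M[K]_p), [/\ is_lower dA, is_upper dB,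
  forall i j, (i, j) \notin E -> Y i j = 0 & X = dA *m W *m B + A *m W *m dB + Y].

Lemma decomposesD E c X Y : decomposes E X -> decomposes E Y -> decomposes E (c *: X + Y).
Proof.
case=> dA [dB [Z [h1 h2 h3 ->]]] [dA' [dB' [Z' [h1' h2' h3' ->]]]].
exists (c *: dA + dA'), (c *: dB + dB'), (c *: Z + Z'); split.
- exact: is_lowerD.
- exact: is_upperD.
- by move=> i j n; rewrite !mxE h3 // h3' // mulr0 addr0.
rewrite !mulmxDl !mulmxDr -!scalemxAl -!scalemxAr !scalerDr.
by apply/matrixP => x y; rewrite !(mxDE, mxZE, mxNE); ring.
Qed.

Lemma decomposes0 E : decomposes E 0.
Proof.
exists 0, 0, 0; split; try by move=> *; rewrite mxE.
by rewrite !mul0mx mulmx0 !addr0.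
Qed.

Lemma full_decomposes E : box_rank E = box_rank setT -> row_full (tangent_span setT) -> forall X, decomposes E X.
Proof.
move=> e full X.
have fE : row_full (tangent_span E).
  have e' : \rank (tangent_span E) = \rank (tangent_span setT).
    by move: e; rewrite /box_rank; have := tanmx_rank_le E; have := tanmx_rank_le setT; lia.
  by rewrite /row_full e'; exact: full.
have cl : forall x : 'rV[K]_(p * p), (x <= tangent_span E)%MS -> decomposes E (vec_mx x).
  pose clM m (M : 'M[K]_(m, p * p)) := forall x : 'rV[K]_(p * p), (x <= M)%MS -> decomposes E (vec_mx x).
  have clD m1 m2 (M1 : 'M_(m1, _)) (M2 : 'M_(m2, _)) : clM _ M1 -> clM _ M2 -> clM _ (M1 + M2)%MS.
    move=> c1 c2 x /sub_addsmxP[[u1 u2] /= ->]; rewrite linearD /= -[vec_mx (u1 *m M1)]scale1r.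
    by apply: decomposesD; [apply: c1|apply: c2]; exact: submxMl.
  have clS (P : pred box) (F : box -> 'M_(p * p)) : (forall e, P e -> clM _ (F e)) -> clM _ (\sum_(e | P e) F e)%MS.
    move=> h; apply: big_ind => [x||]; [|by move=> ? ?; exact: clD|by []].
    by rewrite submx0 => /eqP ->; rewrite linear0; exact: decomposes0.
  have clG (Y : 'M_p) : decomposes E Y -> clM _ <<mxvec Y>>%MS.
    move=> dY x; rewrite genmxE => /sub_rVP[c ->]; rewrite linearZ /= mxvecK -[_ *: _]addr0.
    by apply: decomposesD => //; exact: decomposes0.
  have delta0 (a b i j : 'I_p) : ~~ ((i == a) && (j == b)) -> (delta_mx a b : 'M[K]_p) i j = 0.
    by move=> h; rewrite mxE (negbTE h).
  apply: (clD); first apply: (clD); apply: (clS) => c hc; apply: (clG).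
  - exists (delta_mx c.1 c.2), 0, 0; split; try by move=> *; rewrite mxE.
      by move=> i j lt; apply: delta0; apply/andP => -[/eqP e1 /eqP e2]; move: lt; rewrite e1 e2 ltnNge hc.
    by rewrite mulmx0 !addr0.
  - exists 0, (delta_mx c.1 c.2), 0; split; try by move=> *; rewrite mxE.
      by move=> i j lt; apply: delta0; apply/andP => -[/eqP e1 /eqP e2]; move: lt; rewrite e1 e2 ltnNge hc.
    by rewrite !mul0mx add0r addr0.
  - exists 0, 0, (delta_mx c.1 c.2); split; try by move=> *; rewrite mxE.
      move=> i j n; apply: delta0; apply: contra n => /andP[/eqP -> /eqP ->].
      by rewrite -surjective_pairing.
    by rewrite !mul0mx mulmx0 !add0r.
by rewrite -[X]mxvecK; apply: cl; exact: submx_full.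
Qed.

Lemma decomposes_full (E : {set box}) : (forall X, decomposes E X) -> row_full (tangent_span E).
Proof.
move=> h; rewrite -sub1mx; apply/row_subP => k.
rewrite -[row k _]vec_mxK; move: (vec_mx _) => X.
have [dA [dB [Y [h1 h2 h3 ->]]]] := h X.
rewrite !linearD /= /tangent_span; apply: addmx_sub; first apply: addmx_sub.
- apply: submx_trans (addsmxSl _ _); apply: submx_trans (addsmxSl _ _).
  rewrite [dA]matrix_sum_delta !mulmx_suml linear_sum; apply: summx_sub => i _.
  rewrite !mulmx_suml linear_sum; apply: summx_sub => j _ /=.
  rewrite -!scalemxAl linearZ /=; have [le|lt] := leqP j i; last by rewrite h1 // scale0r sub0mx.
  by apply/scalemx_sub/(sumsmx_sup (i, j)) => //=; rewrite genmxE.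
- apply: submx_trans (addsmxSl _ _); apply: submx_trans (addsmxSr _ _).
  rewrite [dB]matrix_sum_delta !mulmx_sumr linear_sum; apply: summx_sub => i _.
  rewrite !mulmx_sumr linear_sum; apply: summx_sub => j _ /=.
  rewrite -!scalemxAr linearZ /=; have [le|lt] := leqP i j; last by rewrite h2 // scale0r sub0mx.
  by apply/scalemx_sub/(sumsmx_sup (i, j)) => //=; rewrite genmxE.
apply: submx_trans (addsmxSr _ _).
rewrite [Y]matrix_sum_delta linear_sum; apply: summx_sub => i _.
rewrite linear_sum; apply: summx_sub => j _ /=; rewrite linearZ /=.
have [hE|nE] := boolP ((i, j) \in E); last by rewrite h3 // scale0r sub0mx.
by apply/scalemx_sub/(sumsmx_sup (i, j)) => //=; rewrite genmxE.
Qed.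

End RankFunction.

(** * The polymatroid *)

Section Assembly.

Variables (p : nat) (w : 'S_p).
Local Notation K := rat.
Local Notation box := ('I_p * 'I_p)%type.

Definition set_pred (X : {set box}) (b : nat * nat) :=
  [exists e in X, (e.1 == b.1 :> nat) && (e.2 == b.2 :> nat)].

Lemma set_predE X (i j : 'I_p) : set_pred X (i : nat, j : nat) = ((i, j) \in X).
Proof.
apply/existsP/idP => [[[i' j'] /= /and3P[h /eqP/val_inj <- /eqP/val_inj <-]] //|h].
by exists (i, j); rewrite h !eqxx.
Qed.

Definition seq_set (D : seq (nat * nat)) : {set box} := [set e : box | (e.1 : nat, e.2 : nat) \in D].

Lemma filter_seq_set D : subseq D (grid p p) -> [seq b <- grid p p | set_pred (seq_set D) b] = D.
Proof.
move=> sD; have /(subseq_uniqP (uniq_grid p p)) e := sD; rewrite [RHS]e.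
apply: eq_in_filter => -[i j]; rewrite mem_grid => /andP[/= hi hj].
by rewrite -[i]/(nat_of_ord (Ordinal hi)) -[j]/(nat_of_ord (Ordinal hj)) set_predE inE.
Qed.

Lemma count_boxes D (P : pred (nat * nat)) : subseq D (grid p p) ->
  count P D = #|[set e : box | (e \in seq_set D) && P (e.1 : nat, e.2 : nat)]|.
Proof.
move=> sD; have uD : uniq D by apply: subseq_uniq sD _; exact: uniq_grid.
rewrite cardE -size_filter.
rewrite -(size_map (fun e : box => (e.1 : nat, e.2 : nat)) (enum _)).
apply: perm_size; apply: uniq_perm; rewrite ?filter_uniq //.
  rewrite map_inj_uniq ?enum_uniq // => -[i j] [i' j'] /= [/val_inj -> /val_inj ->] //.
move=> -[i j]; rewrite mem_filter; apply/andP/mapP => [[hP hD]|[e]].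
  have := mem_subseq sD hD; rewrite mem_grid => /andP[/= hi hj].
  by exists (Ordinal hi, Ordinal hj); rewrite // mem_enum !inE /= hP hD.
by rewrite mem_enum !inE => /andP[h1 h2] ->.
Qed.

(** There are finitely many sets of boxes, so a single frame serves all pipe dreams of [w]. *)
Lemma common_frame : exists A B : 'M[K]_p, [/\ is_lower A, is_upper B &
  forall D, subseq D (grid p p) -> reduced_word D w -> row_full (tangent_span w A B (seq_set D))].
Proof.
pose good := [seq X <- enum {set box} | reduced_word [seq b <- grid p p | set_pred X b] w].
have inIn (T : eqType) (x : T) s : x \in s -> List.In x s.
  by elim: s => //= y s IH; rewrite inE => /orP[/eqP ->|/IH]; [left|right].
have Inin (T : eqType) (x : T) s : List.In x s -> x \in s.
  by elim: s => //= y s IH [->|/IH h]; rewrite inE ?eqxx // h orbT.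
have [|A [B [hA hB h]]] := @common_span p K w (List.map set_pred good).
  move=> P /List.in_map_iff[X [<- /Inin]]; rewrite mem_filter => /andP[r _].
  by have [A [B [? ? _ _ ?]]] := pipe_span K r; exists A, B.
exists A, B; split=> // D sD rD; apply: decomposes_full => X.
have /h/(_ X) : List.In (set_pred (seq_set D)) (List.map set_pred good).
  by apply/List.in_map/inIn; rewrite mem_filter mem_enum filter_seq_set // rD.
case=> dA [dB [Y [h1 h2 h3 ->]]]; exists dA, dB, Y; split=> // i j n.
by apply: h3; rewrite set_predE.
Qed.

Definition touch (J : {set 'I_(p + p)}) : {set box} :=
  [set e : box | (lshift p e.1 \in J) || (rshift p e.2 \in J)].

Lemma touchS (J1 J2 : {set 'I_(p + p)}) : J1 \subset J2 -> touch J1 \subset touch J2.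
Proof.
move=> /subsetP s; apply/subsetP => e; rewrite !inE => /orP[/s ->//|/s ->].
by rewrite orbT.
Qed.

Lemma sum_card_fiber (T X : finType) (E : {set T}) (h : T -> X) (J : {set X}) :
  (\sum_(x in J) #|[set e in E | h e == x]| = #|[set e in E | h e \in J]|)%N.
Proof.
rewrite -sum1_card (partition_big h (mem J)) /= => [|e]; last by rewrite inE => /andP[].
apply: eq_bigr => x xJ; rewrite -sum1_card; apply: eq_bigl => e; rewrite !inE.
by case: eqP => [->|_]; rewrite ?andbF // xJ !andbT.
Qed.

Definition typo (o : nat * nat -> bool) (e : box) : bool := o (e.1 : nat, e.2 : nat).

Lemma load_fiber o D (x : 'I_(p + p)) : subseq D (grid p p) ->
  load p o D x = #|[set e in seq_set D | flag_block (e, typo o e) == x]|.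
Proof.
move=> sD; rewrite /load count_boxes //; apply: eq_card => e; rewrite !inE; congr (_ && _).
by rewrite -val_eqE /= /flag_block /block_index /typo /=; case: (o _).
Qed.

Lemma sum_load o D : subseq D (grid p p) -> (\sum_(x < p + p) load p o D x)%N = size D.
Proof.
move=> sD; rewrite (eq_bigr _ (fun x _ => load_fiber o x sD)).
rewrite (eq_bigl (fun x => x \in [set: 'I_(p + p)])) => [|x]; last by rewrite inE.
rewrite sum_card_fiber -(count_predT D) count_boxes //.
by apply: eq_card => e; rewrite !inE andbT.
Qed.

(** Exponents are the loads of charged bases of the matroid of boxes. A pipe dream is a basis, which
    gives the inequalities; conversely Rado's theorem produces a charged basis and [pipe_of_span] a
    pipe dream with the same loads. *)
Lemma pipe_exponent_polymatroid : exists2 r : {set 'I_(p + p)} -> nat, rank_function r &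
  forall m : 'X_{1..p + p}, pipe_exponent (grid p p) w m <->
      (forall J : {set 'I_(p + p)}, J \proper [set: 'I_(p + p)] -> (\sum_(j in J) m j <= r J)%N) /\
      (\sum_(i < p + p) m i)%N = r [set: 'I_(p + p)].
Proof.
have [A [B [hA hB full]]] := common_frame.
pose rk := @box_rank p K w A B.
have rkm := @box_rank_mono p K w A B; have rks := @box_rank_sub p K w A B.
have rk0 : rk set0 = 0%N by exact: box_rank0.
have rk1 := @box_rank1 p K w A B.
pose r J := rk (touch J).
have fT : row_full (tangent_span w A B setT).
  apply: decomposes_full => X; exists 0, 0, X; split=> [i j _|i j _|i j|]; rewrite ?mxE ?inE //.
  by rewrite !mul0mx mulmx0 !add0r.
have touchT : touch setT = setT by apply/setP => e; rewrite !inE.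
(* The boxes of a pipe dream form a basis: a basis S chosen among them still spans, so some pipe
   dream has loads at most those of S, and all pipe dreams of [w] have the same length. *)
have total D : subseq D (grid p p) -> reduced_word D w -> rk (seq_set D) = r setT /\ size D = r setT.
  move=> sD rD; have fD := full D sD rD.
  have e : rk (seq_set D) = r setT.
    rewrite /r touchT /rk /box_rank; move: fD fT; rewrite /row_full => /eqP -> /eqP ->.
    by [].
  split=> //; apply/eqP; rewrite eqn_leq; apply/andP; split; last first.
    rewrite -e; apply: leq_trans (rank_card rks rk0 rk1 _) _.
    rewrite -(count_predT D) count_boxes //; apply/eq_leq/eq_card => b.
    by rewrite !inE andbT.
  have [S sS [e1 e2]] := basis_exists rkm rks rk0 rk1 (seq_set D).
  have eS : box_rank w A B S = box_rank w A B setT by exact: (etrans e1 (etrans e (congr1 rk touchT))).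
  have [D' [o' [sD' rD' ld]]] := pipe_of_span (fun=> true) hA hB (full_decomposes eS fT).
  rewrite (reduced_word_size rD) -(reduced_word_size rD') -(sum_load o' sD') -(etrans e2 e : #|S| = r setT).
  apply: (@leq_trans (\sum_(x < p + p) box_load S (fun=> true) x)); first by apply: leq_sum => x _; exact: ld.
  rewrite /box_load.
  rewrite (eq_bigl (fun x => x \in [set: 'I_(p + p)])) => [|x]; last by rewrite inE.
  rewrite sum_card_fiber; apply/subset_leq_card/subsetP => b; rewrite inE => /andP[] //.
exists r.
  split=> [|J1 J2 s|J1 J2].
  - by rewrite /r; have -> : touch set0 = set0 by apply/setP => b; rewrite !inE.
  - exact/rkm/touchS.
  rewrite /r; have -> : touch (J1 :|: J2) = touch J1 :|: touch J2.
    by apply/setP => b; rewrite !inE; case: (_ \in J1); case: (_ \in J2); rewrite ?orbT.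
  apply: leq_trans (rks _ _); rewrite leq_add2r; apply: rkm.
  by rewrite subsetI !touchS ?subsetIl ?subsetIr.
move=> m; split.
  case=> D [o [sD rD hm]]; have [e1 e2] := total D sD rD.
  have cD : #|seq_set D| = rk (seq_set D).
    rewrite e1 -e2 -(count_predT D) count_boxes //; apply: eq_card => b.
    by rewrite !inE andbT.
  split; last by rewrite -e2 -(sum_load o sD); apply: eq_bigr => x _.
  move=> J _; rewrite (eq_bigr (fun x => #|[set e in seq_set D | flag_block (e, typo o e) == x]|)); last first.
    by move=> x _; rewrite hm load_fiber.
  (* The boxes charged into J are independent and touch J, so their number is at most the rank of
     [touch J]. *)
  rewrite sum_card_fiber; set E := [set e in _ | _].
  have sE : E \subset seq_set D by apply/subsetP => b; rewrite inE => /andP[].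
  have h1 : (rk (seq_set D) <= rk E + #|seq_set D :\: E|)%N.
    by have := rank_setU rks rk0 rk1 E (seq_set D :\: E); rewrite -{1}(setIidPr sE) setID.
  have h2 := cardsD (seq_set D) E; rewrite (setIidPr sE) in h2.
  have h3 := subset_leq_card sE.
  have h4 : (rk E <= r J)%N.
    apply: rkm; apply/subsetP => b; rewrite !inE => /andP[_]; rewrite /flag_block /=.
    by case: (typo o b) => /= ->; rewrite ?orbT.
  lia.
case=> hJ htot.
have hJ' (J : {set 'I_(p + p)}) : (\sum_(j in J) m j <= r J)%N.
  have [->|nJ] := eqVneq J setT; last by apply: hJ; rewrite properEneq nJ subsetT.
  rewrite -htot; apply: eq_leq; apply: eq_bigl => x; by rewrite inE.
pose N := (\sum_(i < p + p) m i)%N.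
have mN x : (m x <= N)%N by rewrite /N (bigD1 x) //= leq_addr.
have cP (J : {set 'I_(p + p)}) :
    #|[set s : 'I_(p + p) * 'I_N | (s.1 \in J) && (s.2 < m s.1)%N]| = (\sum_(x in J) m x)%N.
  rewrite -sum1_card (eq_bigl (fun s : 'I_(p + p) * 'I_N => (s.1 \in J) && (s.2 < m s.1)%N)) => [|s].
    rewrite -(pair_big_dep (mem J) (fun x (s : 'I_N) => (s < m x)%N) (fun _ _ => 1%N)) /=.
    by apply: eq_bigr => x _; rewrite -(big_ord_widen N (fun=> 1%N) (mN x)) sum1_card card_ord.
  by rewrite inE.
(* One element per unit of each exponent, to be matched with a box of the corresponding row or
   column. *)
pose I := {s : 'I_(p + p) * 'I_N | (s.2 < m s.1)%N}.
have cI : #|{: I}| = r setT.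
  rewrite -htot card_sig; transitivity (\sum_(x in [set: 'I_(p + p)]) m x)%N; last first.
    by apply: eq_bigl => x; rewrite inE.
  by rewrite -cP; apply: eq_card => s; rewrite !inE.
pose V (i : I) := touch [set (val i).1].
have hV (Q : {set I}) : (#|Q| <= rk (\bigcup_(i in Q) V i))%N.
  pose J := [set (val i).1 | i in Q].
  have -> : \bigcup_(i in Q) V i = touch J.
    apply/setP => b; rewrite inE; apply/bigcupP/orP => [[i iQ]|[/imsetP[i iQ e]|/imsetP[i iQ e]]].
    - by rewrite !inE => /orP[/eqP e|/eqP e]; [left|right]; apply/imsetP; exists i; rewrite ?e.
    - by exists i; rewrite // !inE e eqxx.
    - by exists i; rewrite // !inE e eqxx orbT.
  apply: leq_trans (hJ' J); rewrite -cP -(card_imset _ val_inj); apply/subset_leq_card/subsetP => s /imsetP[i iQ ->].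
  by rewrite inE (valP i) andbT; apply/imsetP; exists i.
have [e [he hr]] := rado rkm rks rk0 hV.
rewrite cI in hr; set S := [set e i | i in {: I}] in hr.
have cS : #|S| = r setT.
  apply/eqP; rewrite eqn_leq (leq_trans hr (rank_card rks rk0 rk1 _)) andbT.
  by rewrite -cI; exact: leq_imset_card.
have e_inj : injective e.
  have /imset_injP h : #|[set e i | i in {: I}]| == #|{: I}| by rewrite -/S cS cI.
  by move=> i j; exact: h.
(* A matched box is charged to the line of the unit it serves; indices below p are rows. *)
pose o b := [exists i, (e i == b) && ((val i).1 < p)%N].
have oe i : o (e i) = ((val i).1 < p)%N.
  apply/existsP/idP => [[i' /andP[/eqP/e_inj -> //]]|h].
  by exists i; rewrite eqxx.
have be i : flag_block (e i, o (e i)) = (val i).1.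
  rewrite oe /flag_block /=; have := he i; rewrite !inE => /orP[/eqP h|/eqP h]; rewrite -h /=.
    by rewrite ltn_ord.
  by rewrite ltnNge leq_addr.
have sl x : box_load S o x = m x.
  rewrite /box_load; have -> : [set b in S | flag_block (b, o b) == x] = e @: [set i | (val i).1 == x].
    apply/setP => b; rewrite inE; apply/andP/imsetP => [[/imsetP[i _ ->]]|[i]].
      by rewrite be => h; exists i; rewrite ?inE.
    by rewrite inE => h ->; rewrite be h; split=> //; apply: imset_f.
  rewrite (card_imset _ e_inj) -(card_imset _ val_inj).
  have -> : m x = (\sum_(y in [set x]) m y)%N by rewrite big_set1.
  rewrite -cP.
  apply: eq_card => s; rewrite !inE; apply/imsetP/andP => [[i]|[h1 h2]].
    by rewrite inE => h ->; split=> //; exact: (valP i).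
  by exists (Sub s h2); rewrite ?inE SubK.
have eS : box_rank w A B S = box_rank w A B setT.
  apply/eqP; rewrite eqn_leq (rkm _ _ (subsetT _)) /=.
  by move: hr; rewrite /r touchT.
have [D [o' [sD rD ld]]] := pipe_of_span o hA hB (full_decomposes eS fT).
exists D, o'; split=> // x; have [_ hs] := total D sD rD.
(* The loads are at most those of m and have the same total, so they agree. *)
apply/eqP; rewrite eqn_leq -{2}sl ld andbT.
have := htot; rewrite -hs -(sum_load o' sD) (bigD1 x) //= [X in _ = X](bigD1 x) //=.
have : (\sum_(i < p + p | i != x) load p o' D i <= \sum_(i < p + p | i != x) m i)%N.
  by apply: leq_sum => y _; rewrite -sl; exact: ld.
by move=> h1 h2; rewrite -(leq_add2r (\sum_(i < p + p | i != x) m i)%N) h2 leq_add2l.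
Qed.

End Assembly.

(** * Saturation of the Newton polytope *)

(** The conditions defining a polymatroid are linear, so they pass to convex combinations, and a
    lattice point satisfying them belongs to the support. *)
Lemma polymatroid_snp (R : realType) n (f : {mpoly int[n]}) :
  discrete_polymatroid (mem (msupp f)) -> saturated_newton_polytope R f.
Proof.
case=> r _ hr m; split=> [hm|[k [c [a [c0 c1 ha e]]]]].
  exists 1%N, (fun=> 1), (fun=> real_point R m); split=> //.
  - by rewrite big_ord1.
  - by move=> _; exists m.
  by rewrite big_ord1 scale1r.
have [b hb] : exists b : 'I_k -> 'X_{1..n}, forall i, b i \in msupp f /\ a i = real_point R (b i).
  have h i : exists b, b \in msupp f /\ a i = real_point R b by have [b ? ?] := ha i; exists b.
  by have [b hb] := fin_all_exists h; exists b.
have mE j : (m j)%:R = \sum_(i < k) c i * (b i j)%:R :> R.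
  have := congr1 (fun v : 'rV_n => v 0 j) e; rewrite mxE => ->; rewrite summxE.
  by apply: eq_bigr => i _; rewrite (hb i).2 !mxE.
have sE (P : pred 'I_n) : (\sum_(j | P j) m j)%N%:R = \sum_(i < k) c i * (\sum_(j | P j) b i j)%N%:R :> R.
  rewrite natr_sum (eq_bigr _ (fun j _ => mE j)) exchange_big /=; apply: eq_bigr => i _.
  by rewrite natr_sum mulr_sumr.
have qE q : \sum_(i < k) c i * q = q by rewrite -mulr_suml c1 mul1r.
apply/hr; split=> [J hJ|].
  rewrite -(ler_nat R) sE -[X in _ <= X]qE; apply: ler_sum => i _.
  apply: ler_wpM2l => //; rewrite ler_nat.
  by have [/(_ J hJ)] := (hr (b i)).1 (hb i).1.
apply/eqP; rewrite -(eqr_nat R) sE -[X in _ == X]qE; apply/eqP/eq_bigr => i _.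
by have [_ ->] := (hr (b i)).1 (hb i).1.
Qed.

Theorem theoremA (R : realType) (p : nat) (hp : (1 <= p)%N) (pi : 'S_p)
    (f : {mpoly int[p + p]}) (hf : double_schubert pi f) :
  discrete_polymatroid (mem (msupp f)) /\ saturated_newton_polytope R f.
Proof.
suff h : discrete_polymatroid (mem (msupp f)) by split=> //; exact: polymatroid_snp.
have [r hr h] := pipe_exponent_polymatroid pi; exists r => // x.
by rewrite -h; exact: schubert_support.
Qed.
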